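(* Let $\alpha,\beta,N\geq 1$ be integers with $\gcd(\beta,N)=1$, and let $(X,0)\subset(\mathbb{C}^3,0)$ be the germ of toric hypersurface singularity with normalization map $$\eta:(\mathbb{C}^2,0)\to(X,0),\qquad (u,v)\mapsto(u,\;u^\alpha v^\beta,\;v^N).$$ Then the Lipschitz saturation $(X^s,0)$ is a toric surface singularity of multiplicity $N$ and embedding dimension $N+1$.
   Context: The germ $(X,0)$ is the germ at the origin of the hypersurface $y^N-x^{\alpha N}z^\beta=0$ in $\mathbb{C}^3$ with coordinates $(x,y,z)$, and via $\eta$ one has $\mathcal{O}_{X,0}=\mathbb{C}\{u,u^\alpha v^\beta,v^N\}\subset\overline{\mathcal{O}_{X,0}}=\mathbb{C}\{u,v\}$. Embedding dimension is the dimension of the Zariski tangent space; multiplicity is the Hilbert–Samuel multiplicity of the local ring. **Toric singularities.** Let $\Gamma\subset\mathbb{Z}^d$ be a finitely generated semigroup (containing $0$) with generators $\gamma_1,\dots,\gamma_n$, generating $\mathbb{Z}^d$ as a group and such that the cone $\mathbb{R}_{\ge 0}\Gamma$ is strongly convex. Let $X_\Gamma\subset\mathbb{C}^n$ be the affine toric variety defined by the kernel of $\mathbb{C}[z_1,\dots,z_n]\to\mathbb{C}[t_1^{\pm1},\dots,t_d^{\pm1}]$, $z_i\mapsto t^{\gamma_i}$. A germ $(X,0)$ is a germ of toric singularity if it is isomorphic to some $(X_\Gamma,0)$; it is a toric surface singularity if in addition it has dimension $2$. **Lipschitz saturation.** Let $(X,0)$ be a reduced irreducible germ of complex analytic space.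 Let $\overline{\mathcal{O}_{X,0}}$ be the integral closure of $\mathcal{O}_{X,0}$ in its field of fractions; it is the analytic algebra of the normalization $n:(\overline{X},0)\to(X,0)$. Let $I_\Delta$ be the kernel of the natural surjection $\mathcal{O}_{\overline{X}\times\overline{X},(0,0)}\to\mathcal{O}_{\overline{X}\times_X\overline{X},(0,0)}$. (If $(X,0)\subset(\mathbb{C}^k,0)$ and $n=(\eta_1,\dots,\eta_k)$, then $I_\Delta$ is generated by $\eta_i(x)-\eta_i(y)$, $i=1,\dots,k$.) For an ideal $I$, $\overline{I}$ denotes its integral closure. The Lipschitz saturation of $\mathcal{O}_{X,0}$ is $$\mathcal{O}_{X,0}^s=\{f\in\overline{\mathcal{O}_{X,0}} : f(x)-f(y)\in\overline{I_\Delta}\}.$$ It is an analytic algebra with $\mathcal{O}_{X,0}\subset\mathcal{O}_{X,0}^s\subset\overline{\mathcal{O}_{X,0}}$, and the Lipschitz saturation $(X^s,0)$ is the germ of analytic space with algebra $\mathcal{O}_{X,0}^s$. *)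

(* Defs.v *)
From HB Require Import structures.
From mathcomp Require Import all_boot all_order all_algebra.
From mathcomp Require Import boolp classical_sets reals.
From mathcomp Require Import complex.
From mathcomp Require Import mpoly.

Set Implicit Arguments.
Unset Strict Implicit.
Unset Printing Implicit Defensive.

Import Order.TTheory GRing.Theory Num.Theory.

Local Open Scope complex_scope.
Local Open Scope classical_set_scope.
Local Open Scope ring_scope.

Record fps (K : Type) (n : nat) : Type := FPS { fps_coef : 'X_{1..n} -> K }.

HB.instance Definition _ (K : Type) n := gen_eqMixin (fps K n).
HB.instance Definition _ (K : Type) n := gen_choiceMixin (fps K n).

Lemma fpsP (K : Type) n (f g : fps K n) :
  fps_coef f =1 fps_coef g -> f = g.
Proof. by case: f g => f [g] /= fg; congr FPS; apply: funext. Qed.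

Section FpsRing.
Variables (K : comNzRingType) (n : nat).
Implicit Types (f g h : fps K n) (m : 'X_{1..n}) (b : nat).

Definition fps_zero : fps K n := FPS (fun=> 0).
Definition fps_one : fps K n := FPS (fun m => (m == 0%MM)%:R).
Definition fps_opp f : fps K n := FPS (fun m => - fps_coef f m).
Definition fps_add f g : fps K n := FPS (fun m => fps_coef f m + fps_coef g m).
Definition fps_scale (c : K) f : fps K n := FPS (fun m => c * fps_coef f m).
Definition fps_mul f g : fps K n :=
  FPS (fun m => \sum_(k : 'X_{1..n < (mdeg m).+1, (mdeg m).+1}
                       | m == (k.1 + k.2)%MM) fps_coef f k.1 * fps_coef g k.2).

Definition fps_trunc b f : {mpoly K[n]} :=
  \sum_(m : 'X_{1..n < b}) fps_coef f m *: 'X_[m].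

Lemma mcoeff_trunc b f m : (mdeg m < b)%N -> (fps_trunc b f)@_m = fps_coef f m.
Proof. exact: mcoeff_mpoly. Qed.

Lemma mcoeff_mul_eq b (p p' q q' : {mpoly K[n]}) :
  (forall m, (mdeg m < b)%N -> p@_m = p'@_m) ->
  (forall m, (mdeg m < b)%N -> q@_m = q'@_m) ->
  forall m, (mdeg m < b)%N -> (p * q)@_m = (p' * q')@_m.
Proof.
move=> hp hq m hm; rewrite !(mcoeff_poly_mul _ _ hm).
by apply: eq_bigr => -[k1 k2] _ /=; rewrite hp ?hq ?bmdeg.
Qed.

Lemma fps_coefM b f g m : (mdeg m < b)%N ->
  fps_coef (fps_mul f g) m = (fps_trunc b f * fps_trunc b g)@_m.
Proof.
move=> hm; rewrite mcoeffM /=; apply: eq_bigr => -[k1 k2] _ /=.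
by rewrite !mcoeff_trunc // (leq_trans (bmdeg _)).
Qed.

Lemma trunc_mul b f g m : (mdeg m < b)%N ->
  (fps_trunc b (fps_mul f g))@_m = (fps_trunc b f * fps_trunc b g)@_m.
Proof. by move=> hm; rewrite mcoeff_trunc // (fps_coefM _ _ hm). Qed.

Lemma fps_addA : associative fps_add.
Proof. by move=> f g h; apply: fpsP => m /=; rewrite addrA. Qed.
Lemma fps_addC : commutative fps_add.
Proof. by move=> f g; apply: fpsP => m /=; rewrite addrC. Qed.
Lemma fps_add0 : left_id fps_zero fps_add.
Proof. by move=> f; apply: fpsP => m /=; rewrite add0r. Qed.
Lemma fps_addN : left_inverse fps_zero fps_opp fps_add.
Proof. by move=> f; apply: fpsP => m /=; rewrite addNr. Qed.

HB.instance Definition _ := GRing.isZmodule.Build (fps K n)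
  fps_addA fps_addC fps_add0 fps_addN.

Lemma fps_mulA : associative fps_mul.
Proof.
move=> f g h; apply: fpsP => m.
rewrite !(@fps_coefM (mdeg m).+1) //.
rewrite (mcoeff_mul_eq (b := (mdeg m).+1) (p' := fps_trunc (mdeg m).+1 f)
  (q' := fps_trunc (mdeg m).+1 g * fps_trunc (mdeg m).+1 h)) //;
  last by move=> k; apply: trunc_mul.
rewrite mulrA; apply/esym.
by apply: (mcoeff_mul_eq (b := (mdeg m).+1)) => // k; apply: trunc_mul.
Qed.

Lemma fps_mulC : commutative fps_mul.
Proof.
by move=> f g; apply: fpsP => m; rewrite !(@fps_coefM (mdeg m).+1) // mulrC.
Qed.

Lemma fps_mul1 : left_id fps_one fps_mul.
Proof.
move=> f; apply: fpsP => m; rewrite !(@fps_coefM (mdeg m).+1) //.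
rewrite (mcoeff_mul_eq (p' := 1) (q' := fps_trunc (mdeg m).+1 f)
  (b := (mdeg m).+1)) // ?mul1r ?mcoeff_trunc //.
by move=> k hk; rewrite mcoeff_trunc // mcoeff1.
Qed.

Lemma fps_mulDl : left_distributive fps_mul fps_add.
Proof.
move=> f g h; apply: fpsP => m; rewrite /= -big_split.
by apply: eq_bigr => k _ /=; rewrite mulrDl.
Qed.

Lemma fps_1neq0 : fps_one != fps_zero.
Proof.
apply/eqP => /(congr1 (fun f => fps_coef f 0%MM))/=.
by rewrite eqxx => /eqP; rewrite oner_eq0.
Qed.

HB.instance Definition _ := GRing.Zmodule_isComNzRing.Build (fps K n)
  fps_mulA fps_mulC fps_mul1 fps_mulDl fps_1neq0.

Lemma fps_scaleA (a c : K) f : fps_scale a (fps_scale c f) = fps_scale (a * c) f.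
Proof. by apply: fpsP => m /=; rewrite mulrA. Qed.
Lemma fps_scale1 : left_id 1 fps_scale.
Proof. by move=> f; apply: fpsP => m /=; rewrite mul1r. Qed.
Lemma fps_scaleDr : right_distributive fps_scale +%R.
Proof. by move=> a f g; apply: fpsP => m /=; rewrite mulrDr. Qed.
Lemma fps_scaleDl f : {morph fps_scale^~ f : a c / a + c}.
Proof. by move=> a c; apply: fpsP => m /=; rewrite mulrDl. Qed.

HB.instance Definition _ := GRing.Zmodule_isLmodule.Build K (fps K n)
  fps_scaleA fps_scale1 fps_scaleDr fps_scaleDl.

Lemma fps_scaleAl (a : K) f g : a *: (f * g) = a *: f * g.
Proof.
apply: fpsP => m; rewrite /= big_distrr.
by apply: eq_bigr => k _ /=; rewrite mulrA.
Qed.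

HB.instance Definition _ := GRing.Lmodule_isLalgebra.Build K (fps K n)
  fps_scaleAl.
HB.instance Definition _ := GRing.Lalgebra_isComAlgebra.Build K (fps K n).

Definition fps_of_mpoly (p : {mpoly K[n]}) : fps K n := FPS (fun m => p@_m).

End FpsRing.

(** The substitution of the variable [s i] for the [i]-th variable, [s] being
    injective: the coefficient of a monomial [m] is zero unless [m] only
    involves variables in the image of [s]. *)
Section Rename.
Variables (K : comNzRingType) (d e : nat) (s : 'I_d -> 'I_e).
Hypothesis s_inj : injective s.

Definition mnm_pull (m : 'X_{1..e}) : 'X_{1..d} := [multinom m (s i) | i < d].

Definition mnm_supported (m : 'X_{1..e}) : bool :=
  [forall j, (m j != 0%N) ==> (j \in codom s)].

Definition fps_rename (f : fps K d) : fps K e :=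
  FPS (fun m => if mnm_supported m then fps_coef f (mnm_pull m) else 0).

Definition mnm_push (l : 'X_{1..d}) : 'X_{1..e} :=
  [multinom (\sum_(i | s i == j) l i)%N | j < e].

Lemma mnm_pushK : cancel mnm_push mnm_pull.
Proof.
move=> l; apply/mnmP => i; rewrite !mnmE (big_pred1 i) // => j.
by rewrite /= (inj_eq s_inj).
Qed.

Lemma mnm_push_supp l : mnm_supported (mnm_push l).
Proof.
apply/forallP => j; apply/implyP; rewrite mnmE => h.
case: (pickP (fun i => s i == j)) => [i /eqP <-|h0]; first exact: codom_f.
by rewrite big_pred0 // in h.
Qed.

Lemma mnm_pullK m : mnm_supported m -> mnm_push (mnm_pull m) = m.
Proof.
move=> /forallP hm; apply/mnmP => j; rewrite mnmE.
have [/codomP[i ->]|hj] := boolP (j \in codom s).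
  rewrite (big_pred1 i) ?mnmE // => k.
  by rewrite /= (inj_eq s_inj).
have := hm j; rewrite (negbTE hj) implybF negbK => /eqP ->.
rewrite big_pred0 // => i; apply/negbTE/eqP => h.
by move: hj; rewrite -h codom_f.
Qed.

Lemma mdeg_push l : mdeg (mnm_push l) = mdeg l.
Proof.
rewrite !mdegE (partition_big s predT) //=.
by apply: eq_bigr => j _; rewrite mnmE.
Qed.

Lemma mdeg_pull m : mnm_supported m -> mdeg (mnm_pull m) = mdeg m.
Proof. by move=> hm; rewrite -[in RHS](mnm_pullK hm) mdeg_push. Qed.

Lemma mdeg_pull_le m : (mdeg (mnm_pull m) <= mdeg m)%N.
Proof.
rewrite !mdegE (partition_big s predT) //=.
apply: leq_sum => j _; case: (pickP (fun i => s i == j)) => [i /eqP <-|h0].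
  rewrite (big_pred1 i) ?mnmE // => k.
  by rewrite /= (inj_eq s_inj).
by rewrite big_pred0.
Qed.

Definition mp_rename : {mpoly K[d]} -> {mpoly K[e]} :=
  mmap (@mpolyC e K) (fun i => 'X_(s i)).
HB.instance Definition _ := GRing.RMorphism.on mp_rename.

Lemma mp_renameX l : mp_rename 'X_[l] = 'X_[mnm_push l].
Proof.
rewrite /mp_rename mmapX /mmap1 [RHS]mpolyXE_id.
rewrite [LHS](partition_big s predT) //=; apply: eq_bigr => j _.
rewrite mnmE expr_sum; apply: eq_bigr => i /eqP <- //.
Qed.

Lemma mp_renameC c : mp_rename c%:MP = c%:MP.
Proof. by rewrite /mp_rename mmapC. Qed.

Lemma mcoeff_rename (p : {mpoly K[d]}) m :
  (mp_rename p)@_m = if mnm_supported m then p@_(mnm_pull m) else 0.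
Proof.
elim/mpolyind: p => [|c l p _ _ IH].
  by rewrite raddf0 !mcoeff0 if_same.
rewrite raddfD /= !mcoeffD IH -mul_mpolyC rmorphM /= mp_renameC mp_renameX.
rewrite !mcoeffCM !mcoeffX; case: ifPn => hm.
  congr (_ * _%:R + _); congr nat_of_bool.
  by apply/eqP/eqP => [<-|->]; rewrite ?mnm_pushK ?mnm_pullK.
case: eqP => [h|_]; last by rewrite mulr0 addr0.
by rewrite -h mnm_push_supp in hm.
Qed.

Lemma fps_rename_is_zmod : zmod_morphism fps_rename.
Proof.
by move=> f g; apply: fpsP => m; rewrite /=; case: ifP => // _; rewrite subr0.
Qed.

Lemma fps_rename_trunc b f m : (mdeg m < b)%N ->
  (mp_rename (fps_trunc b f))@_m = fps_coef (fps_rename f) m.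
Proof.
move=> hm; rewrite mcoeff_rename /=; case: ifP => // hs.
by rewrite mcoeff_trunc // mdeg_pull.
Qed.

Lemma fps_rename_is_monoid : monoid_morphism fps_rename.
Proof.
split.
  apply: fpsP => m /=.
  have [hm|hm] := boolP (mnm_supported m).
    congr (nat_of_bool _)%:R; apply/eqP/eqP => [h|->].
      by apply/eqP; rewrite -mdeg_eq0 -(mdeg_pull hm) h mdeg0.
    by apply/mnmP => i; rewrite !mnmE.
  case: eqP => // h; move: hm; rewrite h => /forallPn[j].
  by rewrite mnm0E.
move=> f g; apply: fpsP => m.
rewrite (@fps_coefM _ _ (mdeg m).+1) //.
have -> : (fps_trunc (mdeg m).+1 (fps_rename f)
      * fps_trunc (mdeg m).+1 (fps_rename g))@_m
    = (mp_rename (fps_trunc (mdeg m).+1 f * fps_trunc (mdeg m).+1 g))@_m.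
  rewrite rmorphM /=.
  by apply: (@mcoeff_mul_eq _ _ (mdeg m).+1) => // k hk;
    rewrite mcoeff_trunc // fps_rename_trunc.
rewrite mcoeff_rename /=; case: ifP => // hm.
by rewrite -(@fps_coefM _ _ (mdeg m).+1) // mdeg_pull.
Qed.

Lemma fps_rename_scalable : scalable fps_rename.
Proof.
by move=> c f; apply: fpsP => m; rewrite /=; case: ifP => // _; rewrite mulr0.
Qed.

End Rename.

Section Convergent.
Variables (R : realType) (n : nat).
Implicit Types (f g : fps R[i] n) (r M : R).

Definition fps_norm_le r M f : Prop :=
  forall b, \sum_(m : 'X_{1..n < b})
    `|fps_coef f m| * r%:C ^+ mdeg m <= M%:C :> R[i].

(** [f] converges absolutely on a polydisc of positive radius. *)
Definition convergent : {pred fps R[i] n} :=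
  fun f => `[< exists r M, 0 < r /\ fps_norm_le r M f >].

Lemma fps_norm_leW r r' M f : 0 <= r' -> r' <= r ->
  fps_norm_le r M f -> fps_norm_le r' M f.
Proof.
move=> r0 rr' hf b; apply: le_trans (hf b); apply: ler_sum => m _.
by rewrite ler_wpM2l // lerXn2r ?nnegrE ?ler0c ?lecR // (le_trans r0).
Qed.

Lemma convergent2 f g : f \in convergent -> g \in convergent ->
  exists r M1 M2, [/\ 0 < r, fps_norm_le r M1 f & fps_norm_le r M2 g].
Proof.
move=> /asboolP[r1 [M1 [r10 h1]]] /asboolP[r2 [M2 [r20 h2]]].
exists (Num.min r1 r2), M1, M2; split; first by rewrite lt_min r10.
- by apply: fps_norm_leW h1; [rewrite le_min !ltW | rewrite ge_min lexx].
- by apply: fps_norm_leW h2; [rewrite le_min !ltW | rewrite ge_min lexx orbT].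
Qed.

Lemma convergentX (l : 'X_{1..n}) : fps_of_mpoly 'X_[l] \in convergent.
Proof.
apply/asboolP; exists 1, 1; split => // b.
have E (m : 'X_{1..n < b}) :
    `|fps_coef (fps_of_mpoly ('X_[l] : {mpoly R[i][n]})) m| * 1%:C ^+ mdeg m
    = (l == m)%:R :> R[i].
  by rewrite /= mcoeffX normr_nat expr1n mulr1.
rewrite (eq_bigr _ (fun m _ => E m)).
have [hl|hl] := ltnP (mdeg l) b.
  rewrite (bigD1 (BMultinom hl)) //= big1 ?addr0 ?eqxx // => m /negbTE hm.
  rewrite (_ : l == m = false) // eq_sym -hm.
  by rewrite -val_eqE.
rewrite big1 ?ler01 // => m _; case: eqP => [h|//].
by move: (bmdeg m); rewrite -h ltnNge hl.
Qed.

Lemma convergent_lin c f g : f \in convergent -> g \in convergent ->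
  c *: f + g \in convergent.
Proof.
move=> hf hg; have [r [M1 [M2 [r0 h1 h2]]]] := convergent2 hf hg.
apply/asboolP; exists r, (complex.Re `|c| * M1 + M2); split => // b.
have cE : `|c| = (complex.Re `|c|)%:C by rewrite normc_def.
rewrite rmorphD rmorphM /= -cE.
apply: le_trans (lerD (ler_wpM2l (normr_ge0 c) (h1 b)) (h2 b)).
rewrite mulr_sumr -big_split; apply: ler_sum => m _ /=.
rewrite mulrA -mulrDl; apply: ler_wpM2r.
  by rewrite exprn_ge0 // ler0c ltW.
by apply: (le_trans (ler_normD _ _)); rewrite normrM.
Qed.

Lemma convergentM f g : f \in convergent -> g \in convergent ->
  f * g \in convergent.
Proof.
move=> hf hg; have [r [M1 [M2 [r0 h1 h2]]]] := convergent2 hf hg.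
apply/asboolP; exists r, (M1 * M2); split => // b.
have rC : 0 <= r%:C by rewrite ler0c ltW.
rewrite rmorphM /=.
apply: le_trans (ler_pM _ _ (h1 b) (h2 b)); first last.
- by apply: sumr_ge0 => m _; rewrite mulr_ge0 ?exprn_ge0.
- by apply: sumr_ge0 => m _; rewrite mulr_ge0 ?exprn_ge0.
pose F (k : 'X_{1..n < b, b}) : R[i] := (`|fps_coef f k.1| * r%:C ^+ mdeg k.1)
  * (`|fps_coef g k.2| * r%:C ^+ mdeg k.2).
have F0 k : 0 <= F k by rewrite !mulr_ge0 ?exprn_ge0.
have -> : (\sum_(m : 'X_{1..n < b}) `|fps_coef f m| * r%:C ^+ mdeg m)
  * (\sum_(m : 'X_{1..n < b}) `|fps_coef g m| * r%:C ^+ mdeg m) = \sum_k F k.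
  rewrite big_distrlr pair_big /=; exact: eq_bigr.
apply: (@le_trans _ _ (\sum_(m : 'X_{1..n < b})
    \sum_(k : 'X_{1..n < b, b} | bmnm m == (k.1 + k.2)%MM) F k)).
  apply: ler_sum => m _; have /= -> := fps_coefM f g (bmdeg m).
  rewrite (mcoeff_poly_mul _ _ (bmdeg m)).
  apply: (le_trans (ler_wpM2r _ (ler_norm_sum _ _ _))); first exact: exprn_ge0.
  rewrite mulr_suml; apply: ler_sum => -[k1 k2] /= /eqP ->.
  rewrite /F /= !mcoeff_trunc ?bmdeg // normrM mdegD exprD.
  by rewrite mulrACA.
rewrite (exchange_big_dep xpredT) //=; apply: ler_sum => k _.
rewrite big_mkcond /=.
have [hk|hk] := ltnP (mdeg (k.1 + k.2)%MM) b.
  rewrite (bigD1 (BMultinom hk)) //= eqxx big1 ?addr0 // => m hm.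
  by rewrite -val_eqE /= in hm; rewrite (negbTE hm).
rewrite big1 // => m _; case: eqP => // h.
by move: (bmdeg m); rewrite h ltnNge hk.
Qed.

Lemma convergent1 : (1 : fps R[i] n) \in convergent.
Proof.
have -> : (1 : fps R[i] n) = fps_of_mpoly 'X_[0%MM]; last exact: convergentX.
by apply: fpsP => m /=; rewrite mcoeffX eq_sym.
Qed.

Lemma convergent_subalg : subalg_closed convergent.
Proof.
by split; [exact: convergent1 | exact: convergent_lin | exact: convergentM].
Qed.

HB.instance Definition _ :=
  GRing.isSubalgClosed.Build R[i] (fps R[i] n) convergent convergent_subalg.

(** The ring of convergent power series in [n] variables over the complex
    numbers. *)
Record cps : Type := CPS { cps_val :> fps R[i] n; _ : cps_val \in convergent }.

HB.instance Definition _ := [isSub for cps_val].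
HB.instance Definition _ := [Choice of cps by <:].
HB.instance Definition _ := [SubChoice_isSubComNzRing of cps by <:].
HB.instance Definition _ :=
  GRing.SubZmodule_isSubLmodule.Build R[i] _ _ cps
    convergent_subalg.
HB.instance Definition _ :=
  GRing.SubNzRing_SubLmodule_isSubLalgebra.Build R[i] _ _ cps.
HB.instance Definition _ := GRing.SubLalgebra_isSubAlgebra.Build R[i] _ _ cps.

Lemma fps_of_mpoly_convergent (p : {mpoly R[i][n]}) :
  fps_of_mpoly p \in convergent.
Proof.
elim/mpolyind: p => [|c m p _ _ IH].
  have -> : fps_of_mpoly 0 = 0 :> fps R[i] n.
    by apply: fpsP => m; rewrite /= mcoeff0.
  exact: (rpred0 convergent).
have -> : fps_of_mpoly (c *: 'X_[m] + p)
    = c *: fps_of_mpoly 'X_[m] + fps_of_mpoly p.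
  by apply: fpsP => k; rewrite /= mcoeffD mcoeffZ.
exact: convergent_lin (convergentX m) IH.
Qed.

Definition cps_of_mpoly (p : {mpoly R[i][n]}) : cps :=
  CPS (fps_of_mpoly_convergent p).

Definition cps_var (i : 'I_n) : cps := cps_of_mpoly 'X_i.

End Convergent.

Arguments convergent {R n}.

Section CpsRename.
Variables (R : realType) (d e : nat) (s : 'I_d -> 'I_e).
Hypothesis s_inj : injective s.

Lemma convergent_rename (f : fps R[i] d) :
  f \in convergent -> fps_rename s f \in convergent.
Proof.
move=> /asboolP[r [M [r0 hf]]]; apply/asboolP; exists r, M; split => // b.
apply: le_trans (hf b).
pose pull (m : 'X_{1..e < b}) : 'X_{1..d < b} :=
  BMultinom (leq_ltn_trans (mdeg_pull_le s_inj m) (bmdeg m)).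
have push_lt (l : 'X_{1..d < b}) : (mdeg (mnm_push s l) < b)%N.
  by rewrite mdeg_push bmdeg.
pose push (l : 'X_{1..d < b}) : 'X_{1..e < b} := BMultinom (push_lt l).
rewrite (bigID (fun m : 'X_{1..e < b} => mnm_supported s m)) /=.
rewrite [X in _ + X]big1 ?addr0; last first.
  by move=> m /negbTE ->; rewrite normr0 mul0r.
rewrite (reindex_onto push pull) /=; last first.
  by move=> m hm; apply: val_inj => /=; apply: mnm_pullK.
rewrite (eq_bigl xpredT); last first.
  move=> l /=; rewrite mnm_push_supp /=; apply/eqP; apply: val_inj => /=.
  exact: mnm_pushK.
apply: ler_sum => l _.
by rewrite mnm_push_supp mnm_pushK // mdeg_push.
Qed.

Definition cps_rename (f : cps R d) : cps R e :=
  CPS (convergent_rename (valP f)).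

Lemma cps_rename_is_zmod : zmod_morphism cps_rename.
Proof. by move=> f g; apply/val_inj/fps_rename_is_zmod. Qed.
Lemma cps_rename_is_monoid : monoid_morphism cps_rename.
Proof.
split=> [|f g]; apply: val_inj.
  exact: (fps_rename_is_monoid _ s_inj).1.
exact: (fps_rename_is_monoid _ s_inj).2.
Qed.
Lemma cps_rename_scalable : scalable cps_rename.
Proof. by move=> c f; apply/val_inj/fps_rename_scalable. Qed.

End CpsRename.

(** The two coordinate projections of the product of two copies of a smooth
    germ with coordinates [x] act on power series by [f |-> f(x)] and
    [f |-> f(y)], where [(x, y)] are the coordinates on the product. *)
Section Diagonal.
Variables (R : realType) (d : nat).

Definition cps_fst : cps R d -> cps R (d + d) :=
  cps_rename (@lshift_inj d d).
Definition cps_snd : cps R d -> cps R (d + d) :=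
  cps_rename (@rshift_inj d d).

HB.instance Definition _ := GRing.isZmodMorphism.Build _ _ cps_fst
  (@cps_rename_is_zmod R _ _ _ (@lshift_inj d d)).
HB.instance Definition _ := GRing.isMonoidMorphism.Build _ _ cps_fst
  (@cps_rename_is_monoid R _ _ _ (@lshift_inj d d)).
HB.instance Definition _ := GRing.isScalable.Build R[i] _ _ _ cps_fst
  (@cps_rename_scalable R _ _ _ (@lshift_inj d d)).
HB.instance Definition _ := GRing.isZmodMorphism.Build _ _ cps_snd
  (@cps_rename_is_zmod R _ _ _ (@rshift_inj d d)).
HB.instance Definition _ := GRing.isMonoidMorphism.Build _ _ cps_snd
  (@cps_rename_is_monoid R _ _ _ (@rshift_inj d d)).
HB.instance Definition _ := GRing.isScalable.Build R[i] _ _ _ cps_snd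
  (@cps_rename_scalable R _ _ _ (@rshift_inj d d)).

End Diagonal.

Section Ideals.
Variable A : comNzRingType.
Implicit Types (I J S : set A) (k : nat).

Definition ideal_gen S : set A := [set a | exists (n : nat) (c s : 'I_n -> A),
  (forall i, S (s i)) /\ a = \sum_(i < n) c i * s i].

Definition ideal_mul I J : set A :=
  ideal_gen [set a | exists x y, [/\ I x, J y & a = x * y]].

Fixpoint ideal_exp I k : set A :=
  if k is k'.+1 then ideal_mul I (ideal_exp I k') else setT.

Definition integral_closure I : set A := [set f | exists (n : nat) (a : nat -> A),
  [/\ (0 < n)%N,
      forall i, (1 <= i <= n)%N -> ideal_exp I i (a i) &
      f ^+ n + \sum_(1 <= i < n.+1) a i * f ^+ (n - i) = 0]].

Definition is_ideal I : Prop :=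
  [/\ I 0, forall x y, I x -> I y -> I (x + y) & forall a x, I x -> I (a * x)].

Definition prime_ideal I : Prop :=
  [/\ is_ideal I, ~ I 1 & forall x y, I (x * y) -> I x \/ I y].

Lemma ideal_genP S : is_ideal (ideal_gen S).
Proof.
split.
- exists 0%N, (fun=> 0), (fun=> 0); split; first by case.
  by rewrite big_ord0.
- move=> _ _ [n1 [c1 [s1 [h1 ->]]]] [n2 [c2 [s2 [h2 ->]]]].
  exists (n1 + n2)%N,
    (fun i => match split i with inl j => c1 j | inr j => c2 j end),
    (fun i => match split i with inl j => s1 j | inr j => s2 j end); split.
    by move=> i; case: (split i).
  rewrite big_split_ord /=; congr (_ + _); apply: eq_bigr => i _.
    by rewrite (unsplitK (inl i)).
  by rewrite (unsplitK (inr i)).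
- move=> a _ [n [c [s [h ->]]]]; exists n, (fun i => a * c i), s; split => //.
  by rewrite mulr_sumr; apply: eq_bigr => i _; rewrite mulrA.
Qed.

Lemma ideal_gen_sub S I : is_ideal I -> S `<=` I -> ideal_gen S `<=` I.
Proof.
move=> [I0 ID IM] SI _ [n [c [s [h ->]]]].
by elim/big_ind: _ => // i _; apply/IM/SI.
Qed.

Lemma sub_ideal_gen S : S `<=` ideal_gen S.
Proof.
move=> x Sx; exists 1%N, (fun=> 1), (fun=> x); split => //.
by rewrite big_ord1 mul1r.
Qed.

Lemma ideal_expP I k : is_ideal (ideal_exp I k).
Proof. by case: k => [|k] /=; [split | apply: ideal_genP]. Qed.

Lemma ideal_exp_mul I i j x y :
  ideal_exp I i x -> ideal_exp I j y -> ideal_exp I (i + j) (x * y).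
Proof.
have [_ IDj IMj] := ideal_expP I (i + j).
elim: i x {IDj IMj} => [|i IH] x /=.
  by have [_ _ IM] := ideal_expP I j => _ /IM.
move=> hx hy; move: x hx; rewrite -/(ideal_exp I (i + j).+1).
have [J0 JD JM] := ideal_expP I (i + j).+1.
apply: (@ideal_gen_sub _ [set x | ideal_exp I (i + j).+1 (x * y)]).
  split => /=; first by rewrite mul0r.
  - by move=> a b ha hb; rewrite mulrDl; apply: JD.
  - by move=> a b hb; rewrite -mulrA; apply: JM.
move=> _ [a [b [ha hb ->]]] /=; rewrite -mulrA; apply: sub_ideal_gen.
by exists a, (b * y); split => //; apply: IH.
Qed.

End Ideals.

(** The Rees algebra, used to show that the integral closure of an ideal is an
    ideal. *)
Section Rees.
Variables (A : comNzRingType) (I : set A).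

Definition rees_pred : {pred {poly A}} :=
  fun p => `[< forall i, ideal_exp I i p`_i >].

Lemma rees_subring : subring_closed rees_pred.
Proof.
split.
- apply/asboolP => i; rewrite coef1; case: i => [|i] //.
  by have [] := ideal_expP I i.+1.
- move=> p q /asboolP hp /asboolP hq; apply/asboolP => i.
  have [_ ID IM] := ideal_expP I i.
  by rewrite coefB -mulN1r; apply: ID => //; apply: IM.
- move=> p q /asboolP hp /asboolP hq; apply/asboolP => i.
  have [I0 ID IM] := ideal_expP I i.
  rewrite coefM; elim/big_ind: _ => // j _.
  by rewrite -[X in ideal_exp _ X](subnKC (leq_ord j)); apply: ideal_exp_mul.
Qed.

HB.instance Definition _ := GRing.isSubringClosed.Build _ rees_pred rees_subring.

Record rees := Rees { rees_val :> {poly A}; _ : rees_val \in rees_pred }.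
HB.instance Definition _ := [isSub for rees_val].
HB.instance Definition _ := [Choice of rees by <:].
HB.instance Definition _ := [SubChoice_isSubComNzRing of rees by <:].

Definition rees_incl : {rmorphism rees -> {poly A}} := val.
Local Notation rv := rees_incl.

Lemma integral_closureP f : integral_closure I f <->
  integralOver rees_incl (f *: 'X).
Proof.
split.
  move=> [n [a [n0 ha ea]]].
  have mem (i : nat) : (1 <= i <= n)%N -> a i *: 'X^i \in rees_pred.
    move=> hi; apply/asboolP => j; rewrite coefZ coefXn.
    have [J0 _ JM] := ideal_expP I j.
    case: eqP => [->|_]; last by rewrite mulr0.
    by rewrite mulr1; apply: ha.
  pose c (i : nat) : rees := insubd 0 (a (n - i)%N *: 'X^(n - i)).
  pose w i := rv (c i).
  have cE i : (i < n)%N -> w i = a (n - i)%N *: 'X^(n - i).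
    by move=> hi; rewrite /w /= insubdK // mem // subn_gt0 hi leq_subr.
  exists ('X^n + \poly_(i < n) c i).
    rewrite monicE lead_coefDl ?lead_coefXn //.
    by rewrite size_polyXn ltnS size_poly.
  rewrite /root rmorphD hornerD.
  have -> : (map_poly rv 'X^n).[f *: 'X] = (f *: 'X) ^+ n :> {poly A}.
    by rewrite map_polyXn hornerXn.
  have mE (u : rees) i :
      (map_poly rv (u *: 'X^i)).[f *: 'X] = rv u * (f *: 'X) ^+ i.
    by rewrite map_polyZ map_polyXn hornerZ hornerXn.
  rewrite poly_def rmorph_sum horner_sum (eq_bigr (fun i : 'I_n => w i * (f *: 'X) ^+ i)); last by move=> i _; exact: mE.
  clearbody w.
  have -> : \sum_(i < n) w i * (f *: 'X) ^+ i
     = (\sum_(1 <= i < n.+1) a i * f ^+ (n - i)) *: 'X^n.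
    rewrite scaler_suml.
    rewrite -(big_mkord xpredT (fun i => w i * (f *: 'X) ^+ i)).
    rewrite big_nat_rev /= add0n big_add1 /=.
    apply: eq_big_nat => i /andP[_ hi].
    rewrite cE ?ltn_subrL ?(leq_ltn_trans _ hi) //.
    rewrite subKn // exprZn -scalerAl -scalerAr scalerA -exprD subnKC //.
  by rewrite exprZn -scalerDl ea scale0r.
move=> [q mq rq]; set n := (size q).-1.
have sq : size q = n.+1 by rewrite prednK // size_poly_gt0 monic_neq0.
have hq i j : ideal_exp I i (rv q`_j)`_i by have /asboolP := valP q`_j; exact.
have n0 : (0 < n)%N.
  rewrite lt0n; apply/eqP => n00; move: rq.
  have -> : q = 1.
    rewrite [q]size1_polyC ?sq ?n00 //; congr _%:P.
    by rewrite -[RHS](monicP mq) lead_coefE sq n00.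
  by rewrite /root rmorph1 hornerC oner_eq0.
have := rootP rq.
have -> : (map_poly rv q).[f *: 'X] = \sum_(i < n.+1) rv q`_i * (f *: 'X) ^+ i.
  rewrite horner_coef size_map_poly_id0 ?sq; last first.
    by rewrite (monicP mq) rmorph1 oner_eq0.
  by apply: eq_bigr => i _; rewrite coef_map.
have : rv q`_n = 1 by rewrite /n -lead_coefE (monicP mq) rmorph1.
pose w i := rv q`_i; rewrite -[rv q`_n]/(w n).
rewrite (eq_bigr (fun i : 'I__ => w i * (f *: 'X) ^+ i)) // => wn e0.
have {}hq i j : ideal_exp I i (w j)`_i by exact: hq.
clearbody w; exists n, (fun i => (w (n - i)%N)`_i); split => //.
have := congr1 (fun p : {poly A} => p`_n) e0.
rewrite big_ord_recr coefD coef_sum coef0 wn mul1r => e1.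
rewrite -[RHS]e1 addrC; congr (_ + _); last first.
  by rewrite exprZn coefZ coefXn eqxx mulr1.
rewrite -(big_mkord xpredT (fun i => (w i * (f *: 'X) ^+ i)`_n)).
rewrite big_add1 /= [RHS]big_nat_rev /= add0n.
apply: eq_big_nat => i /andP[_ hi].
rewrite exprZn -scalerAr coefZ coefMXn ltnNge leq_subr /= subKn //.
by rewrite mulrC.
Qed.

Lemma integral_closure_is_ideal : is_ideal (integral_closure I).
Proof.
split.
- by apply/integral_closureP; rewrite scale0r; apply: (integral0 rv).
- move=> x y /integral_closureP hx /integral_closureP hy.
  by apply/integral_closureP; rewrite scalerDl; apply: (integral_add (RtoK := rv)).
- move=> c x [n [a [n0 ha ea]]].
  exists n, (fun i => c ^+ i * a i); split => //.
    by move=> i /ha; have [_ _ IM] := ideal_expP I i; apply: IM.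
  have := congr1 (fun t => c ^+ n * t) ea; rewrite mulr0 => e0; rewrite -[RHS]e0.
  rewrite mulrDr -exprMn mulr_sumr; congr (_ + _).
  apply: eq_big_nat => i /andP[_ hi].
  by rewrite exprMn mulrCA !mulrA -exprD subnK // mulrC.
Qed.

End Rees.

(** [eta] collects the components of the normalization
    [(C^d, 0) -> (X, 0) <= (C^k, 0)] of a germ whose normalization is smooth, so
    that [cps R d] is the integral closure of the algebra of [(X, 0)]. The ideal
    below is the kernel of the map from the algebra of the product of two copies
    of [(C^d, 0)] onto that of their fibre product over [(X, 0)]. *)
Section LipschitzSaturation.
Variables (R : realType) (d k : nat) (eta : 'I_k -> cps R d).

Definition diagonal_ideal : set (cps R (d + d)) :=
  ideal_gen (range (fun i => cps_fst (eta i) - cps_snd (eta i))).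

Definition lip_pred : {pred cps R d} :=
  fun f => `[< integral_closure diagonal_ideal (cps_fst f - cps_snd f) >].

Lemma lip_subalg : subalg_closed lip_pred.
Proof.
have [I0 ID IM] := integral_closure_is_ideal diagonal_ideal.
split.
- by apply/asboolP; rewrite !rmorph1 subrr.
- move=> c f g /asboolP hf /asboolP hg; apply/asboolP.
  have -> : cps_fst (c *: f + g) - cps_snd (c *: f + g)
    = c%:A * (cps_fst f - cps_snd f) + (cps_fst g - cps_snd g).
    by rewrite !linearP mulr_algl scalerDr addrACA.
  by apply: ID => //; apply: IM.
- move=> f g /asboolP hf /asboolP hg; apply/asboolP.
  rewrite !rmorphM /=.
  have -> : cps_fst f * cps_fst g - cps_snd f * cps_snd g
    = cps_fst f * (cps_fst g - cps_snd g) + cps_snd g * (cps_fst f - cps_snd f).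
    by rewrite !mulrBr addrA [cps_snd g * cps_fst f]mulrC subrK
      [cps_snd g * _]mulrC.
  by apply: ID; apply: IM.
Qed.

HB.instance Definition _ :=
  GRing.isSubalgClosed.Build R[i] (cps R d) lip_pred lip_subalg.

Record lipschitz_saturation : Type :=
  Lip { lip_val :> cps R d; _ : lip_val \in lip_pred }.

HB.instance Definition _ := [isSub for lip_val].
HB.instance Definition _ := [Choice of lipschitz_saturation by <:].
HB.instance Definition _ :=
  [SubChoice_isSubComNzRing of lipschitz_saturation by <:].
HB.instance Definition _ :=
  GRing.SubZmodule_isSubLmodule.Build R[i] _ _ lipschitz_saturation lip_subalg.
HB.instance Definition _ :=
  GRing.SubNzRing_SubLmodule_isSubLalgebra.Build R[i] _ _ lipschitz_saturation.
HB.instance Definition _ :=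
  GRing.SubLalgebra_isSubAlgebra.Build R[i] _ _ lipschitz_saturation.

End LipschitzSaturation.

Definition nonunits (A : comNzRingType) : set A :=
  [set a | ~ exists b, a * b = 1].

Definition prime_chain (A : comNzRingType) (k : nat) : Prop :=
  exists P : nat -> set A,
    (forall i, (i <= k)%N -> prime_ideal (P i)) /\
    (forall i, (i < k)%N -> P i `<` P i.+1).

Definition krull_dim (A : comNzRingType) (k : nat) : Prop :=
  prime_chain A k /\ ~ prime_chain A k.+1.

Section LocalAlgebra.
Variables (K : fieldType) (A : comAlgType K).

(** For subspaces [W <= V], the quotient [V / W] has dimension [n]. *)
Definition quot_dim (V W : set A) (n : nat) : Prop :=
  exists b : 'I_n -> A, (forall i, V (b i)) /\
    forall a, V a -> exists! c : 'rV[K]_n, W (a - \sum_(i < n) c 0 i *: b i).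

(** For a local algebra [A], the maximal ideal is [m = nonunits A], and the
    Zariski tangent space is the dual of [m / m ^ 2]. When the residue field is
    [K], as for analytic algebras, the length of [A / m ^ k] is its dimension
    over [K]. *)
Definition embedding_dim (n : nat) : Prop :=
  quot_dim (@nonunits A) (ideal_exp (@nonunits A) 2) n.

Definition hilbert_samuel_poly (p : {poly rat}) : Prop :=
  exists k0, forall k, (k0 <= k)%N ->
    exists2 l, quot_dim setT (ideal_exp (@nonunits A) k) l & p.[k%:R] = l%:R.

Definition hilbert_samuel_multiplicity (e : nat) : Prop :=
  exists (d : nat) (p : {poly rat}),
    [/\ krull_dim A d, hilbert_samuel_poly p, (size p <= d.+1)%N &
        p`_d * d`!%:R = e%:R].

End LocalAlgebra.

Section Toric.
Variables (R : realType) (d n : nat) (gamma : 'I_n -> 'rV[int]_d).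

Definition generates_lattice : Prop :=
  forall w : 'rV[int]_d, exists c : 'I_n -> int, w = \sum_(i < n) c i *: gamma i.

Definition in_cone (x : 'rV[R]_d) : Prop :=
  exists l : 'I_n -> R,
    (forall i, 0 <= l i) /\ x = \sum_(i < n) l i *: map_mx intr (gamma i).

Definition strongly_convex_cone : Prop :=
  forall x, in_cone x -> in_cone (- x) -> x = 0.

(** The Laurent monomial [t ^ gamma_i]; Laurent polynomials are viewed inside
    the field of rational functions in [t_1, ..., t_d]. *)
Definition laurent_monomial (i : 'I_n) : {fraction {mpoly R[i][d]}} :=
  \prod_(j < d) (tofrac ('X_j : {mpoly R[i][d]})) ^ (gamma i 0 j).

Definition toric_ideal : set {mpoly R[i][n]} :=
  [set p | mmap (fun c : R[i] => tofrac (c%:MP : {mpoly R[i][d]}))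
             laurent_monomial p = 0].

(** The ideal of convergent power series defining the germ at the origin. *)
Definition toric_germ_ideal : set (cps R n) :=
  ideal_gen [set cps_of_mpoly p | p in toric_ideal].

End Toric.

(** [A] is isomorphic to the quotient of [cps R n] by [J]. *)
Definition presented_by (R : realType) (A : comAlgType R[i]) (n : nat)
    (J : set (cps R n)) : Prop :=
  exists phi : {lrmorphism cps R n -> A},
    (forall a, exists f, phi f = a) /\ (forall f, phi f = 0 <-> J f).

Definition toric_singularity (R : realType) (A : comAlgType R[i]) : Prop :=
  exists (d n : nat) (gamma : 'I_n -> 'rV[int]_d),
    [/\ generates_lattice gamma, strongly_convex_cone R gamma &
        presented_by A (toric_germ_ideal gamma)].

Definition toric_surface_singularity (R : realType) (A : comAlgType R[i]) : Prop :=
  toric_singularity A /\ krull_dim A 2.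

(** The map [(u, v) |-> (u, u ^ alpha * v ^ beta, v ^ N)], which normalizes the
    germ at the origin of the surface [y ^ N = x ^ (alpha * N) * z ^ beta]. *)
Definition hypersurface_normalization (R : realType) (alpha beta N : nat) :
    'I_3 -> cps R 2 :=
  let u := cps_var R (0 : 'I_2) in
  let v := cps_var R (1 : 'I_2) in
  fun i => [:: u; u ^+ alpha * v ^+ beta; v ^+ N]`_i.

Lemma hypersurface_normalizationE (R : realType) (alpha beta N : nat) :
  let eta := hypersurface_normalization R alpha beta N in
  eta 1 ^+ N = eta 0 ^+ (alpha * N) * eta (inord 2) ^+ beta.
Proof.
rewrite /hypersurface_normalization /= inordK //=.
by rewrite exprMn -!exprM [(N * beta)%N]mulnC.
Qed.

(* Main.v *)
Require Import Defs.
From HB Require Import structures.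
From mathcomp Require Import all_boot all_order all_algebra.
From mathcomp Require Import boolp classical_sets reals complex mpoly.
From mathcomp Require Import mxpoly cyclic separable cyclotomic.
From mathcomp Require Import zify ring.

(** Write [t^m] for the monomial of exponent [m] in the coordinates [(u, v)] of
    the normalization. The saturation turns out to be monomial: it consists of
    the series all of whose exponents lie in the semigroup
<<
    Gamma = {(i, j) : N | j, or i >= alpha, j >= beta and
                      (beta | j or j >= N)}
>>
    and the whole theorem is read off from the combinatorics of [Gamma].

    The exponents of an element [f] of the saturation are in [Gamma]
    ([lip_supp]) because of two restrictions of [f(x) - f(y)], to surfaces of
    the form [x = (u, v)], [y = (u, w v)]. If [w] is a primitive [N]-th root of
    unity, the restriction of the diagonal ideal is contained in
    [(u^alpha v^beta)]; if [w] is a primitive [beta]-th root of unity, it is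
    contained in [(v^N)]. The restriction of [f(x) - f(y)] is [f] with the
    coefficient of each [t^m] multiplied by [1 - w^(m 1)], and it is integral
    over the restricted ideal, so that orders of vanishing bound the exponents
    ([integral_closure_order]).

    Conversely, [Gamma] is generated by [(1, 0)], [(0, N)] and, for every
    non-zero residue class modulo [N], the exponent [(alpha, j)] with [j] the
    least admissible element of the class. The differences of the corresponding
    monomials at [x] and [y] are integral over the diagonal ideal
    ([sat_gen_integral]). The only case which is not immediate is that of
    [u^alpha v^j] with [j >= beta] and [j >= N]: multiplication by
    [u^alpha (v1^j - v2^j)] sends each monomial of degree [beta + N] in
    [(v1, v2)] to a combination of such monomials with coefficients in the
    ideal, since any two monomials of the same large degree are linked by
    exchanging [beta] or [N] factors [v1] for as many factors [v2], and the
    determinant trick applies ([integral_closure_binomial]). General elements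
    follow because a series in the generators satisfies
    [F(X) - F(Y) = sum (X_l - Y_l) Q_l] with [Q_l] convergent ([hadamard]).

    Every element of [Gamma] has a unique expression [a (1, 0) + b (0, N)] plus
    at most one of the other generators, and this normal form has the largest
    number of summands among all the expressions ([mdeg_nf]). Therefore the
    [k]-th power of the maximal ideal consists of the series whose exponents have
    normal forms of length at least [k] ([max_ideal_expE]). Counting normal forms
    of length less than [k] gives the Hilbert-Samuel polynomial
    [N k^2 / 2 + (2 - N) k / 2], and the normal forms of length one are the
    [N + 1] generators. Rewriting words in the generators to normal form also
    shows that the kernel of [C{z_0, ..., z_N} -> C{u, v}] is generated by
    binomials ([Xparam_kernel]), which is the toric presentation.

    There remains the dimension. The saturation is integral over [C{u, v^N}], a
    ring of convergent series in two variables, so that its chains of primes are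
    not longer than those of that ring ([prime_chain_integral]). A chain of four
    primes of [C{u, v}] is excluded by Weierstrass division
    ([krull_dim_cps2_le]). *)

Set Implicit Arguments.
Unset Strict Implicit.
Unset Printing Implicit Defensive.

Import Order.TTheory GRing.Theory Num.Theory.

Local Open Scope complex_scope.
Local Open Scope classical_set_scope.
Local Open Scope ring_scope.

(** * Convergence as geometric growth of the coefficients *)

Section Growth.
Variable R : realType.
Local Notation K := R[i].

(** Taking a natural number as growth constant turns the later convergence
    estimates into inequalities between natural numbers. *)
Definition growth n (f : fps K n) (b : nat) : Prop :=
  forall m, `|fps_coef f m| <= (b ^ (mdeg m).+1)%:R.

Lemma growth_leq n (f : fps K n) b c : (b <= c)%N -> growth f b -> growth f c.
Proof.
by move=> bc hf m; apply: le_trans (hf m) _; rewrite ler_nat leq_exp2r.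
Qed.

(** Exponents of bounded degree sit in a box, over which sums of products factor
    into products of sums. *)
Definition mnm_box n b (m : 'X_{1..n < b.+1}) : {ffun 'I_n -> 'I_b.+1} :=
  [ffun i => inord (m i)].

Lemma mnm_boxE n b (m : 'X_{1..n < b.+1}) i : mnm_box m i = m i :> nat.
Proof.
rewrite ffunE inordK //; apply: leq_trans (bmdeg m); rewrite ltnS mdegE.
by rewrite (bigD1 i) //= leq_addr.
Qed.

Lemma mnm_box_inj n b : injective (@mnm_box n b).
Proof.
move=> m1 m2 h; apply/val_inj/mnmP => i.
by rewrite /= -!mnm_boxE h.
Qed.

Lemma card_bmultinom n b : (#|{: 'X_{1..n < b}}| <= b ^ n)%N.
Proof.
case: b => [|b].
  by rewrite eq_card0 // => m; have := bmdeg m.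
apply: leq_trans (leq_card _ (@mnm_box_inj n b)) _.
by rewrite card_ffun !card_ord.
Qed.

Lemma sum_geometric n b :
  \sum_(m : 'X_{1..n < b}) 2^-1 ^+ mdeg m <= 2 ^+ n :> K.
Proof.
case: b => [|b].
  by rewrite big_pred0 ?exprn_ge0 // => m; have := bmdeg m.
have h0 : 0 <= 2^-1 :> K by rewrite invr_ge0.
pose G (g : {ffun 'I_n -> 'I_b.+1}) : K := \prod_i 2^-1 ^+ g i.
have G0 g : 0 <= G g by apply: prodr_ge0 => i _; apply: exprn_ge0.
apply: (@le_trans _ _ (\sum_g G g)).
  have -> : \sum_(m : 'X_{1..n < b.+1}) 2^-1 ^+ mdeg m
      = \sum_(g in (@mnm_box n b) @: predT) G g.
    rewrite (big_imset _ (in2W (@mnm_box_inj n b))) /=.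
    apply: eq_big => [m|m _] //.
    rewrite mdegE expr_sum; apply: eq_bigr => i _.
    by rewrite mnm_boxE.
  by rewrite big_mkcond; apply: ler_sum => g _; case: ifP.
rewrite -(bigA_distr_bigA (fun (i : 'I_n) (j : 'I_b.+1) => 2^-1 ^+ j : K)) /=.
rewrite prodr_const card_ord; apply: lerXn2r; rewrite ?nnegrE //.
  by apply: sumr_ge0 => j _; apply: exprn_ge0.
have E k : \sum_(j < k) 2^-1 ^+ j = 2 - 2 * 2^-1 ^+ k :> K.
  elim: k => [|k IH]; first by rewrite big_ord0 expr0 mulr1 subrr.
  rewrite big_ord_recr /= IH exprS mulrA mulfV ?pnatr_eq0 // mul1r.
  by rewrite mulrDl mul1r opprD addrA subrK.
by rewrite E gerBl mulr_ge0 ?exprn_ge0.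
Qed.

Lemma norm_bound (x : K) : exists b : nat, `|x| <= b%:R.
Proof.
have [b hb] : exists b : nat, complex.Re `|x| <= b%:R.
  by exists (Num.bound (complex.Re `|x|)); apply/ltW/archi_boundP; rewrite normc_def /= sqrtr_ge0.
exists b; have -> : `|x| = (complex.Re `|x|)%:C by rewrite normc_def.
by rewrite -(rmorph_nat (real_complex R)) lecR.
Qed.

(** If the majorant series converges, each of its terms is at most its sum, which
    bounds the coefficients. Conversely, growth [b ^ (|m| + 1)] is compensated by
    the radius [1 / (2 b)], where the sum of [2 ^- |m|] over all exponents is at
    most [2 ^ n]. *)
Lemma convergentP n (f : fps K n) :
  (f \in convergent) <-> exists b, growth f b.
Proof.
split.
  move=> /asboolP[r [M [r0 hf]]].
  have [b1 h1] := norm_bound (M%:C); have [b2 h2] := norm_bound (r^-1%:C).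
  have r0C : 0 < r%:C :> K by rewrite ltcR.
  exists (b1 + b2)%N => m.
  have : `|fps_coef f m| * r%:C ^+ mdeg m <= b1%:R.
    have M0 : 0 <= M%:C :> K.
      apply: le_trans (hf 0%N); apply: sumr_ge0 => k _.
      by rewrite mulr_ge0 ?exprn_ge0 // ltW.
    rewrite (ger0_norm M0) in h1; apply: le_trans h1.
    apply: le_trans (hf (mdeg m).+1).
    rewrite (bigD1 (BMultinom (ltnSn (mdeg m)))) //= lerDl.
    by apply: sumr_ge0 => k _; rewrite mulr_ge0 ?exprn_ge0 // ltW.
  rewrite -ler_pdivlMr ?exprn_gt0 // => /le_trans; apply.
  rewrite natrX exprS -exprVn; apply: ler_pM => //.
  - by rewrite exprn_ge0 // invr_ge0 ltW.
  - by rewrite ler_nat leq_addr.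
  apply: lerXn2r; rewrite ?nnegrE ?invr_ge0 ?ler0n ?(ltW r0C) //.
  have -> : (r%:C)^-1 = (r^-1)%:C :> K by rewrite fmorphV.
  rewrite ger0_norm in h2; last by rewrite ler0c invr_ge0 ltW.
  apply: le_trans h2 _.
  by rewrite ler_nat leq_addl.
move=> [b0 /(growth_leq (leqnSn b0))]; move: b0.+1 (ltn0Sn b0) => b b_gt0 hf.
apply/asboolP; exists ((2 * b)%:R)^-1, (b * 2 ^ n)%:R; split.
  by rewrite invr_gt0 ltr0n muln_gt0.
move=> c; have b0' : b%:R != 0 :> K by rewrite pnatr_eq0 -lt0n.
rewrite fmorphV rmorph_nat.
apply: (@le_trans _ _ (\sum_(m : 'X_{1..n < c}) b%:R * 2^-1 ^+ mdeg m)).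
  apply: ler_sum => m _.
  rewrite natrM invfM exprMn mulrA mulrAC.
  apply: ler_wpM2r; first by rewrite exprn_ge0 // invr_ge0.
  rewrite exprVn ler_pdivrMr ?exprn_gt0 ?ltr0n // -exprS -natrX.
  exact: hf.
rewrite -mulr_sumr rmorph_nat natrM natrX ler_wpM2l //.
exact: sum_geometric.
Qed.

End Growth.

(** * Series of polynomials and monomial substitutions *)

Section SumFamily.
Variable R : realType.
Local Notation K := R[i].

Lemma bmultinom_sum_widen n a b (F : 'X_{1..n} -> K) : (a <= b)%N ->
  (forall k, (a <= mdeg k)%N -> F k = 0) ->
  \sum_(k : 'X_{1..n < b}) F k = \sum_(k : 'X_{1..n < a}) F k.
Proof.
move=> ab hF.
pose h (k : 'X_{1..n < a}) : 'X_{1..n < b} :=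
  BMultinom (leq_trans (bmdeg k) ab).
have h_inj : injective h by move=> k l /(congr1 val) /= /val_inj.
transitivity (\sum_(k in h @: predT) F k); last first.
  by rewrite (big_imset _ (in2W h_inj)).
rewrite [RHS]big_mkcond; apply: eq_bigr => k _; case: ifPn => // hk.
apply: hF; rewrite leqNgt; apply: contra hk => hk.
by apply/imsetP; exists (BMultinom hk) => //; apply: val_inj.
Qed.

Lemma bmultinom_sum1 n b (F : 'X_{1..n} -> K) k0 : (mdeg k0 < b)%N ->
  (forall k, k != k0 -> F k = 0) ->
  \sum_(k : 'X_{1..n < b}) F k = F k0.
Proof.
move=> h hF; rewrite (bigD1 (BMultinom h)) //= big1 ?addr0 // => k hk.
by apply: hF; rewrite -val_eqE in hk.
Qed.

Variables n d : nat.
Implicit Types (P : 'X_{1..n} -> {mpoly K[d]}) (F : fps K n) (q : {mpoly K[d]}).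

(** The two conditions under which the sum of [F_k P_k] makes sense for every
    convergent [F]: only finitely many [P_k] contribute to a given coefficient,
    at a rate linear in the degree, and the coefficients of [P_k] grow at most
    geometrically. *)
Definition dominated (D : nat) P : Prop := forall k m, (P k)@_m != 0 ->
  (mdeg k <= D * (mdeg m).+1)%N /\ `|(P k)@_m| <= (D ^ (mdeg k).+1)%:R.

Definition fps_sum D P F : fps K d := FPS (fun m =>
  \sum_(k : 'X_{1..n < (D * (mdeg m).+1).+1}) fps_coef F k * (P k)@_m).

(** The truncation degree in the definition is immaterial once it is large
    enough, which allows sums over different families to be compared. *)
Lemma fps_sumE D P F b m : dominated D P -> (D * (mdeg m).+1 < b)%N ->
  fps_coef (fps_sum D P F) m =
  \sum_(k : 'X_{1..n < b}) fps_coef F k * (P k)@_m.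
Proof.
move=> hP hb; apply/esym.
apply: (@bmultinom_sum_widen n _ _ (fun k => fps_coef F k * (P k)@_m)) => //.
move=> k hk; apply/eqP; rewrite mulf_eq0; apply/orP; right.
by apply/contraTT: hk => /hP[hk _]; rewrite -leqNgt.
Qed.

Lemma convergent_sum D P F : dominated D P -> F \in convergent ->
  fps_sum D P F \in convergent.
Proof.
move=> hP /convergentP[b hb]; apply/convergentP.
pose c := (b.+1 * D.+1)%N.
(* [2 ^ n] accounts for the number of indices and [c] for each of the terms; the
   exponent [D + 1] is the rate at which indices grow with the degree. *)
exists ((2 ^ n * c) ^ D.+1)%N => m /=.
have c0 : (0 < c)%N by rewrite muln_gt0.
apply: (le_trans (ler_norm_sum _ _ _)).
set s := (D * (mdeg m).+1)%N.
apply: (@le_trans _ _ (\sum_(k : 'X_{1..n < s.+1}) (c ^ s.+1)%:R)).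
  apply: ler_sum => k _; rewrite normrM.
  have [->|/hP[_ h2]] := eqVneq (P k)@_m 0; first by rewrite normr0 mulr0.
  apply: le_trans (ler_pM _ _ (hb k) h2) _ => //.
  rewrite -natrM ler_nat -expnMn.
  apply: (@leq_trans (c ^ (mdeg k).+1)%N).
    by rewrite leq_exp2r // leq_mul.
  by apply: leq_pexp2l => //; apply: bmdeg.
rewrite sumr_const -mulrnA ler_nat mulnC.
apply: (@leq_trans ((2 ^ n * c) ^ s.+1)%N).
  rewrite expnMn leq_mul2r; apply/orP; right.
  apply: leq_trans (card_bmultinom _ _) _.
  rewrite -expnM mulnC expnM.
  by case: (n) => // n'; rewrite leq_exp2r // ltnW // ltn_expl.
rewrite -expnM; apply: leq_pexp2l; first by rewrite muln_gt0 expn_gt0.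
by rewrite /s mulSn addSn ltnS leq_addl.
Qed.

(** A fixed factor [q] comes out of the sum of [F_k q P_k]. The left-hand side is
    a finite sum rather than [fps_sum], because multiplication by [q] may destroy
    the bounds with constant [D]. *)
Lemma fps_sum_mul D P F q m b : dominated D P -> (D * (mdeg m).+1 < b)%N ->
  \sum_(k : 'X_{1..n < b}) fps_coef F k * (q * P k)@_m
  = fps_coef (fps_of_mpoly q * fps_sum D P F) m.
Proof.
move=> hP hb.
transitivity (\sum_(k : 'X_{1..n < b}) \sum_(j : 'X_{1..d < (mdeg m).+1, (mdeg m).+1}
   | m == (j.1 + j.2)%MM) q@_j.1 * (fps_coef F k * (P k)@_j.2)).
  apply: eq_bigr => k _; rewrite mcoeffM mulr_sumr.
  by apply: eq_bigr => j _; rewrite mulrCA.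
rewrite exchange_big /=; apply: eq_bigr => -[j1 j2] /= /eqP hm.
rewrite -mulr_sumr -(fps_sumE (b := b) _ hP) //.
by apply: leq_ltn_trans hb; rewrite leq_mul // bmdeg.
Qed.

End SumFamily.

Section Substitution.
Variables (R : realType) (n d : nat).
Local Notation K := R[i].
Variables (c : 'I_n -> K) (g : 'I_n -> 'X_{1..d}).
Hypotheses (c_le1 : forall i, `|c i| <= 1) (g_neq0 : forall i, g i != 0%MM).

Definition mnm_subst (k : 'X_{1..n}) : 'X_{1..d} := (\sum_i g i *+ k i)%MM.

Lemma mnm_substD k l : mnm_subst (k + l) = (mnm_subst k + mnm_subst l)%MM.
Proof.
rewrite /mnm_subst -big_split; apply: eq_bigr => i _ /=; apply/mnmP => j.
by rewrite mulmnE !mnmDE !mulmnE mulnDr.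
Qed.

Lemma mnm_subst1 i : mnm_subst U_(i) = g i.
Proof.
rewrite /mnm_subst (bigD1 i) //= mnm1E eqxx mulm1n big1 ?addm0 // => j hj.
by rewrite mnm1E eq_sym (negbTE hj) mulm0n.
Qed.

Lemma mnm_subst0 : mnm_subst 0%MM = 0%MM.
Proof. by rewrite /mnm_subst big1 // => i _; rewrite mnm0E mulm0n. Qed.

Lemma mdeg_mnm_subst k : (mdeg k <= mdeg (mnm_subst k))%N.
Proof.
rewrite /mnm_subst mdeg_sum [X in (X <= _)%N]mdegE; apply: leq_sum => i _.
by rewrite mdegMn leq_pmull // lt0n mdeg_eq0.
Qed.

Definition mp_subst : {mpoly K[n]} -> {mpoly K[d]} :=
  mmap (@mpolyC d K) (fun i => c i *: 'X_[g i]).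
HB.instance Definition _ := GRing.RMorphism.on mp_subst.

Lemma mp_substZ a p : mp_subst (a *: p) = a *: mp_subst p.
Proof. by rewrite /mp_subst mmapZ mul_mpolyC. Qed.

Lemma mp_substX k :
  mp_subst 'X_[k] = (\prod_i c i ^+ k i) *: 'X_[mnm_subst k].
Proof.
rewrite /mp_subst mmapX /mmap1 -mul_mpolyC rmorph_prod /= /mnm_subst -mprodXE -big_split.
apply: eq_bigr => i _; rewrite exprZn mpolyXn.
by rewrite -mul_mpolyC rmorphXn.
Qed.

(** Since no variable is sent to a constant, the degree of a monomial does not
    drop, and the coefficients have absolute value at most 1. *)
Lemma mp_subst_dominated : dominated 1 (fun k => mp_subst 'X_[k]).
Proof.
move=> k m; rewrite mp_substX mcoeffZ mcoeffX mul1n.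
case: (mnm_subst k =P m) => [<-|_]; last by rewrite mulr0 eqxx.
rewrite mulr1 exp1n normr_prod => _.
split; first by apply: leq_trans (mdeg_mnm_subst k) _.
apply: (@le_trans _ _ (\prod_(i < n) 1)); last by rewrite prodr_const expr1n.
apply: ler_prod => i _; rewrite normr_ge0 normrX.
exact: exprn_ile1.
Qed.

Definition fps_subst : fps K n -> fps K d := fps_sum 1 (fun k => mp_subst 'X_[k]).

Lemma fps_subst_coef F b m : ((mdeg m).+1 < b)%N -> fps_coef (fps_subst F) m =
  \sum_(k : 'X_{1..n < b}) fps_coef F k * (mp_subst 'X_[k])@_m.
Proof. by move=> hb; apply: (fps_sumE _ mp_subst_dominated); rewrite mul1n. Qed.

Lemma fps_subst_mpoly p : fps_subst (fps_of_mpoly p) = fps_of_mpoly (mp_subst p).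
Proof.
apply: fpsP => m; pose b := (msize p + (mdeg m).+2)%N.
rewrite (@fps_subst_coef _ b); last by rewrite /b leq_addl.
rewrite /= {2}(mpolywE (k := b) (p := p)) ?leq_addr // rmorph_sum raddf_sum /=.
by apply: eq_bigr => k _; rewrite mp_substZ mcoeffZ.
Qed.

(** Coefficients of degree less than [b] of the image depend only on those of the
    argument: degrees do not drop under the substitution. *)
Lemma fps_subst_tame (F G : fps K n) b :
    (forall m, (mdeg m < b)%N -> fps_coef F m = fps_coef G m) ->
  forall m, (mdeg m < b)%N -> fps_coef (fps_subst F) m = fps_coef (fps_subst G) m.
Proof.
move=> h m hm; apply: eq_bigr => k _; have [hk|hk] := ltnP (mdeg k) b.
  by rewrite h.
rewrite mp_substX mcoeffZ mcoeffX; case: eqP => [e|_]; last by rewrite !mulr0.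
by have := mdeg_mnm_subst k; rewrite e leqNgt (leq_trans hm hk).
Qed.

Lemma fps_subst_is_zmod : zmod_morphism fps_subst.
Proof.
move=> f h; apply: fpsP => m /=; rewrite -sumrB.
by apply: eq_bigr => k _; rewrite mulrBl.
Qed.

Lemma fps_subst_scalable : scalable fps_subst.
Proof.
move=> a f; apply: fpsP => m /=; rewrite mulr_sumr.
by apply: eq_bigr => k _; rewrite mulrA.
Qed.

Lemma fps_trunc_eq b (F : fps K n) m : (mdeg m < b)%N ->
  fps_coef F m = fps_coef (fps_of_mpoly (fps_trunc b F)) m.
Proof. by move=> hm; rewrite /= mcoeff_trunc. Qed.

Lemma fps_of_mpolyM e (p q : {mpoly K[e]}) :
  fps_of_mpoly (p * q) = fps_of_mpoly p * fps_of_mpoly q.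
Proof. by apply: fpsP => m; rewrite /= mcoeffM. Qed.

Lemma fps_subst_mpolyM p q :
  fps_subst (fps_of_mpoly p * fps_of_mpoly q)
  = fps_subst (fps_of_mpoly p) * fps_subst (fps_of_mpoly q).
Proof.
rewrite -(fps_of_mpolyM p q) !fps_subst_mpoly.
have -> : mp_subst (p * q) = mp_subst p * mp_subst q by exact: rmorphM.
exact: fps_of_mpolyM.
Qed.

Lemma fps_tameM e (F F' G G' : fps K e) b :
  (forall m, (mdeg m < b)%N -> fps_coef F m = fps_coef F' m) ->
  (forall m, (mdeg m < b)%N -> fps_coef G m = fps_coef G' m) ->
  forall m, (mdeg m < b)%N -> fps_coef (F * G) m = fps_coef (F' * G') m.
Proof.
move=> hF hG m hm; apply: eq_bigr => -[k1 k2] _ /=.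
by rewrite hF ?hG // ?(leq_trans (bmdeg _)).
Qed.

(** Up to any given degree, the arguments may be replaced by polynomials, for
    which the substitution is a morphism. *)
Lemma fps_subst_is_monoid : monoid_morphism fps_subst.
Proof.
split.
  have E e : (1 : fps K e) = fps_of_mpoly 1.
    by apply: fpsP => m /=; rewrite mcoeff1.
  by rewrite !E fps_subst_mpoly rmorph1.
move=> F G; apply: fpsP => m; set b := (mdeg m).+1.
have ht (H : fps K n) k : (mdeg k < b)%N ->
    fps_coef H k = fps_coef (fps_of_mpoly (fps_trunc b H)) k.
  exact: fps_trunc_eq.
rewrite (fps_subst_tame (fps_tameM (ht F) (ht G)) (ltnSn _)).
rewrite fps_subst_mpolyM.
have hs (H : fps K n) k : (mdeg k < b)%N ->
    fps_coef (fps_subst (fps_of_mpoly (fps_trunc b H))) k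
    = fps_coef (fps_subst H) k.
  by move: k; apply: fps_subst_tame => l hl; rewrite -(fps_trunc_eq _ hl).
exact: (fps_tameM (hs F) (hs G) (ltnSn _)).
Qed.

Definition cps_subst (F : cps R n) : cps R d :=
  CPS (convergent_sum mp_subst_dominated (valP F)).

Lemma cps_subst_is_zmod : zmod_morphism cps_subst.
Proof. by move=> f h; apply/val_inj/fps_subst_is_zmod. Qed.
Lemma cps_subst_is_monoid : monoid_morphism cps_subst.
Proof.
split=> [|f h]; apply: val_inj; first exact: fps_subst_is_monoid.1.
exact: fps_subst_is_monoid.2.
Qed.
Lemma cps_subst_scalable : scalable cps_subst.
Proof. by move=> a f; apply/val_inj/fps_subst_scalable. Qed.

HB.instance Definition _ := GRing.isZmodMorphism.Build _ _ cps_subst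
  cps_subst_is_zmod.
HB.instance Definition _ := GRing.isMonoidMorphism.Build _ _ cps_subst
  cps_subst_is_monoid.
HB.instance Definition _ := GRing.isScalable.Build K _ _ _ cps_subst
  cps_subst_scalable.

End Substitution.

Section Tame.
Variable R : realType.
Local Notation K := R[i].

Definition agree n b (F G : fps K n) : Prop :=
  forall m, (mdeg m < b)%N -> fps_coef F m = fps_coef G m.

(** Continuity for the degree filtration. *)
Definition tame n d (f : cps R n -> cps R d) : Prop :=
  forall (F G : cps R n) b, agree b F G -> agree b (f F) (f G).

Lemma tame_comp n d e (f : cps R n -> cps R d) (h : cps R d -> cps R e) :
  tame f -> tame h -> tame (h \o f).
Proof. by move=> hf hh F G b /hf/hh. Qed.

Lemma cps_subst_tame n d c (g : 'I_n -> 'X_{1..d}) c_le1 g_neq0 :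
  tame (@cps_subst R n d c g c_le1 g_neq0).
Proof. by move=> F G b h; apply: fps_subst_tame. Qed.

Lemma cps_rename_tame n d s (s_inj : injective s) :
  tame (@cps_rename R n d s s_inj).
Proof.
move=> F G b h m hm /=; case: ifP => // hs; apply: h.
by rewrite mdeg_pull.
Qed.

Lemma cps_of_mpolyB n (p q : {mpoly K[n]}) :
  cps_of_mpoly (p - q) = cps_of_mpoly p - cps_of_mpoly q.
Proof. by apply/val_inj/fpsP => m; rewrite /= mcoeffB. Qed.
Lemma cps_of_mpolyM n (p q : {mpoly K[n]}) :
  cps_of_mpoly (p * q) = cps_of_mpoly p * cps_of_mpoly q.
Proof. by apply/val_inj/fps_of_mpolyM. Qed.
Lemma cps_of_mpoly1 n : cps_of_mpoly (1 : {mpoly K[n]}) = 1.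
Proof. by apply/val_inj/fpsP => m; rewrite /= mcoeff1. Qed.
Lemma cps_of_mpolyZ n a (p : {mpoly K[n]}) :
  cps_of_mpoly (a *: p) = a *: cps_of_mpoly p.
Proof. by apply/val_inj/fpsP => m; rewrite /= mcoeffZ. Qed.

HB.instance Definition _ n := GRing.isZmodMorphism.Build _ _
  (@cps_of_mpoly R n) (@cps_of_mpolyB n).
HB.instance Definition _ n := GRing.isMonoidMorphism.Build _ _
  (@cps_of_mpoly R n) (conj (@cps_of_mpoly1 n) (@cps_of_mpolyM n)).
HB.instance Definition _ n := GRing.isScalable.Build K _ _ _
  (@cps_of_mpoly R n) (@cps_of_mpolyZ n).

(** Polynomials are dense for the degree filtration. *)
Lemma cps_lrmorphism_eq n d (f h : {lrmorphism cps R n -> cps R d}) :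
  tame f -> tame h -> (forall i, f (cps_var R i) = h (cps_var R i)) -> f =1 h.
Proof.
move=> tf th fh F; apply/val_inj/fpsP => m; set b := (mdeg m).+1.
have hp p : f (cps_of_mpoly p) = h (cps_of_mpoly p).
  elim/mpolyind: p => [|a k p _ _ IH]; first by rewrite !raddf0.
  have -> : cps_of_mpoly (a *: 'X_[k] + p)
    = a *: cps_of_mpoly 'X_[k] + cps_of_mpoly p by exact: linearP.
  rewrite !linearP; congr (_ *: _ + _); last exact: IH.
  suff: f (cps_of_mpoly 'X_[k]) = h (cps_of_mpoly 'X_[k]) by [].
  rewrite mpolyXE_id !rmorph_prod /=; apply: eq_bigr => i _.
  by rewrite !rmorphXn /=; congr (_ ^+ _); apply: fh.
have hb : agree b F (cps_of_mpoly (fps_trunc b F)).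
  by move=> k hk; apply: fps_trunc_eq.
by rewrite (tf _ _ _ hb) ?(th _ _ _ hb) ?hp.
Qed.

End Tame.

(** * Telescoping families of polynomials *)

Section Telescope.
Variable R : realType.
Local Notation K := R[i].

Lemma mcoeff_mulX d (p : {mpoly K[d]}) (a m : 'X_{1..d}) :
  ('X_[a] * p)@_m = if (a <= m)%MM then p@_(m - a) else 0.
Proof.
rewrite mulrC; case: ifP => h.
  by rewrite -[in LHS](submK h) addmC mcoeffMX.
apply: memN_msupp_eq0; rewrite (perm_mem (msuppMX _ _)).
by apply/negP => /mapP[l _ e]; rewrite e lem_addr in h.
Qed.

Lemma mnm_ind n (P : 'X_{1..n} -> Prop) :
  P 0%MM -> (forall k r, P k -> P (k + U_(r))%MM) -> forall k, P k.
Proof.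
move=> P0 PS k; have [s] := ubnP (mdeg k); elim: s k => // s IH k.
have [->|k0] := eqVneq k 0%MM; first by [].
have [r hr] : exists r, k r != 0%N.
  apply/existsP; apply: contraNT k0; rewrite negb_exists => /forallP h.
  by apply/eqP/mnmP => r; rewrite mnm0E; apply/eqP; move: (h r); rewrite negbK.
have hk : (U_(r) <= k)%MM by rewrite lep1mP.
rewrite -(submK hk) mdegD mdeg1 addn1 ltnS => hs.
by apply/PS/IH.
Qed.

(** Unfolding the recursion writes every [E_k] as a combination of the [G_i], with
    coefficients [P_{k,i}] that are sums of at most [|k|] monomials of degree at
    least [|k| / D - 1]. These bounds are what makes the coefficients
    [Q_i = sum_k F_k P_{k,i}] of the [G_i] in [sum_k F_k E_k] converge. The same
    recursion governs the difference of two monomial substitutions and the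
    rewriting of monomials to normal form. *)
Lemma telescope n d (I : finType) (G : I -> {mpoly K[d]})
    (E : 'X_{1..n} -> {mpoly K[d]}) (a : 'I_n -> 'X_{1..d}) (D : nat) :
    (1 < D)%N -> (forall r, a r != 0%MM) -> E 0%MM = 0 ->
    (forall k r, exists i y, (mdeg k < D * (mdeg y).+1)%N /\
       E (k + U_(r))%MM = 'X_[a r] * E k + G i * 'X_[y]) ->
  forall F : cps R n, exists Q : I -> cps R d,
  forall b m, (D * (mdeg m).+1 < b)%N ->
  \sum_(k : 'X_{1..n < b}) fps_coef F k * (E k)@_m
    = fps_coef (\sum_i cps_of_mpoly (G i) * Q i : cps R d) m.
Proof.
move=> D1 a0 E0 ES F.
have /choice[P hP] k : exists P : I -> {mpoly K[d]}, E k = \sum_i G i * P i /\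
    forall i m, (P i)@_m != 0 -> (mdeg k <= D * (mdeg m).+1)%N /\
      `|(P i)@_m| <= (mdeg k)%:R.
  elim/mnm_ind: k => [|k r [P [EP hP]]].
    exists (fun=> 0); split => [|i m]; last by rewrite mcoeff0 eqxx.
    by rewrite E0 big1 // => i _; rewrite mulr0.
  have [i [y [ky ->]]] := ES k r.
  exists (fun j => 'X_[a r] * P j + (j == i)%:R *: 'X_[y]); split.
    rewrite [RHS](eq_bigr (fun j => 'X_[a r] * (G j * P j)
      + G j * ((j == i)%:R *: 'X_[y]))); last first.
      by move=> j _; rewrite mulrDr mulrCA.
    rewrite EP mulr_sumr big_split /=; congr (_ + _); rewrite (bigD1 i) //= eqxx scale1r.
    by rewrite big1 ?addr0 // => j /negbTE ->; rewrite scale0r mulr0.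
  move=> j m; rewrite mcoeffD mcoeff_mulX mcoeffZ mcoeffX mdegD mdeg1 addn1.
  set A := if _ then _ else _; set B := _ * _ => AB0.
  have hA : A != 0 -> (mdeg k < D * (mdeg m).+1)%N.
    rewrite /A; case: ifP => [am|_]; last by rewrite eqxx.
    move=> /hP[h _]; apply: leq_ltn_trans h _.
    rewrite ltn_pmul2l ?(ltnW D1) // ltnS -[in X in (_ < X)%N](submK am) mdegD.
    by rewrite -[X in (X < _)%N]addn0 ltn_add2l lt0n mdeg_eq0.
  have hB : B != 0 -> (mdeg k < D * (mdeg m).+1)%N.
    rewrite /B; case: (y =P m) => [<- //|_]; by rewrite mulr0 eqxx.
  split.
    have [A0|/hA //] := eqVneq A 0; apply: hB; apply: contraNneq AB0 => ->.
    by rewrite A0 addr0.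
  rewrite -addn1 natrD; apply: (le_trans (ler_normD _ _)); apply: lerD.
    rewrite /A; case: ifP => [am|_]; last by rewrite normr0.
    have [->|/hP[]//] := eqVneq (P j)@_(m - a r) 0; by rewrite normr0.
  by rewrite /B -natrM normr_nat ler_nat; case: (j == i); case: (y == m).
pose Q i := fun k => P k i.
have hQ i : dominated D (Q i).
  move=> k m /(proj2 (hP k))[-> h]; split => //; apply: le_trans h _.
  by rewrite ler_nat; apply: leq_trans (leqnSn _) (ltnW _); apply: ltn_expl.
exists (fun i => CPS (convergent_sum (hQ i) (valP F))) => b m hb.
transitivity (\sum_(k : 'X_{1..n < b}) \sum_i fps_coef F k * (G i * Q i k)@_m).
  apply: eq_bigr => k _; rewrite (proj1 (hP k)) raddf_sum /= mulr_sumr.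
  by [].
rewrite exchange_big /=.
have S (J : seq I) (H : I -> cps R d) : fps_coef (\sum_(i <- J) H i : cps R d) m
    = \sum_(i <- J) fps_coef (H i) m.
  by elim: J => [|i J IH]; rewrite ?big_nil // !big_cons -IH.
rewrite S; apply: eq_bigr => i _ /=; exact: fps_sum_mul.
Qed.

End Telescope.

(** * Orders of vanishing and integral closure *)

Section FpsSupport.
Variables (K : comNzRingType) (n : nat).
Implicit Types (f g : fps K n) (m p q : 'X_{1..n}).

Lemma fps_coefD f g m : fps_coef (f + g) m = fps_coef f m + fps_coef g m.
Proof. by []. Qed.

Lemma fps_coefN f m : fps_coef (- f) m = - fps_coef f m.
Proof. by []. Qed.

Lemma fps_coef_sum (I : Type) (r : seq I) (P : pred I) (F : I -> fps K n) m :
  fps_coef (\sum_(i <- r | P i) F i) m = \sum_(i <- r | P i) fps_coef (F i) m.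
Proof.
elim: r => [|i r IH]; first by rewrite !big_nil.
by rewrite !big_cons; case: ifP => // _; rewrite fps_coefD IH.
Qed.

Lemma fps_coefM_supp f g m : fps_coef (f * g) m != 0 ->
  exists k l, [/\ m = (k + l)%MM, fps_coef f k != 0 & fps_coef g l != 0].
Proof.
move=> h; apply: contrapT => hn; move/eqP: h; apply.
rewrite [LHS]big1 // => -[k1 k2] /= /eqP hm.
have [->|h1] := eqVneq (fps_coef f k1) 0; first by rewrite mul0r.
have [->|h2] := eqVneq (fps_coef g k2) 0; first by rewrite mulr0.
by case: hn; exists k1, k2.
Qed.

(** The product of two extremal coefficients does not interfere with the rest of
    the convolution. *)
Lemma fps_coefM1 f g p q :
  (forall k l, (k + l = p + q)%MM -> fps_coef f k != 0 -> fps_coef g l != 0 ->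
     k = p /\ l = q) ->
  fps_coef (f * g) (p + q)%MM = fps_coef f p * fps_coef g q.
Proof.
move=> h; have hp : (mdeg p < (mdeg (p + q)).+1)%N by rewrite ltnS mdegD leq_addr.
have hq : (mdeg q < (mdeg (p + q)).+1)%N by rewrite ltnS mdegD leq_addl.
rewrite [LHS](bigD1 (BMultinom hp, BMultinom hq)) //= big1 ?addr0 //.
move=> [k1 k2] /= /andP[/eqP hm hk].
have [->|h1] := eqVneq (fps_coef f k1) 0; first by rewrite mul0r.
have [->|h2] := eqVneq (fps_coef g k2) 0; first by rewrite mulr0.
have [e1 e2] := h _ _ (esym hm) h1 h2.
by move: hk; rewrite xpair_eqE !bmeqP /= e1 e2 !eqxx.
Qed.

End FpsSupport.

Section Leading.
Variable K : idomainType.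
Variables (i j : 'I_2).
Hypothesis ij : i != j.
Implicit Types (f g : fps K 2) (m p q : 'X_{1..2}).

Lemma mnm2P p q : p i = q i -> p j = q j -> p = q.
Proof.
move=> hi hj; apply/mnmP => k; suff /orP[/eqP->|/eqP->] : (k == i) || (k == j) by [].
move: ij; rewrite -!val_eqE /=.
by case: i j k => [[|[|?]] ?] [[|[|?]] ?] [[|[|?]] ?].
Qed.

(** The first comparison is by the exponent [i], whose minimum over the support is
    the order of vanishing along a coordinate axis; the exponent [j] only breaks
    ties, so that leading exponents are unique and add up in products. *)
Definition lex2 p m := (p i < m i)%N || ((p i == m i) && (p j <= m j)%N).

Definition leading f p := fps_coef f p != 0 /\
  forall m, fps_coef f m != 0 -> lex2 p m.

Lemma leading_exists f : f != 0 -> exists p, leading f p.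
Proof.
move=> f0; pose P a := `[< exists m, fps_coef f m != 0 /\ m i = a >].
have exP : exists a, P a.
  have [m hm] : exists m, fps_coef f m != 0.
    apply: contrapT => h; move/eqP: f0; apply; apply: fpsP => m.
    by apply/eqP; apply: contrapT => hm; apply: h; exists m; apply/negP.
  by exists (m i); apply/asboolP; exists m.
have [a /asboolP[m0 [m0f m0a]] amin] := ex_minnP exP.
pose P' b := `[< exists m, [/\ fps_coef f m != 0, m i = a & m j = b] >].
have exP' : exists b, P' b by exists (m0 j); apply/asboolP; exists m0.
have [b /asboolP[p [pf pa pb]] bmin] := ex_minnP exP'.
exists p; split => // m hm; rewrite /lex2 pa pb.
have : (a <= m i)%N by apply: amin; apply/asboolP; exists m.
rewrite leq_eqVlt => /orP[/eqP e|->//]; rewrite e eqxx ltnn /=.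
by apply: bmin; apply/asboolP; exists m.
Qed.

Lemma leadingM f g p q : leading f p -> leading g q -> leading (f * g) (p + q)%MM.
Proof.
move=> [pf hf] [qg hg]; split.
  rewrite fps_coefM1 ?mulf_neq0 // => k l e /hf hk /hg hl.
  have ei := congr1 (fun m : 'X_{1..2} => m i) e.
  have ej := congr1 (fun m : 'X_{1..2} => m j) e.
  rewrite !mnmDE in ei ej; move: hk hl; rewrite /lex2 => hk hl.
  by split; apply: mnm2P; lia.
move=> m /fps_coefM_supp[k [l [-> /hf hk /hg hl]]].
by move: hk hl; rewrite /lex2 !mnmDE; lia.
Qed.

Lemma leadingX f p n : leading f p -> leading (f ^+ n) (p *+ n)%MM.
Proof.
move=> h; elim: n => [|n IH]; last by rewrite exprS mulmS; apply: leadingM.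
rewrite mulm0n expr0; split; first by rewrite /= eqxx oner_eq0.
by move=> m /=; case: (m =P 0%MM) => [->|_]; rewrite /lex2 ?eqxx // ltnn leqnn.
Qed.

End Leading.

Lemma fps2_mul_eq0 (K : idomainType) (f g : fps K 2) :
  f * g = 0 -> f = 0 \/ g = 0.
Proof.
have [->|f0] := eqVneq f 0; first by left.
have [->|g0] := eqVneq g 0; first by right.
have ij : (0 : 'I_2) != 1 by [].
have [p hp] := leading_exists 0 1 f0; have [q hq] := leading_exists 0 1 g0.
by have [] := leadingM ij hp hq => /[swap] _ /[swap] ->; rewrite eqxx.
Qed.

Section IntegralClosureMaps.
Variables (A B : comNzRingType) (phi : {rmorphism A -> B}).

Lemma ideal_exp_rmorph (I : set A) (J : set B) k x :
  (forall y, I y -> J (phi y)) -> ideal_exp I k x -> ideal_exp J k (phi x).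
Proof.
move=> IJ; elim: k x => // k IH x [n [c [s [hs ->]]]].
exists n, (phi \o c), (phi \o s); split.
  move=> i; have [y [z [Iy Iz e]]] := hs i.
  by exists (phi y), (phi z); rewrite /= e rmorphM; split; auto.
by rewrite rmorph_sum; apply: eq_bigr => i _; rewrite rmorphM.
Qed.

Lemma integral_closure_rmorph (I : set A) (J : set B) x :
  (forall y, I y -> J (phi y)) -> integral_closure I x ->
  integral_closure J (phi x).
Proof.
move=> IJ [n [a [n0 ha e]]]; exists n, (phi \o a); split => //.
  by move=> i /ha; apply: ideal_exp_rmorph.
have := congr1 phi e; rewrite rmorph0 => e0; rewrite -[RHS]e0 rmorphD rmorphXn rmorph_sum.
congr (_ + _); apply: eq_bigr => l _; by rewrite rmorphM rmorphXn.
Qed.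

End IntegralClosureMaps.

Section CpsVal.
Variables (R : realType) (n : nat).
Implicit Types x y : cps R n.

Lemma cps_valD x y : cps_val (x + y) = cps_val x + cps_val y.
Proof. by []. Qed.
Lemma cps_valB x y : cps_val (x - y) = cps_val x - cps_val y.
Proof. by []. Qed.
Lemma cps_valM x y : cps_val (x * y) = cps_val x * cps_val y.
Proof. by []. Qed.
Lemma cps_valX x k : cps_val (x ^+ k) = cps_val x ^+ k.
Proof. by elim: k => // k IH; rewrite !exprS cps_valM IH. Qed.
Lemma cps_val_sum (I : Type) (r : seq I) (P : pred I) (F : I -> cps R n) :
  cps_val (\sum_(i <- r | P i) F i) = \sum_(i <- r | P i) cps_val (F i).
Proof.
elim: r => [|i r IH]; first by rewrite !big_nil.
by rewrite !big_cons; case: ifP => // _; rewrite cps_valD IH.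
Qed.
Lemma cps_coef_sum (I : Type) (r : seq I) (P : pred I) (F : I -> cps R n) m :
  fps_coef (\sum_(i <- r | P i) F i : cps R n) m
  = \sum_(i <- r | P i) fps_coef (F i) m.
Proof. by rewrite cps_val_sum fps_coef_sum. Qed.
End CpsVal.

Section MonomialOrder.
Variables (R : realType) (i : 'I_2) (a : nat) (I : set (cps R 2)).
Hypothesis Ia : forall x, I x -> forall m, fps_coef x m != 0 -> (a <= m i)%N.

Lemma ideal_exp_order k (x : cps R 2) : ideal_exp I k x ->
  forall m, fps_coef x m != 0 -> (k * a <= m i)%N.
Proof.
elim: k x => // k IH x [n [c [s [hs ->]]]] m.
have E (r : seq 'I_n) : fps_coef (\sum_(l <- r) c l * s l : cps R 2) m != 0 ->
    (k.+1 * a <= m i)%N.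
  elim: r => [|l r IHr]; first by rewrite big_nil eqxx.
  rewrite big_cons cps_valD fps_coefD cps_valM => h.
  have [e|/IHr //] := eqVneq (fps_coef (\sum_(l <- r) c l * s l : cps R 2) m) 0.
  have [y [z [/Ia Iy /IH Iz es]]] := hs l; move: h; rewrite e addr0 es cps_valM.
  move=> /fps_coefM_supp[m1 [m2 [-> _ /fps_coefM_supp[m3 [m4 [-> /Iy h3 /Iz h4]]]]]].
  by rewrite !mnmDE; lia.
exact: E.
Qed.

(** The order along a coordinate axis is a valuation. If [x] had order [o < a],
    then in an integral equation of degree [n] the leading exponent of [x ^ n]
    would have order [n o], while the term of index [l] has order at least
    [l a + (n - l) o > n o], so that nothing could cancel it. *)
Lemma integral_closure_order (x : cps R 2) : integral_closure I x ->
  forall m, fps_coef x m != 0 -> (a <= m i)%N.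
Proof.
move=> [n [c [n0 hc e]]] m hm.
have [j ij] : exists j : 'I_2, i != j.
  by exists (1 - i); case: i => [[|[|?]] ?].
have x0 : (x : fps R[i] 2) != 0 by apply: contraNneq hm => ->.
have [p hp] := leading_exists i j x0.
suff hpa : (a <= p i)%N.
  by have := hp.2 m hm; rewrite /lex2; lia.
rewrite leqNgt; apply/negP => pa.
have := congr1 (fun y : cps R 2 => fps_coef y (p *+ n)%MM) e.
rewrite cps_valD fps_coefD cps_valX.
have [/negP hn _] := leadingX ij n hp.
rewrite cps_coef_sum big_nat_cond big1 ?addr0.
  by move=> h; apply: hn; rewrite h.
move=> l /andP[/andP[l1 ln] _]; apply/eqP; apply: contrapT => /negP.
rewrite cps_valM cps_valX => /fps_coefM_supp[m1 [m2 [em]]].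
move=> /(ideal_exp_order (hc l _)); rewrite l1 -ltnS ln => /(_ isT) h1.
move=> /(leadingX ij (n - l) hp).2; rewrite /lex2 !mulmnE => h2.
have := congr1 (fun m : 'X_{1..2} => m i) em; rewrite mnmDE mulmnE => e1.
have h3 : (p i * (n - l) <= m2 i)%N by lia.
have : (l * a + p i * (n - l) <= p i * n)%N by rewrite e1 leq_add.
by rewrite mulnBr; nia.
Qed.

End MonomialOrder.

Section RootsOfUnity.
Variable R : realType.

Lemma complex_prim_root n : (0 < n)%N -> exists z : R[i], n.-primitive_root z.
Proof.
pose p : {poly R[i]} := 'X^n - 1; have [r Dp] := closed_field_poly_normal p.
move=> n_gt0; rewrite (monicP _) ?monicXnsubC // scale1r in Dp.
have rn1 : all n.-unity_root r by apply/allP=> z; rewrite -root_prod_XsubC -Dp.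
have sz_r : (n < (size r).+1)%N.
  by rewrite -(size_prod_XsubC r id) -Dp size_XnsubC.
have [|z] := hasP (has_prim_root n_gt0 rn1 _ sz_r); last by exists z.
by rewrite -separable_prod_XsubC -Dp separable_Xn_sub_1 // pnatr_eq0 -lt0n.
Qed.

Lemma norm_prim_root n (z : R[i]) : n.-primitive_root z -> `|z| = 1.
Proof.
move=> hz; have n0 := prim_order_gt0 hz; apply/eqP.
by rewrite -(@pexpr_eq1 _ _ n) ?normr_ge0 // -normrX (prim_expr_order hz) normr1.
Qed.

End RootsOfUnity.

(** * Exponents occurring in the saturation *)

Definition mnm2 (a b : nat) : 'X_{1..2} := (U_(0%R) *+ a + U_(1%R) *+ b)%MM.

Lemma mnm2_0 a b : mnm2 a b 0 = a.
Proof. by rewrite mnmDE !mulmnE !mnm1E mul1n mul0n addn0. Qed.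

Lemma mnm2_1 a b : mnm2 a b 1 = b.
Proof. by rewrite mnmDE !mulmnE !mnm1E mul1n mul0n. Qed.

Lemma mnm2E (m : 'X_{1..2}) : m = mnm2 (m 0) (m 1).
Proof. by apply: (@mnm2P 0 1); rewrite ?mnm2_0 ?mnm2_1. Qed.

Section Monomials.
Variable R : realType.
Local Notation K := R[i].

Definition cpsX n (m : 'X_{1..n}) : cps R n := cps_of_mpoly 'X_[m].

Lemma cpsXD n (k l : 'X_{1..n}) : cpsX (k + l)%MM = cpsX k * cpsX l.
Proof. by rewrite /cpsX mpolyXD rmorphM. Qed.


Lemma cpsXn n (k : 'X_{1..n}) a : cpsX (k *+ a)%MM = cpsX k ^+ a.
Proof. by rewrite /cpsX -mpolyXn rmorphXn. Qed.

Lemma cpsX_coef n (k m : 'X_{1..n}) : fps_coef (cpsX k) m = (k == m)%:R.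
Proof. by rewrite /= mcoeffX. Qed.

Lemma cps_substX n d c (g : 'I_n -> 'X_{1..d}) c_le1 g_neq0 k :
  @cps_subst R n d c g c_le1 g_neq0 (cpsX k)
  = (\prod_i c i ^+ k i) *: cpsX (mnm_subst g k).
Proof.
apply: val_inj; transitivity (fps_subst c g (fps_of_mpoly 'X_[k])) => //.
rewrite fps_subst_mpoly // mp_substX.
by apply: fpsP => m; rewrite /= mcoeffZ.
Qed.

Lemma cps_subst_var n d c (g : 'I_n -> 'X_{1..d}) c_le1 g_neq0 i :
  @cps_subst R n d c g c_le1 g_neq0 (cps_var R i) = c i *: cpsX (g i).
Proof.
have := cps_substX c_le1 g_neq0 U_(i); rewrite /cps_var -/(cpsX U_(i)) => ->.
congr (_ *: cpsX _); last exact: mnm_subst1.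
rewrite (bigD1 i) //= mnm1E eqxx big1 ?mulr1 // => j hj.
by rewrite mnm1E eq_sym (negbTE hj).
Qed.

Lemma cps_rename_var n d s (s_inj : injective s) i :
  @cps_rename R n d s s_inj (cps_var R i) = cps_var R (s i).
Proof.
apply/val_inj/fpsP => m /=; rewrite -mcoeff_rename // mp_renameX //.
congr mcoeff; congr mpolyX; apply/mnmP => j; rewrite [LHS]mnmE [RHS]mnm1E.
case: (s i =P j) => [<-|h].
  rewrite (bigD1 i) //= mnm1E eqxx big1 ?addn0 // => l /andP[_ hl].
  by rewrite mnm1E eq_sym (negbTE hl).
rewrite big1 // => l /eqP sl; rewrite mnm1E.
by case: (i =P l) => // il; case: h; rewrite il.
Qed.

(** Rescaling the variables acts diagonally on monomials. *)
Lemma cps_subst_scale n c c_le1 g_neq0 (f : cps R n) m :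
  fps_coef (@cps_subst R n n c (fun i => U_(i))%MM c_le1 g_neq0 f) m
  = (\prod_i c i ^+ m i) * fps_coef f m.
Proof.
have e k : mnm_subst (fun i => U_(i))%MM k = k :> 'X_{1..n}.
  by rewrite /mnm_subst -multinomUE_id.
transitivity (fps_coef (fps_subst c (fun i => U_(i))%MM f) m) => //.
rewrite (@fps_subst_coef _ _ _ _ _ c_le1 g_neq0 f (mdeg m).+2) //.
pose F k := fps_coef f k * (mp_subst c (fun i => U_(i))%MM 'X_[k])@_m.
rewrite (@bmultinom_sum1 _ _ _ F m) // /F => [|k hk].
  by rewrite mp_substX e mcoeffZ mcoeffX eqxx mulr1 mulrC.
by rewrite mp_substX e mcoeffZ mcoeffX (negbTE hk) !mulr0.
Qed.

End Monomials.

Section Twist.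
Variables (R : realType) (w : R[i]).
Hypothesis w1 : `|w| = 1.
Local Notation K := R[i].

Definition twist_coef (i : 'I_2) : K := if i == 1 then w else 1.
Definition diag_coef (i : 'I_(2 + 2)) : K :=
  match split i with inl _ => 1 | inr j => twist_coef j end.
Definition diag_mnm (i : 'I_(2 + 2)) : 'X_{1..2} :=
  match split i with inl j => U_(j) | inr j => U_(j) end%MM.

Fact twist_coef_le1 i : `|twist_coef i| <= 1.
Proof. by rewrite /twist_coef; case: ifP => _; rewrite ?w1 ?normr1. Qed.
Fact diag_coef_le1 i : `|diag_coef i| <= 1.
Proof.
by rewrite /diag_coef; case: split => j; rewrite ?normr1 ?twist_coef_le1.
Qed.
Fact mnm1_neq0 n (i : 'I_n) : (U_(i) != 0)%MM.
Proof. by rewrite mnm1_eq0. Qed.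
Fact diag_mnm_neq0 i : diag_mnm i != 0%MM.
Proof. by rewrite /diag_mnm; case: split => j; apply: mnm1_neq0. Qed.
Fact one_le1 n (i : 'I_n) : `|1 : K| <= 1.
Proof. by rewrite normr1. Qed.

Definition twist := cps_subst twist_coef_le1 (@mnm1_neq0 2).
(** The restriction to the surface of pairs [((u, v), (u, w v))] of the product of
    two copies of the plane. *)
Definition twisted_diag := cps_subst diag_coef_le1 diag_mnm_neq0.
HB.instance Definition _ := GRing.LRMorphism.on twisted_diag.

Lemma twist_coefE f m : fps_coef (twist f) m = w ^+ (m 1) * fps_coef f m.
Proof.
rewrite cps_subst_scale; congr (_ * _).
rewrite big_ord_recl big_ord1 /twist_coef /= expr1n mul1r.
by congr (_ ^+ m _); apply: val_inj.
Qed.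

Lemma twisted_diag_snd f : twisted_diag (cps_snd f) = twist f.
Proof.
have := @cps_lrmorphism_eq R 2 2 [the {lrmorphism _ -> _} of
  twisted_diag \o @cps_snd R 2] [the {lrmorphism _ -> _} of twist].
apply; first exact: tame_comp (cps_rename_tame _) (cps_subst_tame _ _).
  exact: cps_subst_tame.
move=> i; rewrite /= /cps_snd cps_rename_var /twisted_diag /twist !cps_subst_var.
by rewrite /diag_coef /diag_mnm -[rshift 2 i]/(unsplit (inr i)) unsplitK.
Qed.

Lemma twisted_diag_fst f : twisted_diag (cps_fst f) = f.
Proof.
transitivity (cps_subst (@one_le1 2) (@mnm1_neq0 2) f); last first.
  apply/val_inj/fpsP => m; rewrite [LHS]cps_subst_scale big1 ?mul1r // => i _.
  exact: expr1n.
have := @cps_lrmorphism_eq R 2 2 [the {lrmorphism _ -> _} of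
  twisted_diag \o @cps_fst R 2] [the {lrmorphism _ -> _} of
  cps_subst (@one_le1 2) (@mnm1_neq0 2)].
apply; first exact: tame_comp (cps_rename_tame _) (cps_subst_tame _ _).
  exact: cps_subst_tame.
move=> i; rewrite /= /cps_fst cps_rename_var /twisted_diag /twist !cps_subst_var.
by rewrite /diag_coef /diag_mnm -[lshift 2 i]/(unsplit (inl i)) unsplitK.
Qed.

Lemma twisted_diagB f : twisted_diag (cps_fst f - cps_snd f) = f - twist f.
Proof.
transitivity (twisted_diag (cps_fst f) - twisted_diag (cps_snd f)).
  exact: rmorphB.
by rewrite twisted_diag_fst twisted_diag_snd.
Qed.

Variables (alpha beta N : nat).
Local Notation eta := (hypersurface_normalization R alpha beta N).

Definition eta_mnm (k : 'I_3) : 'X_{1..2} :=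
  nth 0%MM [:: mnm2 1 0; mnm2 alpha beta; mnm2 0 N] k.

Lemma etaE k : eta k = cpsX R (eta_mnm k).
Proof.
have vE i : cps_var R i = cpsX R U_(i) by [].
rewrite /hypersurface_normalization !vE -!cpsXn -cpsXD /eta_mnm /mnm2.
case: k => [[|[|[|?]]] ?] //=.
- by congr cpsX; apply: (@mnm2P 0 1); rewrite // ?mnmDE !mulmnE ?muln0 ?addn0 ?muln1.
- by congr cpsX; apply: (@mnm2P 0 1); rewrite // ?mnmDE !mulmnE ?muln0 ?add0n.
Qed.

(** On the surface of pairs [((u, v), (u, w v))], a monomial [t^m] contributes
    [(1 - w^(m 1)) t^m] to [f(x) - f(y)]. Hence only the components of [eta] not
    invariant under [v |-> w v] generate the restricted ideal, and their order
    bounds the exponents of [f] not invariant under it either. *)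
Lemma twisted_order (i : 'I_2) (a : nat) (f : cps R 2) :
    (forall k, w ^+ (eta_mnm k 1) != 1 -> (a <= eta_mnm k i)%N) ->
    f \in lip_pred eta ->
  forall m : 'X_{1..2}, w ^+ (m 1) != 1 -> fps_coef f m != 0 -> (a <= m i)%N.
Proof.
move=> ha /asboolP hf m wm fm.
pose J : set (cps R 2) :=
  [set x : cps R 2 | forall m : 'X_{1..2}, fps_coef x m != 0 -> (a <= m i)%N].
have JP : is_ideal J.
  split; first by move=> k /=; rewrite eqxx.
  - move=> x y hx hy k; rewrite cps_valD fps_coefD.
    have [->|/hx//] := eqVneq (fps_coef x k) 0.
    by rewrite add0r => /hy.
  - move=> x y hy k; rewrite cps_valM => /fps_coefM_supp[k1 [k2 [-> _ /hy h]]].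
    by rewrite mnmDE (leq_trans h) // leq_addl.
have key y : diagonal_ideal eta y -> J (twisted_diag y).
  have [J0 JD JM] := JP.
  apply: (@ideal_gen_sub _ _ [set y | J (twisted_diag y)]).
    split => /=; first by rewrite rmorph0.
    - by move=> x z hx hz; rewrite rmorphD; apply: JD.
    - by move=> x z hz; rewrite rmorphM; apply: JM.
  move=> _ [k _ <-]; rewrite /mkset twisted_diagB etaE.
  move=> l; rewrite cps_valB fps_coefD fps_coefN twist_coefE cpsX_coef.
  case: (_ =P l) => [<-|_]; last by rewrite mulr0 subrr eqxx.
  by rewrite mulr1 subr_eq0 eq_sym => /ha.
have := integral_closure_order _ (integral_closure_rmorph
  (phi := [the {rmorphism _ -> _} of twisted_diag]) key hf).
move=> /(_ i a (fun x hx => hx) m); apply.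
rewrite [X in cps_val X]twisted_diagB cps_valB fps_coefD fps_coefN twist_coefE.
rewrite -{1}[fps_coef f m]mul1r -mulrBl.
by rewrite mulf_neq0 // subr_eq0 eq_sym.
Qed.

End Twist.

Section Necessity.
Variables (R : realType) (alpha beta N : nat).
Hypotheses (beta_gt0 : (0 < beta)%N) (N_gt0 : (0 < N)%N).
Hypothesis beta_N_coprime : coprime beta N.

(** The semigroup [Gamma] of the exponents of the saturation. *)
Definition saturated (m : 'X_{1..2}) : bool :=
  ((N %| m 1%R) || [&& alpha <= m 0%R, beta <= m 1%R & (beta %| m 1%R) || (N <= m 1%R)])%N.

(** For a primitive [N]-th root of unity the component [v^N] of [eta] disappears
    from the restricted ideal and [u^alpha v^beta] remains; for a primitive
    [beta]-th root it is the other way round. *)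
Lemma lip_supp (f : cps R 2) :
  f \in lip_pred (hypersurface_normalization R alpha beta N) ->
  forall m, fps_coef f m != 0 -> saturated m.
Proof.
move=> hf m fm; rewrite /saturated; case: (boolP (N %| m 1%R)%N) => //= Nm.
have [w hw] := complex_prim_root R N_gt0; have [z hz] := complex_prim_root R beta_gt0.
have w1 := norm_prim_root hw; have z1 := norm_prim_root hz.
have dw k : (w ^+ k == 1) = (N %| k)%N.
  by rewrite (prim_order_dvd hw).
have dz k : (z ^+ k == 1) = (beta %| k)%N.
  by rewrite (prim_order_dvd hz).
have h1 i a : (a <= mnm2 alpha beta i)%N -> (a <= m i)%N.
  move=> ha; apply: (twisted_order w1 _ hf) fm => [k|]; last by rewrite dw.
  rewrite dw /eta_mnm; case: k => [[|[|[|?]]] ?] //=; rewrite mnm2_1 ?dvdn0 //.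
  by rewrite dvdnn.
have ha : (alpha <= m 0%R)%N by apply: h1; rewrite mnm2_0.
have hb : (beta <= m 1%R)%N by apply: h1; rewrite mnm2_1.
rewrite ha hb /=; case: (boolP (beta %| m 1%R)%N) => //= bm.
apply: (twisted_order z1 _ hf) fm => [k|]; last by rewrite dz.
by rewrite dz /eta_mnm; case: k => [[|[|[|?]]] ?] //=; rewrite mnm2_1 ?dvdn0 ?dvdnn.
Qed.

End Necessity.

(** * Normal forms in the semigroup of exponents *)

Section NormalForm.
Variables (alpha beta N : nat).
Hypotheses (alpha_gt0 : (0 < alpha)%N) (beta_gt0 : (0 < beta)%N) (N_gt0 : (0 < N)%N).

Definition sat_exp (j : nat) : bool :=
  ((N %| j) || ((beta <= j) && ((beta %| j) || (N <= j))))%N.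

Lemma sat_expD j k : sat_exp j -> sat_exp k -> sat_exp (j + k).
Proof.
rewrite /sat_exp; case: (posnP j) => [-> //|j0].
case: (posnP k) => [->|k0]; first by rewrite addn0.
case: (boolP (N %| j + k)%N) => //= njk.
move=> /orP[dj|/andP[bj hj]] /orP[dk|/andP[bk hk]].
- by rewrite dvdn_add in njk.
- by have := dvdn_leq j0 dj; lia.
- by have := dvdn_leq k0 dk; lia.
rewrite (leq_trans bj) ?leq_addr //=.
case/orP: hj => [dj|]; last by lia.
case/orP: hk => [dk|]; last by lia.
by rewrite dvdn_add.
Qed.

Fact jmin_ex r : exists j, sat_exp j && (j == r %[mod N])%N.
Proof.
(* Both [beta] and [N] are at most [beta N]. *)
exists (beta * N + r)%N; rewrite modnMDl ?eqxx andbT.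
apply/orP; right; rewrite !(leq_trans _ (leq_addr _ _)) ?orbT //.
  exact: leq_pmull.
exact: leq_pmulr.
Qed.

(** A residue class modulo [N] meets the admissible exponents of [v] in all the
    elements of the class from this one on. *)
Definition jmin (r : nat) : nat := ex_minn (jmin_ex r).

Lemma jminP r : [/\ sat_exp (jmin r), jmin r = r %[mod N] &
  forall j, sat_exp j -> j = r %[mod N] -> jmin r <= j]%N.
Proof.
rewrite /jmin; case: ex_minnP => j /andP[hj /eqP er] hmin; split => // k hk ek.
by apply: hmin; rewrite hk; apply/eqP.
Qed.

Lemma jmin0 : jmin 0 = 0%N.
Proof.
have [_ _ h] := jminP 0; apply/eqP; rewrite -leqn0; apply: h => //.
by rewrite /sat_exp dvdn0.
Qed.

Lemma jminD r s : (jmin ((r + s) %% N) <= jmin r + jmin s)%N.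
Proof.
have [hr er _] := jminP r; have [hs es _] := jminP s.
have [_ _] := jminP ((r + s) %% N); apply; first exact: sat_expD.
by rewrite -modnDm er es modnDm modn_mod.
Qed.

(** Powers of [v^N] alone are in the saturation; the other admissible powers of
    [v] come with a factor [u^alpha]. *)
Definition amin (r : nat) : nat := if r == 0%N then 0%N else alpha.

(** [Gamma] is a disjoint union of translated quadrants, one for each residue class
    of the exponent of [v]. *)
Lemma saturatedE (m : 'X_{1..2}) : saturated alpha beta N m =
  (amin (m 1%R %% N) <= m 0%R)%N && (jmin (m 1%R %% N) <= m 1%R)%N.
Proof.
rewrite /saturated /amin -/(dvdn N (m 1%R)).
have [_ _ h] := jminP (m 1%R %% N).
have [hj er _] := jminP (m 1%R %% N).
have [d|d] /= := boolP (N %| m 1%R)%N.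
  by rewrite (eqP d) jmin0.
apply: andb_id2l => _; apply/idP/idP => [hm|hm].
  by apply: h; rewrite ?modn_mod // /sat_exp hm orbT.
have := sat_expD hj (_ : sat_exp (m 1%R - jmin (m 1%R %% N))).
rewrite subnKC // => /(_ _)/orP[|hd|//]; last by rewrite hd in d.
by rewrite /sat_exp -eqn_mod_dvd // eq_sym er modn_mod eqxx.
Qed.

(** The generators of [Gamma]: index 0 is for [u], index 1 for [v^N], and index
    [r + 1] for the non-zero residue class [r]. *)
Definition sat_gen (l : 'I_N.+1) : 'X_{1..2} :=
  if l == 0%N :> nat then mnm2 1 0
  else if l == 1%N :> nat then mnm2 0 N else mnm2 alpha (jmin l.-1).

Lemma sat_gen_neq0 l : sat_gen l != 0%MM.
Proof.
rewrite /sat_gen; case: ifP => _; last case: ifP => _; apply/eqP.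
- by move=> /(congr1 (fun m : 'X_{1..2} => m 0%R)); rewrite mnm2_0 mnm0E.
- move=> /(congr1 (fun m : 'X_{1..2} => m 1%R)); rewrite mnm2_1 mnm0E.
  by move: N_gt0; lia.
- move=> /(congr1 (fun m : 'X_{1..2} => m 0%R)); rewrite mnm2_0 mnm0E.
  by move: alpha_gt0; lia.
Qed.

(** The exponent in [(u, v)] of the image of the monomial [z^k] in the
    generators. *)
Definition phi (k : 'X_{1..N.+1}) : 'X_{1..2} := mnm_subst sat_gen k.

(** For [r = 0] the third generator would be [v^N] again, hence its absence. *)
Definition word (a b r : nat) : 'X_{1..N.+1} :=
  (U_(0%R) *+ a + U_(inord 1) *+ b + (if r == 0%N then 0 else U_(inord r.+1)))%MM.

Definition nf (m : 'X_{1..2}) : 'X_{1..N.+1} :=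
  word (m 0%R - amin (m 1%R %% N)) ((m 1%R - jmin (m 1%R %% N)) %/ N) (m 1%R %% N).

Lemma mnm2D a b c d : (mnm2 a b + mnm2 c d)%MM = mnm2 (a + c) (b + d).
Proof.
by apply: (@mnm2P 0 1) => //; rewrite mnmDE ?mnm2_0 ?mnm2_1.
Qed.

Lemma mnm2Mn a b c : (mnm2 a b *+ c)%MM = mnm2 (a * c) (b * c).
Proof.
by apply: (@mnm2P 0 1) => //; rewrite mulmnE ?mnm2_0 ?mnm2_1.
Qed.

Lemma phiD k l : phi (k + l)%MM = (phi k + phi l)%MM.
Proof. exact: mnm_substD. Qed.
Lemma phi1 l : phi U_(l)%MM = sat_gen l.
Proof. exact: mnm_subst1. Qed.
Lemma phi0 : phi 0%MM = 0%MM.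
Proof. exact: mnm_subst0. Qed.

Lemma phiMn k a : phi (k *+ a)%MM = (phi k *+ a)%MM.
Proof.
elim: a => [|a IH]; first by rewrite !mulm0n phi0.
by rewrite !mulmS phiD IH.
Qed.

Lemma sat_gen_inord r : (r < N)%N ->
  sat_gen (inord r.+1) = mnm2 (amin r) (if r == 0%N then N else jmin r).
Proof.
by move=> rN; rewrite /sat_gen inordK // /amin; case: r rN.
Qed.

Lemma phi_word a b r : (r < N)%N ->
  phi (word a b r) = mnm2 (a + amin r) (b * N + jmin r).
Proof.
move=> rN; rewrite !phiD !phiMn !phi1 sat_gen_inord // /amin eqxx.
rewrite [sat_gen 0%R]/sat_gen eqxx !mnm2Mn mnm2D mul1n !mul0n addn0 add0n mulnC.
case: (eqVneq r 0%N) => [->|r0]; first by rewrite phi0 jmin0 !addn0 addm0.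
by rewrite phi1 sat_gen_inord // /amin (negbTE r0) mnm2D.
Qed.

Lemma nf_word a b r : (r < N)%N -> nf (phi (word a b r)) = word a b r.
Proof.
move=> rN; rewrite phi_word // /nf mnm2_0 mnm2_1.
have [_ er _] := jminP r.
have -> : ((b * N + jmin r) %% N = r)%N by rewrite modnMDl er modn_small.
by rewrite !addnK mulnK.
Qed.

Lemma nfK m : saturated alpha beta N m -> phi (nf m) = m.
Proof.
rewrite saturatedE => /andP[h0 h1]; rewrite phi_word ?ltn_mod // subnK //.
have [_ er _] := jminP (m 1%R %% N).
rewrite divnK ?subnK -?mnm2E // -eqn_mod_dvd //.
by rewrite er modn_mod.
Qed.


Lemma mdeg_word a b r : mdeg (word a b r) = (a + b + (r != 0%N))%N.
Proof.
rewrite /word !mdegD !mdegMn !mdeg1 !mul1n.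
by case: eqP; rewrite ?mdeg0 ?mdeg1.
Qed.

Lemma saturatedD m k : saturated alpha beta N m -> saturated alpha beta N k ->
  saturated alpha beta N (m + k)%MM.
Proof.
rewrite !saturatedE !mnmDE => /andP[a1 b1] /andP[a2 b2]; apply/andP; split.
  rewrite -modnDm; move: a1 a2; rewrite /amin => a1 a2.
  case: (eqVneq (m 1%R %% N)%N 0%N) a1 => [e1|_] a1; last first.
    by case: ifP => _; lia.
  case: (eqVneq (k 1%R %% N)%N 0%N) a2 => [e2|_] a2; last first.
    by case: ifP => _; lia.
  by rewrite e1 e2 mod0n.
rewrite -modnDm; apply: leq_trans (jminD _ _) _.
exact: leq_add.
Qed.

Lemma saturated_sat_gen l : saturated alpha beta N (sat_gen l).
Proof.
rewrite /sat_gen; case: ifP => _; last case: ifP => _; rewrite /saturated ?mnm2_1 ?dvdn0 ?dvdnn //.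
rewrite mnm2_0; have [h _ _] := jminP l.-1.
by rewrite leqnn; apply: h.
Qed.

Lemma saturated0 : saturated alpha beta N 0%MM.
Proof. by rewrite /saturated mnm0E dvdn0. Qed.

Lemma saturated_phi k : saturated alpha beta N (phi k).
Proof.
elim/mnm_ind: k => [|k r IH]; first by rewrite phi0 saturated0.
by rewrite phiD phi1 saturatedD // saturated_sat_gen.
Qed.

Lemma word_add a b a' b' r' :
  (word a b 0 + word a' b' r' = word (a + a') (b + b') r')%MM.
Proof.
rewrite /word /= addm0; apply/mnmP => i.
by rewrite !mnmDE !mulmnE !mulnDr addnA (addnACA (_ * a)%N).
Qed.

Lemma nf_shift a b m : saturated alpha beta N m ->
  nf (phi (word a b 0) + m)%MM = (word a b 0 + nf m)%MM.
Proof.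
move=> hm; rewrite -[in LHS](nfK hm) -phiD {2}/nf.
set a' := (_ - _)%N; set b' := (_ %/ _)%N; set r := (_ %% N)%N.
by rewrite word_add nf_word // ltn_mod.
Qed.

(** Multiplying a normal form by a generator gives a normal form again, unless both
    involve a generator with a non-zero residue class; then these two are to be
    rewritten together, and the remaining factor [y], a word in [u] and [v^N], is
    carried along. *)
Lemma nf_step k l :
  nf (phi (k + U_(l)))%MM = (nf (phi k) + U_(l))%MM \/
  exists s y, nf (phi k) = (y + U_(s))%MM /\
    nf (phi (k + U_(l)))%MM = (y + nf (phi (U_(s) + U_(l))))%MM.
Proof.
have hk := saturated_phi k; set a := (phi k 0%R - amin (phi k 1%R %% N))%N.
set b := ((phi k 1%R - jmin (phi k 1%R %% N)) %/ N)%N.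
set r := (phi k 1%R %% N)%N; have rN : (r < N)%N by rewrite ltn_mod.
have E : nf (phi k) = word a b r by [].
have E2 : phi (k + U_(l))%MM = phi (word a b r + U_(l))%MM.
  by rewrite (phiD k) (phiD (word a b r)) -E nfK.
rewrite E2 E; have [r0|r0] := eqVneq r 0%N; last first.
  right; exists (inord r.+1), (word a b 0).
  have Ew : word a b r = (word a b 0 + U_(inord r.+1))%MM.
    by rewrite /word (negbTE r0) eqxx addm0.
  split => //; rewrite Ew -addmA.
  rewrite [phi (word _ _ _ + _)]phiD nf_shift //.
  exact: saturated_phi.
left; rewrite r0; have [l0|l0] := eqVneq (l : nat) 0%N.
  have -> : l = 0%R by apply: val_inj.
  have -> : (word a b 0 + U_(0%R) = word a.+1 b 0)%MM.
    by rewrite /word /= !addm0 mulmSr -!addmA [(U_(inord 1) *+ b + _)%MM]addmC.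
  by rewrite nf_word.
have [l1|l1] := eqVneq (l : nat) 1%N.
  have -> : l = inord 1 by apply: val_inj; rewrite /= inordK.
  have -> : (word a b 0 + U_(inord 1) = word a b.+1 0)%MM.
    by rewrite /word /= !addm0 mulmSr -!addmA.
  by rewrite nf_word.
have hl : (0 < l.-1 < N)%N by have := ltn_ord l; move: l0 l1; lia.
have -> : (word a b 0 + U_(l) = word a b l.-1)%MM.
  rewrite /word /= addm0; case: eqP => [e|_]; first by rewrite e in hl.
  by congr (_ + U_(_))%MM; apply: val_inj; rewrite /= prednK ?lt0n // inord_val.
by rewrite nf_word //; case/andP: hl.
Qed.

Lemma mnm1_word (t : 'I_N.+1) : exists a b r, [/\ (r < N)%N, U_(t)%MM = word a b r &
  r != 0%N -> a = 0%N /\ b = 0%N].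
Proof.
have [t0|t0] := eqVneq (t : nat) 0%N.
  exists 1%N, 0%N, 0%N; split => //.
  by rewrite /word /= addm0 mulm1n mulm0n addm0; congr U_(_)%MM; apply: val_inj.
have [t1|t1] := eqVneq (t : nat) 1%N.
  exists 0%N, 1%N, 0%N; split => //.
  rewrite /word /= addm0 mulm1n mulm0n add0m; congr U_(_)%MM; apply: val_inj.
  by rewrite /= inordK.
exists 0%N, 0%N, t.-1; split => //.
  by have := ltn_ord t; move: t0 t1; lia.
rewrite /word !mulm0n !add0m; case: eqP => [|_]; first by move: t0 t1; lia.
by rewrite prednK ?lt0n // inord_val.
Qed.

Lemma nf_mnm1 t : nf (phi U_(t)%MM) = U_(t)%MM.
Proof. by have [a [b [r [rN -> _]]]] := mnm1_word t; rewrite nf_word. Qed.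

(** Each of the two generators that disappears in the rewriting frees a factor
    [u^alpha], and [alpha >= 1]. *)
Lemma mdeg_nf2 s l : (2 <= mdeg (nf (phi (U_(s) + U_(l)))))%N.
Proof.
have two : mdeg (U_(s) + U_(l)) = 2%N by rewrite mdegD !mdeg1.
have [a [b [r [rN Es hs]]]] := mnm1_word s; have [a' [b' [r' [rN' El hl]]]] := mnm1_word l.
have [r0|r0] := eqVneq r 0%N.
  by rewrite -two Es El r0 word_add nf_word.
have [r0'|r0'] := eqVneq r' 0%N.
  by rewrite -two Es El r0' addmC word_add nf_word.
have [a0 b0] := hs r0; have [a0' b0'] := hl r0'.
rewrite Es El a0 b0 a0' b0' phiD !phi_word // mnm2D /nf mnm2_0 mnm2_1 mdeg_word.
rewrite !mul0n !add0n /amin (negbTE r0) (negbTE r0').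
move: ((_ - _) %/ N)%N => q.
by case: eqVneq => _ /=; move: alpha_gt0; lia.
Qed.

(** Rewriting to normal form never shortens a word. *)
Lemma mdeg_nf k : (mdeg k <= mdeg (nf (phi k)))%N.
Proof.
elim/mnm_ind: k => [|k l IH]; first by rewrite mdeg0.
rewrite mdegD mdeg1; case: (nf_step k l) => [->|[s [y [E ->]]]].
  by rewrite mdegD mdeg1 leq_add2r.
rewrite E mdegD mdeg1 in IH; rewrite mdegD; apply: (@leq_trans (mdeg y + 2)%N).
  by move: IH; lia.
by rewrite leq_add2l mdeg_nf2.
Qed.


End NormalForm.

(** * Integral closure by determinants *)

Section DeterminantTrick.

(** The adjugate of [x - P] multiplied by [(x - P) e]. Keeping the error terms
    [x e_j - sum_k P_jk e_k] makes the identity usable modulo an ideal. *)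
Lemma char_poly_adj (A : comNzRingType) n (P : 'M[A]_n) (x : A) (e : 'I_n -> A) :
  exists C : 'M[A]_n, forall i,
    (char_poly P).[x] * e i = \sum_j C i j * (x * e j - \sum_k P j k * e k).
Proof.
pose Q : 'M[A]_n := map_mx (horner_eval x) (char_poly_mx P).
exists (\adj Q) => i; have := mul_adj_mx Q.
rewrite det_map_mx /horner_eval -/(char_poly P) => /(congr1 (mulmx^~ (\col_j e j))).
rewrite -mulmxA mul_scalar_mx => /matrixP/(_ i 0); rewrite !mxE => <-.
apply: eq_bigr => j _; congr (_ * _); rewrite !mxE.
rewrite (eq_bigr (fun k => x *+ (j == k) * e k - P j k * e k)).
  rewrite sumrB (bigD1 j) //= eqxx mulr1n big1 ?addr0 // => k /negbTE h.
  by rewrite eq_sym h mulr0n mul0r.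
move=> k _; rewrite !mxE /horner_eval hornerD hornerN hornerC hornerMn hornerX.
by rewrite mulrBl.
Qed.

(** The characteristic polynomial of [M 'X] over the Rees algebra vanishes at
    [f 'X] up to the regular factor [e_i0]. *)
Lemma integral_closure_det (A : comNzRingType) (I : set A) n (M : 'M[A]_n)
    (e : 'I_n -> A) (f : A) (i0 : 'I_n) :
    (forall i j, I (M i j)) -> (forall i, f * e i = \sum_j M i j * e j) ->
    (forall x, x * e i0 = 0 -> x = 0) ->
  integral_closure I f.
Proof.
move=> IM fe reg; apply/integral_closureP.
have IM1 i j : ideal_exp I 1 (M i j).
  by apply: sub_ideal_gen; exists (M i j), 1; split; rewrite ?mulr1.
have memM i j : M i j *: 'X \in rees_pred I.
  apply/asboolP => k; rewrite coefZ coefX; case: eqP => [->|_].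
    by rewrite mulr1.
  by rewrite mulr0; have [] := ideal_expP I k.
pose P : 'M[rees I]_n := \matrix_(i, j) Rees (memM i j).
exists (char_poly P); first exact: char_poly_monic.
apply/rootP; rewrite map_char_poly.
have [C /(_ i0)] := char_poly_adj (map_mx (rees_incl I) P) (f *: 'X)
  (fun i => (e i)%:P).
rewrite big1 => [h|j _]; last first.
  rewrite -mul_polyC mulrAC -polyCM fe (eq_bigr (fun k => (M j k * e k)%:P * 'X)).
    by rewrite -mulr_suml -rmorph_sum subrr mulr0.
  by move=> k _; rewrite !mxE /= -mul_polyC mulrAC -polyCM.
apply/polyP => k; rewrite coef0; apply: reg.
by rewrite -coefMC h coef0.
Qed.

End DeterminantTrick.

Section BinomialClosure.
Variables (A : comNzRingType) (J : set A) (a b c : A) (beta N : nat).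
Hypotheses (J_ideal : is_ideal J) (beta_gt0 : (0 < beta)%N).
Hypothesis beta_N_coprime : coprime beta N.
Hypothesis Jb : J (c * (a ^+ beta - b ^+ beta)).
Hypothesis JN : J (c * (a ^+ N - b ^+ N)).

Lemma coprime_step : exists s t : nat, (s * beta = t * N + 1)%N.
Proof.
case: (egcdnP N beta_gt0) => s t e _.
by exists s, t; rewrite e (eqP beta_N_coprime).
Qed.

Local Notation k := (beta + N)%N.
Let e (i : nat) : A := a ^+ i * b ^+ (k - i).
(** Combinations of the monomials of degree [k] in [a] and [b], with coefficients
    in the ideal. *)
Let W (x : A) : Prop := exists M : 'I_k.+1 -> A,
  (forall i, J (M i)) /\ x = \sum_i M i * e i.

Let W0 : W 0.
Proof.
exists (fun=> 0); split; first by have [] := J_ideal.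
by rewrite big1 // => i _; rewrite mul0r.
Qed.

Let WD x y : W x -> W y -> W (x + y).
Proof.
have [_ JD _] := J_ideal; move=> [M [hM ->]] [M' [hM' ->]].
exists (fun i => M i + M' i); split; first by move=> i; apply: JD.
by rewrite -big_split; apply: eq_bigr => i _; rewrite mulrDl.
Qed.

Let WN x : W x -> W (- x).
Proof.
have [_ _ JM] := J_ideal; move=> [M [hM ->]].
exists (fun i => - M i); split; first by move=> i; rewrite -mulN1r; apply: JM.
by rewrite -sumrN; apply: eq_bigr => i _; rewrite mulNr.
Qed.

Let W_mono x p q : J x -> (k <= p + q)%N -> W (x * (a ^+ p * b ^+ q)).
Proof.
have [J0 JD JM] := J_ideal; move=> Jx pq.
have W1 (i : 'I_k.+1) y : J y -> W (y * e i).
  move=> Jy; exists (fun l => y *+ (l == i)); split.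
    by move=> l; case: eqP.
  rewrite (bigD1 i) //= eqxx mulr1n big1 ?addr0 // => l /negbTE ->.
  by rewrite mulr0n mul0r.
have [kp|pk] := leqP k p.
  have -> : x * (a ^+ p * b ^+ q) = (a ^+ (p - k) * b ^+ q * x) * e (@ord_max k).
    rewrite /e /= subnn expr0 mulr1 -[in LHS](subnK kp) exprD; ring.
  by apply/W1/JM.
have pk1 : (p < k.+1)%N by rewrite ltnW.
have -> : x * (a ^+ p * b ^+ q) = (b ^+ (q - (k - p)) * x) * e (Ordinal pk1).
  rewrite /e /= -{1}(@subnK (k - p) q); last by lia.
  rewrite exprD; ring.
by apply/W1/JM.
Qed.

Variable j : nat.
Hypotheses (beta_j : (beta <= j)%N) (N_j : (N <= j)%N).
Let T := (k + j)%N.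
Let mono p : A := c * (a ^+ p * b ^+ (T - p)).

Let W_step n p : (n <= j)%N -> J (c * (a ^+ n - b ^+ n)) -> (p + n <= T)%N ->
  W (mono p - mono (p + n)).
Proof.
move=> nj Jn pn.
have -> : mono p - mono (p + n)
    = - (c * (a ^+ n - b ^+ n) * (a ^+ p * b ^+ (T - (p + n)))).
  rewrite /mono; have -> : (T - p = n + (T - (p + n)))%N by lia.
  rewrite !exprD; ring.
by apply/WN/W_mono => //; rewrite /T in pn *; lia.
Qed.

(** The positions in the interval from 0 to [T] are linked by steps of length
    [beta] upwards and [N] downwards: as [T >= beta + N], at each position one of
    the steps still to be made stays inside the interval. *)
Let W_conn s t p q : (p <= T)%N -> (q <= T)%N -> (p + s * beta = q + t * N)%N ->
  W (mono p - mono q).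
Proof.
have [n] := ubnP (s + t); elim: n s t p => // n IH s t p st pT qT e1.
have [/andP[s0 pb]|hs] := boolP ((0 < s) && (p + beta <= T))%N.
  have -> : mono p - mono q = (mono p - mono (p + beta)) + (mono (p + beta) - mono q).
    by ring.
  apply: WD; first exact: W_step.
  apply: (IH s.-1 t) => //; first by lia.
  by move: e1; rewrite -{1}(prednK s0) mulSn; lia.
have [/andP[t0 pN]|ht] := boolP ((0 < t) && (N <= p))%N.
  have -> : mono p - mono q = - (mono (p - N) - mono (p - N + N)) + (mono (p - N) - mono q).
    rewrite subnK //; ring.
  apply: WD; first by apply/WN/W_step; rewrite ?subnK.
  apply: (IH s t.-1) => //; try lia.
  by move: e1; rewrite -{1}(prednK t0) mulSn; lia.
have s00 : s = 0%N.
  apply/eqP; rewrite -leqn0 leqNgt; apply/negP => s0.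
  have es : (s * beta = beta + s.-1 * beta)%N by rewrite -{1}(prednK s0) mulSn.
  rewrite s0 /= -ltnNge in hs; rewrite es in e1.
  move: ht; case: (posnP t) => [t0 _|t0] /=; last first.
    move: hs; rewrite /T -ltnNge; lia.
  by move: hs qT e1; rewrite t0 mul0n; move: (s.-1 * beta)%N T; clear; lia.
move: ht e1; rewrite s00; case: (posnP t) => [-> _|t0] /=.
  by rewrite !mul0n !addn0 => ->; rewrite subrr; apply: W0.
move=> h e2; exfalso; have et : (t * N = N + t.-1 * N)%N.
  by rewrite -{1}(prednK t0) mulSn.
by move: h e2; rewrite et mul0n; move: (t.-1 * N)%N; clear; lia.
Qed.

Let W_all p q : (p + q <= T)%N -> W (mono (p + q) - mono p).
Proof.
elim: q => [|q IH] pq; first by rewrite addn0 subrr; apply: W0.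
have -> : mono (p + q.+1) - mono p =
  - (mono (p + q) - mono (p + q.+1)) + (mono (p + q) - mono p) by ring.
apply: WD; last by apply: IH; lia.
have [s [t st]] := coprime_step.
by apply/WN/(@W_conn s t); rewrite ?st; lia.
Qed.

(** Multiplication by [c (a^j - b^j)] moves the monomial [a^i b^(k-i)] of degree [k]
    to the difference of two monomials of degree [T = k + j], and each of the
    elementary steps between them is a multiple of one of the two given binomials
    by a monomial of degree at least [k]. *)
Lemma integral_closure_binomial : (forall x, x * a ^+ k = 0 -> x = 0) ->
  integral_closure J (c * (a ^+ j - b ^+ j)).
Proof.
move=> reg; have hW (i : 'I_k.+1) : W (c * (a ^+ j - b ^+ j) * e i).
  have ik := ltn_ord i.
  have -> : c * (a ^+ j - b ^+ j) * e i = mono (i + j) - mono i.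
    rewrite /mono /e /T; have -> : (k + j - (i + j) = k - i)%N by lia.
    have -> : (k + j - i = j + (k - i))%N by lia.
    rewrite !exprD; ring.
  by apply: W_all; rewrite /T; lia.
have /choice[M hM] := hW.
apply: (@integral_closure_det _ _ _ (\matrix_(i, l) M i l) (fun i : 'I_k.+1 => e i)
  _ ord_max) => [i l|i|x].
- by rewrite mxE; have [] := hM i.
- by rewrite (hM i).2; apply: eq_bigr => l _; rewrite mxE.
- by rewrite /e subnn expr0 mulr1; apply: reg.
Qed.

End BinomialClosure.

(** * The saturation is monomial *)

Section MonomialImages.
Variable R : realType.
Local Notation K := R[i].

Lemma cps_renameX n d s (s_inj : injective s) (k : 'X_{1..n}) :
  @cps_rename R n d s s_inj (cpsX R k) = cpsX R (mnm_push s k).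
Proof.
by apply/val_inj/fpsP => m /=; rewrite -mcoeff_rename // mp_renameX.
Qed.

Lemma cpsX_reg n (k : 'X_{1..n}) (x : cps R n) : x * cpsX R k = 0 -> x = 0.
Proof.
move=> h; apply/val_inj/fpsP => m.
have := congr1 (fun y : cps R n => fps_coef y (m + k)%MM) h.
rewrite cps_valM fps_coefM1 => [|k1 l e _]; rewrite cpsX_coef.
  by rewrite eqxx mulr1 => ->.
case: (k =P l) => [el _|_]; last by rewrite eqxx.
by split => //; apply: (@addIm _ k); rewrite -e el.
Qed.


Lemma cps_subst1_coef n d (g : 'I_n -> 'X_{1..d}) c_le1 g_neq0 (F : cps R n) b m :
  ((mdeg m).+1 < b)%N ->
  fps_coef (@cps_subst R n d (fun=> 1) g c_le1 g_neq0 F) m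
  = \sum_(k : 'X_{1..n < b}) fps_coef F k * (mnm_subst g k == m)%:R.
Proof.
move=> hb; transitivity (fps_coef (fps_subst (fun=> 1) g F) m) => //.
rewrite (@fps_subst_coef _ _ _ _ _ c_le1 g_neq0 F b) //.
apply: eq_bigr => k _; rewrite mp_substX mcoeffZ mcoeffX big1 ?mul1r // => i _.
exact: expr1n.
Qed.

(** For a single monomial, [X^(k + e_r) - Y^(k + e_r)] equals
    [X_r (X^k - Y^k) + (X_r - Y_r) Y^k]. *)
Lemma hadamard n d (g1 g2 : 'I_n -> 'X_{1..d}) c_le1 c_le1' g1_neq0 g2_neq0
    (F : cps R n) : exists Q : 'I_n -> cps R d,
  @cps_subst R n d (fun=> 1) g1 c_le1 g1_neq0 F
  - @cps_subst R n d (fun=> 1) g2 c_le1' g2_neq0 F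
  = \sum_l (cpsX R (g1 l) - cpsX R (g2 l)) * Q l.
Proof.
pose E k : {mpoly K[d]} := 'X_[mnm_subst g1 k] - 'X_[mnm_subst g2 k].
have [//|//|k r|Q hQ] := @telescope R n d 'I_n (fun l => 'X_[g1 l] - 'X_[g2 l])
  E g1 2 _ g1_neq0 _ _ F.
- by rewrite /E !mnm_subst0 subrr.
- exists r, (mnm_subst g2 k); split.
    have := mdeg_mnm_subst g2_neq0 k; lia.
  by rewrite /E !mnm_substD !mnm_subst1 !mpolyXD; ring.
exists Q; apply/val_inj/fpsP => m; pose b := (2 * (mdeg m).+1).+1.
have bm : ((mdeg m).+1 < b)%N by rewrite /b; lia.
transitivity (fps_coef (cps_subst c_le1 g1_neq0 F) m
  - fps_coef (cps_subst c_le1' g2_neq0 F) m) => //.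
transitivity (\sum_(k : 'X_{1..n < b}) fps_coef F k * (mnm_subst g1 k == m)%:R
  - \sum_(k : 'X_{1..n < b}) fps_coef F k * (mnm_subst g2 k == m)%:R).
  by congr (_ - _); apply: cps_subst1_coef.
rewrite -sumrB.
transitivity (fps_coef (\sum_i cps_of_mpoly ('X_[g1 i] - 'X_[g2 i]) * Q i : cps R d) m).
  rewrite -(hQ b) //; apply: eq_bigr => k _.
  by rewrite /E mcoeffB !mcoeffX mulrBr.
by congr (fps_coef _ m); congr cps_val; apply: eq_bigr => l _; rewrite raddfB.
Qed.

HB.instance Definition _ d e s s_inj := GRing.isZmodMorphism.Build _ _
  (@cps_rename R d e s s_inj) (@cps_rename_is_zmod R d e s s_inj).
HB.instance Definition _ d e s s_inj := GRing.isMonoidMorphism.Build _ _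
  (@cps_rename R d e s s_inj) (@cps_rename_is_monoid R d e s s_inj).
HB.instance Definition _ d e s s_inj := GRing.isScalable.Build K _ _ _
  (@cps_rename R d e s s_inj) (@cps_rename_scalable R d e s s_inj).

End MonomialImages.

Section Sufficiency.
Variables (R : realType) (alpha beta N : nat).
Hypotheses (alpha_gt0 : (0 < alpha)%N) (beta_gt0 : (0 < beta)%N) (N_gt0 : (0 < N)%N).
Hypothesis beta_N_coprime : coprime beta N.
Local Notation K := R[i].
Local Notation eta := (hypersurface_normalization R alpha beta N).
Local Notation gm := (sat_gen alpha beta_gt0 N_gt0).
Local Notation J := (diagonal_ideal eta).

Let u1 : cps R (2 + 2) := cps_fst (cps_var R 0).
Let v1 : cps R (2 + 2) := cps_fst (cps_var R 1).
Let u2 : cps R (2 + 2) := cps_snd (cps_var R 0).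
Let v2 : cps R (2 + 2) := cps_snd (cps_var R 1).

Let fstX a b : cps_fst (cpsX R (mnm2 a b)) = u1 ^+ a * v1 ^+ b.
Proof. by rewrite /mnm2 cpsXD !cpsXn rmorphM !rmorphXn. Qed.

Let sndX a b : cps_snd (cpsX R (mnm2 a b)) = u2 ^+ a * v2 ^+ b.
Proof. by rewrite /mnm2 cpsXD !cpsXn rmorphM !rmorphXn. Qed.

Let JP : is_ideal J.
Proof. exact: ideal_genP. Qed.

Let JB x y : J x -> J y -> J (x - y).
Proof. by have [_ JD JM] := JP => hx hy; rewrite -mulN1r; apply/JD/JM. Qed.

Let J_eta k : J (cps_fst (cpsX R (eta_mnm alpha beta N k))
  - cps_snd (cpsX R (eta_mnm alpha beta N k))).
Proof. by apply: sub_ideal_gen; exists k; rewrite // etaE. Qed.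

Let Ju : J (u1 - u2).
Proof. by have := J_eta 0; rewrite fstX sndX !mulr1. Qed.

Let Jv : J (v1 ^+ N - v2 ^+ N).
Proof.
by have := J_eta (inord 2); rewrite /eta_mnm inordK //= fstX sndX !mul1r.
Qed.

Let J_expr x y n : J (x - y) -> J (x ^+ n - y ^+ n).
Proof. by have [_ _ JM] := JP => h; rewrite subrXX mulrC; apply: JM. Qed.

Let Juv : J (u1 ^+ alpha * (v1 ^+ beta - v2 ^+ beta)).
Proof.
have [_ _ JM] := JP; have := J_eta 1; rewrite fstX sndX => h.
have -> : u1 ^+ alpha * (v1 ^+ beta - v2 ^+ beta)
  = u1 ^+ alpha * v1 ^+ beta - u2 ^+ alpha * v2 ^+ beta
    - v2 ^+ beta * (u1 ^+ alpha - u2 ^+ alpha) by ring.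
by apply: JB => //; apply/JM/J_expr.
Qed.

(** Modulo [u1 - u2], the difference is [u1^alpha (v1^j - v2^j)]. It is in the ideal
    if [N] or [beta] divides [j], and is integral over it otherwise. *)
Lemma sat_gen_integral l : integral_closure J
  (cps_fst (cpsX R (gm l)) - cps_snd (cpsX R (gm l))).
Proof.
have [_ JD JM] := JP; have [_ CD CM] := integral_closure_is_ideal J.
have JC x : J x -> integral_closure J x.
  move=> hx; exists 1%N, (fun=> - x); split => //.
    move=> i /andP[i1 i2]; have -> : i = 1%N by apply/eqP; rewrite eqn_leq i1 i2.
    apply: sub_ideal_gen; exists (- x), 1; split; rewrite ?mulr1 //.
    by rewrite -mulN1r; apply: JM.
  by rewrite big_nat1 expr1 subnn mulr1 subrr.
rewrite /sat_gen; case: ifP => _.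
  by apply: JC; rewrite fstX sndX !mulr1.
case: ifP => _; first by apply: JC; rewrite fstX sndX !mul1r.
set j := jmin _ _ _; rewrite fstX sndX.
have -> : u1 ^+ alpha * v1 ^+ j - u2 ^+ alpha * v2 ^+ j
  = u1 ^+ alpha * (v1 ^+ j - v2 ^+ j) + v2 ^+ j * (u1 ^+ alpha - u2 ^+ alpha).
  by ring.
apply: CD; last by apply/JC/JM/J_expr.
have [hj _ _] := jminP beta_gt0 N_gt0 l.-1; rewrite -/j in hj.
case/orP: hj => [/dvdnP[q ->]|/andP[bj]].
  by apply/JC/JM; rewrite mulnC !exprM; apply: J_expr.
case/orP => [/dvdnP[q ->]|Nj].
  apply: JC; rewrite mulnC !exprM subrXX mulrA mulrC; apply: JM.
  exact: Juv.
apply: (@integral_closure_binomial _ _ _ _ _ beta N) => //.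
- exact: JM.
move=> x; have -> : v1 = cpsX R (mnm_push (@lshift 2 2) U_(1)%MM).
  by rewrite /v1 /cps_fst cps_renameX.
by rewrite -cpsXn; apply: cpsX_reg.
Qed.

Lemma push_sat_gen_neq0 s l : mnm_push (d := 2) (e := 2 + 2) s (gm l) != 0%MM.
Proof. by rewrite -mdeg_eq0 mdeg_push mdeg_eq0 sat_gen_neq0. Qed.

(** The map [F |-> F(t^gamma_0, ..., t^gamma_N)] for the generators [gamma_l] of
    the semigroup. *)
Definition param : cps R N.+1 -> cps R 2 :=
  cps_subst (fun i => one_le1 R i) (sat_gen_neq0 alpha_gt0 beta_gt0 N_gt0).
HB.instance Definition _ := GRing.LRMorphism.on param.

Let rename_param s (s_inj : injective s) (F : cps R N.+1) :
  cps_rename s_inj (param F) = cps_subst (fun i => one_le1 R i) (push_sat_gen_neq0 s) F.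
Proof.
have := @cps_lrmorphism_eq R _ _ [the {lrmorphism _ -> _} of
  cps_rename s_inj \o param] [the {lrmorphism _ -> _} of
  cps_subst (fun i => one_le1 R i) (push_sat_gen_neq0 s)].
apply; first exact: tame_comp (cps_subst_tame _ _) (cps_rename_tame _).
  exact: cps_subst_tame.
move=> l; rewrite /= /param !cps_subst_var !scale1r; exact: cps_renameX.
Qed.

Lemma param_lip F : param F \in lip_pred eta.
Proof.
apply/asboolP; have [C0 CD CM] := integral_closure_is_ideal J.
have [Q hQ] := hadamard (fun i => one_le1 R i) (fun i => one_le1 R i)
  (push_sat_gen_neq0 (@lshift 2 2)) (push_sat_gen_neq0 (@rshift 2 2)) F.
rewrite /cps_fst /cps_snd !rename_param hQ.
elim/big_ind: _ => [||l _]; [exact: C0|exact: CD|rewrite mulrC; apply: CM].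
by have := sat_gen_integral l; rewrite /cps_fst /cps_snd !cps_renameX.
Qed.

Let sat_gen_deg := (\sum_l mdeg (gm l))%N.

Lemma mdeg_phi k : (mdeg (phi alpha beta_gt0 N_gt0 k) <= sat_gen_deg * mdeg k)%N.
Proof.
rewrite /phi /mnm_subst mdeg_sum [X in (_ <= _ * X)%N]mdegE big_distrr /=.
apply: leq_sum => l _; rewrite mdegMn leq_mul2r; apply/orP; right.
by rewrite /sat_gen_deg (bigD1 l) //= leq_addr.
Qed.

Lemma lift_convergent (f : cps R 2) :
  FPS (fun k => if k == nf alpha beta_gt0 N_gt0 (phi alpha beta_gt0 N_gt0 k)
    then fps_coef f (phi alpha beta_gt0 N_gt0 k) else 0) \in convergent.
Proof.
have [/(_ (valP f))[b hb] _] := convergentP f; apply/convergentP.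
exists (b.+1 ^ sat_gen_deg.+1)%N => k /=; case: ifP => _; last by rewrite normr0.
apply: le_trans (growth_leq (leqnSn b) hb _) _; rewrite ler_nat -expnM.
apply: leq_pexp2l => //; have := mdeg_phi k; rewrite mulSn mulnS; clear; lia.
Qed.

(** Among the words representing a given exponent, the normal form carries the
    coefficient. *)
Definition lift_nf (f : cps R 2) : cps R N.+1 := CPS (lift_convergent f).

Lemma lift_nfK (f : cps R 2) :
    (forall m, fps_coef f m != 0 -> saturated alpha beta N m) ->
  param (lift_nf f) = f.
Proof.
move=> hf; apply/val_inj/fpsP => m; pose b := (mdeg m).+2.
rewrite [LHS](cps_subst1_coef _ _ _ (ltnSn (mdeg m).+1)).
pose F k := fps_coef (lift_nf f) k
  * (mnm_subst gm k == m)%:R.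
have [ms|ms] := boolP (saturated alpha beta N m); last first.
  have -> : fps_coef f m = 0 by apply/eqP; apply: contraNT ms => /hf.
  rewrite big1 // => k _; case: eqP => [e|_]; last by rewrite mulr0.
  by case/negP: ms; rewrite -e; apply: saturated_phi.
have e := nfK alpha_gt0 beta_gt0 N_gt0 ms.
rewrite (@bmultinom_sum1 _ _ _ F (nf alpha beta_gt0 N_gt0 m)) /F.
- rewrite /= e eqxx [mnm_subst _ _]e eqxx mulr1 //.
- rewrite -[in X in (_ < X)%N]e; have := mdeg_mnm_subst (sat_gen_neq0 alpha_gt0 beta_gt0 N_gt0) (nf alpha beta_gt0 N_gt0 m).
  by rewrite /phi; clear; lia.
move=> k hk; case: eqP => [ek|_]; last by rewrite mulr0.
by rewrite /= [phi _ _ _ k]ek (negbTE hk) mul0r.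
Qed.

(** The saturation is the ring of convergent series with exponents in [Gamma]. *)
Lemma lip_predE (f : cps R 2) : f \in lip_pred eta <->
  forall m, fps_coef f m != 0 -> saturated alpha beta N m.
Proof.
split; first exact: lip_supp.
by move=> hf; rewrite -(lift_nfK hf) param_lip.
Qed.

End Sufficiency.

(** * The local ring of convergent power series *)

Section PowerSeriesLocal.
Variables (R : realType) (n : nat).
Local Notation K := R[i].
Implicit Types (x : fps K n) (f : cps R n).

Lemma fps_coefX_low x j (m : 'X_{1..n}) : fps_coef x 0%MM = 0 ->
  (mdeg m < j)%N -> fps_coef (x ^+ j) m = 0.
Proof.
move=> x0 mj; apply/eqP; apply: contraLR mj => h; rewrite -leqNgt.
elim: j m h => // j IH m; rewrite exprS => /fps_coefM_supp[k [l [-> hk /IH hl]]].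
rewrite mdegD -add1n leq_add // lt0n mdeg_eq0.
by apply: contraNneq hk => ->; rewrite x0.
Qed.

(** The geometric series [1 + x + x^2 + ...]: for [x] without constant term, only
    the powers up to the degree of [m] contribute to the coefficient of [m]. *)
Definition fps_geom x : fps K n :=
  FPS (fun m => fps_coef (\sum_(j < (mdeg m).+1) x ^+ j) m).

Lemma fps_geom_agree x b m : fps_coef x 0%MM = 0 -> (mdeg m < b)%N ->
  fps_coef (fps_geom x) m = fps_coef (\sum_(j < b) x ^+ j) m.
Proof.
move=> x0 mb; rewrite /= !fps_coef_sum.
rewrite -!(big_mkord xpredT (fun j => fps_coef (x ^+ j) m)).
rewrite (big_cat_nat (n := (mdeg m).+1) (leq0n _) mb) /=.
rewrite [X in _ + X]big_nat_cond [X in _ + X]big1 ?addr0 // => j.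
by move=> /andP[/andP[h _] _]; apply: fps_coefX_low.
Qed.

Lemma fps_geomP x : fps_coef x 0%MM = 0 -> (1 - x) * fps_geom x = 1.
Proof.
move=> x0; apply: fpsP => m; set b := (mdeg m).+1.
rewrite (fps_tameM (F' := 1 - x) (G' := \sum_(j < b) x ^+ j) (b := b)) //.
  rewrite -[1 - x]opprB mulNr -subrX1 opprB fps_coefD fps_coefN fps_coefX_low //.
  by rewrite subr0.
by move=> k hk; apply: fps_geom_agree.
Qed.

Lemma fps_geom_supp x (S : 'X_{1..n} -> Prop) : S 0%MM ->
    (forall k l, S k -> S l -> S (k + l)%MM) ->
    (forall m, fps_coef x m != 0 -> S m) ->
  forall m, fps_coef (fps_geom x) m != 0 -> S m.
Proof.
move=> S0 SD Sx m; have SX j k : fps_coef (x ^+ j) k != 0 -> S k.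
  elim: j k => [|j IH] k; first by rewrite expr0 /=; case: (k =P _) => [->|]; rewrite // eqxx.
  by rewrite exprS => /fps_coefM_supp[k1 [k2 [-> /Sx h1 /IH h2]]]; apply: SD.
rewrite /= fps_coef_sum => h; apply: contrapT => hm; move/eqP: h; apply.
by apply: big1 => j _; apply/eqP; apply: contrapT => /negP/SX.
Qed.

(** The second index of a convolution is determined by the first one, over which
    the geometric weights are summable. *)
Lemma fps_coefM_norm (x y : fps K n) m (B : K) : 0 <= B ->
    (forall k l, m = (k + l)%MM ->
      `|fps_coef x k| * `|fps_coef y l| <= B * 2^-1 ^+ mdeg k) ->
  `|fps_coef (x * y) m| <= B * 2 ^+ n.
Proof.
move=> B0 h; apply: (le_trans (ler_norm_sum _ _ _)).
pose F (k : 'X_{1..n}) : K := B * 2^-1 ^+ mdeg k.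
have F0 k : 0 <= F k by rewrite mulr_ge0 ?exprn_ge0 ?invr_ge0.
apply: (@le_trans _ _ (\sum_(k : 'X_{1..n < (mdeg m).+1, (mdeg m).+1}
    | m == (k.1 + k.2)%MM) F k.1)).
  by apply: ler_sum => -[k1 k2] /= /eqP mk; rewrite normrM; apply: h.
apply: (@le_trans _ _ (\sum_(k1 : 'X_{1..n < (mdeg m).+1}) F k1)).
  rewrite -(pair_big_dep xpredT (fun k1 k2 : 'X_{1..n < (mdeg m).+1} =>
    m == (k1 + k2)%MM) (fun k1 _ => F k1)) /=.
  apply: ler_sum => k1 _; have [[k2 hk2]|hn] := pselect (exists k2 :
      'X_{1..n < (mdeg m).+1}, m == (k1 + k2)%MM).
    rewrite (big_pred1 k2) // => k3 /=; rewrite bmeqP.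
    apply/eqP/eqP => [e3|->]; last exact/eqP.
    by apply: (@addmI _ k1); rewrite -e3; apply/eqP.
  by rewrite big_pred0 ?F0 // => k2; apply/negP => hk; apply: hn; exists k2.
rewrite -mulr_sumr ler_wpM2l //; exact: sum_geometric.
Qed.

(** By induction on the degree, from the recursion [g = 1 + x g]. *)
Lemma fps_geom_convergent x : fps_coef x 0%MM = 0 -> x \in convergent ->
  fps_geom x \in convergent.
Proof.
move=> x0 /convergentP[b0 /(growth_leq (leqnSn b0))]; move: b0.+1 (ltn0Sn b0).
move=> b b0' hb; set g := fps_geom x.
have e : g = 1 + x * g by rewrite -[in RHS](fps_geomP x0) mulrBl mul1r subrK.
(* One of the factors [b] of [D] compensates the growth of [x], the factor 2 makes
   the weights of [fps_coefM_norm] appear, and the remaining factor [b 2 ^ n] is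
   gained once because [x] has no constant term. *)
pose D := (b * (2 * (b * 2 ^ n)))%N.
have D0 : (0 < D)%N by rewrite !muln_gt0 b0' expn_gt0.
suff hg m : `|fps_coef g m| <= (D ^ mdeg m)%:R.
  apply/convergentP; exists D => m; apply: le_trans (hg m) _.
  by rewrite ler_nat leq_pexp2l.
have [s] := ubnP (mdeg m); elim: s m => // s IH m; rewrite ltnS => ms.
have [->|m0] := eqVneq m 0%MM.
  by rewrite /g /= mdeg0 big_ord1 expr0 /= eqxx normr1.
rewrite e fps_coefD [fps_coef 1 m]/= (negbTE m0) add0r.
have D0R : 0 <= (D ^ mdeg m)%:R * 2 ^- n :> K by rewrite mulr_ge0 ?invr_ge0 ?exprn_ge0.
apply: le_trans (fps_coefM_norm D0R _) _; last first.
  by rewrite -mulrA mulVf ?mulr1 ?expf_neq0 ?pnatr_eq0.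
move=> k1 k2 mk; have [k10|k10] := eqVneq k1 0%MM.
  by rewrite k10 x0 normr0 mul0r mulr_ge0 ?exprn_ge0 ?invr_ge0.
have d1 : (0 < mdeg k1)%N by rewrite lt0n mdeg_eq0.
have dm : mdeg m = (mdeg k1 + mdeg k2)%N by rewrite mk mdegD.
apply: (@le_trans _ _ ((b ^ (mdeg k1).+1)%:R * (D ^ mdeg k2)%:R)).
  by apply: ler_pM => //; apply: IH; apply: leq_trans ms; rewrite dm; lia.
rewrite exprVn -mulrA -invfM -exprD ler_pdivlMr ?exprn_gt0 ?ltr0n //.
rewrite -!natrX -!natrM ler_nat dm [(D ^ (_ + _))%N]expnD mulnAC leq_mul2r.
apply/orP; right; set c := (b * 2 ^ n)%N.
have c0 : (0 < c)%N by rewrite muln_gt0 b0' expn_gt0.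
apply: (@leq_trans (b ^ mdeg k1 * (2 ^ mdeg k1 * c))%N).
  by rewrite expnS expnD /c; apply/eq_leq; ring.
rewrite /D -/c (expnMn b) (expnMn 2 c) !leq_mul2l; do 2!(apply/orP; right).
by apply: (@leq_pexp2l c 1).
Qed.

(** Up to a scalar, [f] is [1 - x] with [x] in the maximal ideal. The monoid [S] is
    there to invert inside the subring of series with exponents in [S]. *)
Lemma cps_inverse f (S : 'X_{1..n} -> Prop) : S 0%MM ->
    (forall k l, S k -> S l -> S (k + l)%MM) ->
    (forall m, fps_coef f m != 0 -> S m) -> fps_coef f 0%MM != 0 ->
  exists g : cps R n, f * g = 1 /\ forall m, fps_coef g m != 0 -> S m.
Proof.
move=> S0 SD Sf f0; pose c := fps_coef f 0%MM; pose x : fps K n := 1 - c^-1 *: cps_val f.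
have x0 : fps_coef x 0%MM = 0 by rewrite /= eqxx mulVf // subrr.
have Sx m : fps_coef x m != 0 -> S m.
  rewrite /= ; case: (m =P 0%MM) => [->//|_]; rewrite add0r oppr_eq0 mulf_eq0.
  by rewrite negb_or => /andP[_ /Sf].
have cx : x \in convergent.
  have -> : x = (- c^-1) *: cps_val f + 1 by rewrite scaleNr addrC.
  apply: convergent_lin; first exact: valP.
  exact: convergent1.
pose g : cps R n := c^-1 *: CPS (fps_geom_convergent x0 cx).
exists g; split.
  apply: val_inj; rewrite /= -scalerAr scalerAl.
  by rewrite -[c^-1 *: cps_val f](subKr 1) fps_geomP.
move=> m; rewrite /= mulf_eq0 negb_or => /andP[_]; exact: fps_geom_supp.
Qed.

Lemma cpsX_mul_coef (k : 'X_{1..n}) f m :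
  fps_coef (cpsX R k * f) m = if (k <= m)%MM then fps_coef f (m - k)%MM else 0.
Proof.
case: ifP => km.
  rewrite -[in LHS](submK km) addmC cps_valM fps_coefM1.
    by rewrite cpsX_coef eqxx mul1r.
  move=> k1 l e; rewrite cpsX_coef; case: (k =P k1) => [ek|_]; last by rewrite eqxx.
  by move=> _ _; split => //; apply: (@addmI _ k); rewrite -e ek.
apply/eqP; apply: contraFT km; rewrite cps_valM => /fps_coefM_supp[k1 [l [-> + _]]].
rewrite cpsX_coef; case: (k =P k1) => [<- _|_]; last by rewrite eqxx.
exact: lem_addr.
Qed.

(** Each monomial is assigned to the first of the variables dividing it. *)
Lemma cps_split f : fps_coef f 0%MM = 0 -> exists Q : 'I_n -> cps R n,
  f = \sum_l cps_var R l * Q l /\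
  forall j, (forall m, fps_coef f m != 0 -> (j < mdeg m)%N) ->
    forall l m, fps_coef (Q l) m != 0 -> (j <= mdeg m)%N.
Proof.
move=> f0; pose first (m : 'X_{1..n}) (l : 'I_n) :=
  (m l != 0%N) && [forall l' : 'I_n, (l' < l)%N ==> (m l' == 0%N)].
pose q l : fps K n := FPS (fun m =>
  if first (m + U_(l))%MM l then fps_coef f (m + U_(l))%MM else 0).
have cq l : q l \in convergent.
  have /convergentP[b hb] := valP f; apply/convergentP; exists (b.+1 ^ 2)%N => m /=.
  case: ifP => _; last by rewrite normr0.
  apply: le_trans (growth_leq (leqnSn b) hb _) _.
  by rewrite ler_nat -expnM leq_pexp2l // mdegD mdeg1; lia.
exists (fun l => CPS (cq l)); split; last first.
  move=> j hj l m /=; case: ifP => _; last by rewrite eqxx.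
  by move=> /hj; rewrite mdegD mdeg1 addn1 ltnS.
apply/val_inj/fpsP => m; rewrite [RHS]cps_coef_sum.
under eq_bigr => l _ do rewrite (cpsX_mul_coef U_(l)%MM).
have E l : (if (U_(l) <= m)%MM then fps_coef (CPS (cq l)) (m - U_(l))%MM else 0)
    = if first m l then fps_coef f m else 0.
  rewrite lep1mP; case: ifP => ml /=; last by rewrite /first ml.
  by rewrite submK ?lep1mP.
under eq_bigr => l _ do rewrite E.
have [m0|m0] := eqVneq m 0%MM.
  by rewrite big1 ?m0 // => l _; rewrite /first mnm0E eqxx.
have [l0 ml0] : exists l, m l != 0%N.
  apply/existsP; apply: contraNT m0; rewrite negb_exists => /forallP h.
  by apply/eqP/mnmP => l; rewrite mnm0E; apply/eqP; move: (h l); rewrite negbK.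
case: (@arg_minnP _ l0 (fun l => m l != 0%N) (fun l => l : nat) ml0) => l ml lmin.
have Fl : first m l.
  rewrite /first ml; apply/forallP => l'; apply/implyP => ll'.
  by rewrite -[_ == _]negbK; apply/negP => /lmin; rewrite leqNgt ll'.
rewrite (bigD1 l) //= Fl big1 ?addr0 // => l' ll'; case: ifP => //.
move=> /andP[ml' /forallP h']; case/negP: ll'; apply/eqP/val_inj/eqP => /=.
rewrite eqn_leq (lmin _ ml') andbT leqNgt; apply/negP => lt.
by move/implyP: (h' l) => /(_ lt); rewrite (negbTE ml).
Qed.

End PowerSeriesLocal.

(** * Powers of the maximal ideal *)

Section SaturatedRing.
Variables (R : realType) (alpha beta N : nat).
Hypotheses (alpha_gt0 : (0 < alpha)%N) (beta_gt0 : (0 < beta)%N) (N_gt0 : (0 < N)%N).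
Hypothesis beta_N_coprime : coprime beta N.
Local Notation K := R[i].
Local Notation eta := (hypersurface_normalization R alpha beta N).
Local Notation Xs := (lipschitz_saturation eta).
Local Notation gm := (sat_gen alpha beta_gt0 N_gt0).
Local Notation ph := (phi alpha beta_gt0 N_gt0).
Local Notation nrm := (nf alpha beta_gt0 N_gt0).
Local Notation sat := (saturated alpha beta N).
Local Notation par := (@param R alpha beta N alpha_gt0 beta_gt0 N_gt0).
Local Notation lift := (lift_nf alpha beta_gt0 N_gt0).

Definition Xcoef (x : Xs) (m : 'X_{1..2}) : K := fps_coef (lip_val x) m.

Lemma XcoefP (x y : Xs) : Xcoef x =1 Xcoef y -> x = y.
Proof. by move=> h; apply/val_inj/val_inj/fpsP. Qed.

Lemma Xcoef_sat (x : Xs) m : Xcoef x m != 0 -> sat m.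
Proof. by apply: lip_supp => //; apply: valP. Qed.

Lemma XcoefD (x y : Xs) m : Xcoef (x + y) m = Xcoef x m + Xcoef y m.
Proof. by []. Qed.
Lemma XcoefB (x y : Xs) m : Xcoef (x - y) m = Xcoef x m - Xcoef y m.
Proof. by []. Qed.
Lemma XcoefZ a (x : Xs) m : Xcoef (a *: x) m = a * Xcoef x m.
Proof. by []. Qed.
Lemma Xcoef0 m : Xcoef 0 m = 0.
Proof. by []. Qed.
Lemma Xcoef1 m : Xcoef 1 m = (m == 0%MM)%:R.
Proof. by []. Qed.
Lemma Xcoef_sum (I : Type) (r : seq I) (P : pred I) (F : I -> Xs) m :
  Xcoef (\sum_(i <- r | P i) F i) m = \sum_(i <- r | P i) Xcoef (F i) m.
Proof.
elim: r => [|i r IH]; first by rewrite !big_nil.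
by rewrite !big_cons; case: ifP => // _; rewrite XcoefD IH.
Qed.
Lemma XcoefM_supp (x y : Xs) m : Xcoef (x * y) m != 0 ->
  exists k l, [/\ m = (k + l)%MM, Xcoef x k != 0 & Xcoef y l != 0].
Proof. exact: (@fps_coefM_supp _ _ (lip_val x) (lip_val y) m). Qed.

Definition Xparam (F : cps R N.+1) : Xs :=
  Lip (param_lip alpha_gt0 beta_gt0 N_gt0 beta_N_coprime F).

Fact Xparam_is_zmod : zmod_morphism Xparam.
Proof.
move=> F G; apply: val_inj; suff : par (F - G) = par F - par G by [].
exact: rmorphB.
Qed.
Fact Xparam_is_monoid : monoid_morphism Xparam.
Proof.
split.
  by apply: val_inj; suff : par 1 = 1 by []; exact: rmorph1.
move=> F G; apply: val_inj; suff : par (F * G) = par F * par G by [].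
exact: rmorphM.
Qed.
Fact Xparam_scalable : scalable Xparam.
Proof.
move=> a F; apply: val_inj; suff : par (a *: F) = a *: par F by [].
exact: linearZ_LR.
Qed.
HB.instance Definition _ := GRing.isZmodMorphism.Build _ _ Xparam Xparam_is_zmod.
HB.instance Definition _ :=
  GRing.isMonoidMorphism.Build _ _ Xparam Xparam_is_monoid.
HB.instance Definition _ :=
  GRing.isScalable.Build K _ _ _ Xparam Xparam_scalable.

Definition Xlift (x : Xs) : cps R N.+1 := lift (lip_val x).

Lemma XliftK : cancel Xlift Xparam.
Proof. by move=> x; apply/val_inj/lift_nfK => m; apply: Xcoef_sat. Qed.

Lemma Xlift_coef x k : fps_coef (Xlift x) k
  = if k == nrm (ph k) then Xcoef x (ph k) else 0.
Proof. by []. Qed.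

Lemma XparamX k : lip_val (Xparam (cpsX R k)) = cpsX R (ph k).
Proof.
rewrite /= /param cps_substX big1 ?scale1r // => i _; exact: expr1n.
Qed.

Lemma XparamX_coef k m : Xcoef (Xparam (cpsX R k)) m = (ph k == m)%:R.
Proof. by rewrite /Xcoef XparamX cpsX_coef. Qed.

(** The inverse taken in the ring of all convergent series has its exponents in
    [Gamma] again. *)
Lemma nonunitsE (x : Xs) : nonunits x <-> Xcoef x 0%MM = 0.
Proof.
split.
  move=> h; apply: contrapT => /eqP x0; apply: h.
  have [g [fg Sg]] := cps_inverse (saturated0 alpha beta N)
    (@saturatedD alpha beta N alpha_gt0 beta_gt0 N_gt0) (fun m => @Xcoef_sat x m) x0.
  have hg : g \in lip_pred eta by apply/lip_predE.
  by exists (Lip hg); apply: val_inj.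
move=> x0 [y xy]; have := Xcoef1 0%MM; rewrite -xy eqxx => h.
have /XcoefM_supp[k [l [e hk _]]] : Xcoef (x * y) 0%MM != 0 by rewrite h oner_eq0.
have /andP[/eqP k0 _] : (k == 0%MM) && (l == 0%MM) by rewrite -mnmD_eq0 -e.
by rewrite k0 x0 eqxx in hk.
Qed.

Lemma mdeg_nfD m k : sat m -> sat k ->
  (mdeg (nrm m) + mdeg (nrm k) <= mdeg (nrm (m + k)%MM))%N.
Proof.
move=> hm hk; rewrite -mdegD.
by have := mdeg_nf alpha_gt0 beta_gt0 N_gt0 (nrm m + nrm k)%MM; rewrite phiD !nfK.
Qed.

Lemma nf_gt0 m : sat m -> m != 0%MM -> (0 < mdeg (nrm m))%N.
Proof.
move=> hm; rewrite lt0n mdeg_eq0; apply: contra => /eqP e.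
by rewrite -(nfK alpha_gt0 beta_gt0 N_gt0 hm) e phi0.
Qed.

(** Normal forms being longest, the length of the normal form is superadditive, and
    it is positive on the exponents of non-units. *)
Lemma max_ideal_exp_sub k (x : Xs) : ideal_exp (@nonunits Xs) k x ->
  forall m, Xcoef x m != 0 -> (k <= mdeg (nrm m))%N.
Proof.
elim: k x => // k IH x [n [c [s [hs ->]]]] m; rewrite Xcoef_sum => h.
have [i hi] : exists i, Xcoef (c i * s i) m != 0.
  apply: contrapT => hn; move/eqP: h; apply; apply: big1 => i _.
  by apply/eqP; apply: contrapT => /negP hi; apply: hn; exists i.
have [y [z [/nonunitsE y0 /IH hz e]]] := hs i.
move: hi; rewrite e => /XcoefM_supp[k1 [l [-> h1 /XcoefM_supp[k2 [k3 [e2 h2 h3]]]]]].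
have s1 := Xcoef_sat h1; have s2 := Xcoef_sat h2; have s3 := Xcoef_sat h3.
have k20 : k2 != 0%MM by apply: contraNneq h2 => ->; rewrite y0.
rewrite e2; apply: leq_trans (mdeg_nfD s1 (saturatedD alpha_gt0 beta_gt0 N_gt0 s2 s3)).
apply: leq_trans (leq_addl _ _); apply: leq_trans (mdeg_nfD s2 s3).
by rewrite -add1n leq_add ?nf_gt0 // hz.
Qed.

(** Factor out the variables one at a time; their images are not invertible. *)
Lemma Xparam_max_ideal_exp k (F : cps R N.+1) :
    (forall m, fps_coef F m != 0 -> (k <= mdeg m)%N) ->
  ideal_exp (@nonunits Xs) k (Xparam F).
Proof.
elim: k F => // k IH F hF.
have F0 : fps_coef F 0%MM = 0.
  by apply/eqP; apply: contrapT => /negP /hF; rewrite mdeg0.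
have [Q [FQ /(_ _ hF) hQ]] := cps_split F0; rewrite FQ raddf_sum.
have [J0 JD JM] := ideal_expP (@nonunits Xs) k.+1.
elim/big_ind: _ => [||l _]; [exact: J0|exact: JD|].
apply: sub_ideal_gen; exists (Xparam (cps_var R l)), (Xparam (Q l)); split.
- apply/nonunitsE; rewrite (XparamX_coef U_(l)%MM) phi1.
  by rewrite (negbTE (sat_gen_neq0 alpha_gt0 beta_gt0 N_gt0 l)).
- by apply: IH; apply: hQ.
- exact: rmorphM.
Qed.

Lemma max_ideal_expE k (x : Xs) : ideal_exp (@nonunits Xs) k x <->
  forall m, Xcoef x m != 0 -> (k <= mdeg (nrm m))%N.
Proof.
split; first exact: max_ideal_exp_sub.
move=> h; rewrite -(XliftK x); apply: Xparam_max_ideal_exp => m.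
rewrite Xlift_coef; case: (m =P _) => [e|_]; last by rewrite eqxx.
by move=> /h; rewrite -e.
Qed.

(** Subspaces cut out by conditions on the exponents: the monomials allowed in [V]
    but not in [W] are a basis of the quotient. *)
Lemma quot_dim_monomials (T : finType) (D : {pred T}) (mon : T -> 'X_{1..N.+1})
    (SV SW : pred 'X_{1..2}) (V W : set Xs) :
    {in D &, injective (ph \o mon)} ->
    (forall x, V x <-> forall m, Xcoef x m != 0 -> SV m) ->
    (forall x, W x <-> forall m, Xcoef x m != 0 -> SW m) ->
    (forall t, t \in D -> SV (ph (mon t)) && ~~ SW (ph (mon t))) ->
    (forall m, sat m -> SV m -> ~~ SW m -> exists2 t, t \in D & m = ph (mon t)) ->
  quot_dim V W #|D|.
Proof.
move=> inj hV hW hD hm; pose e (i : 'I_#|D|) := ph (mon (enum_val i)).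
have e_inj : injective e.
  by move=> i j /inj h; apply/enum_val_inj/h; apply: enum_valP.
exists (fun i => Xparam (cpsX R (mon (enum_val i)))); split.
  move=> i; apply/hV => m; rewrite XparamX_coef; case: (_ =P m) => [<- _|_].
    by have /andP[] := hD _ (enum_valP i).
  by rewrite eqxx.
have lin (c : 'rV[K]_#|D|) m : Xcoef (\sum_(i < #|D|) c 0 i *: Xparam (cpsX R (mon (enum_val i)))) m
    = \sum_(i < #|D|) c 0 i * (e i == m)%:R.
  by rewrite Xcoef_sum; apply: eq_bigr => i _; rewrite XcoefZ XparamX_coef.
have lin1 (c : 'rV[K]_#|D|) i : \sum_(j < #|D|) c 0 j * (e j == e i)%:R = c 0 i.
  rewrite (bigD1 i) //= eqxx mulr1 big1 ?addr0 // => j ji.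
  by rewrite (inj_eq e_inj) (negbTE ji) mulr0.
move=> a /hV Va; exists (\row_i Xcoef a (e i)); split.
  apply/hW => m; rewrite XcoefB lin => h.
  have [[i ei]|hn] := pselect (exists i, e i = m).
    by move: h; rewrite -ei lin1 mxE subrr eqxx.
  rewrite big1 ?subr0 in h; last first.
    by move=> i _; case: (e i =P m) => [ei|_]; [case: hn; exists i|rewrite mulr0].
  apply: contrapT => /negP Wm; have [t tD et] := hm m (Xcoef_sat h) (Va m h) Wm.
  by apply: hn; exists (enum_rank_in tD t); rewrite /e enum_rankK_in.
move=> c /hW hc; apply/rowP => i; rewrite mxE; apply/eqP.
have /andP[_ nW] := hD _ (enum_valP i).
by apply: contraNT nW => ne; apply: hc; rewrite XcoefB lin lin1 subr_eq0.
Qed.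

End SaturatedRing.

(** * Embedding dimension and Hilbert-Samuel polynomial *)

Section Invariants.
Variables (R : realType) (alpha beta N : nat).
Hypotheses (alpha_gt0 : (0 < alpha)%N) (beta_gt0 : (0 < beta)%N) (N_gt0 : (0 < N)%N).
Hypothesis beta_N_coprime : coprime beta N.
Local Notation K := R[i].
Local Notation eta := (hypersurface_normalization R alpha beta N).
Local Notation Xs := (lipschitz_saturation eta).
Local Notation gm := (sat_gen alpha beta_gt0 N_gt0).
Local Notation ph := (phi alpha beta_gt0 N_gt0).
Local Notation nrm := (nf alpha beta_gt0 N_gt0).
Local Notation sat := (saturated alpha beta N).
Local Notation Xpar := (@Xparam R alpha beta N alpha_gt0 beta_gt0 N_gt0 beta_N_coprime).

(** The normal forms of length one are the generators. *)
Lemma embedding_dim_saturation : embedding_dim Xs N.+1.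
Proof.
rewrite /embedding_dim.
suff : quot_dim (@nonunits Xs) (ideal_exp (@nonunits Xs) 2) #|'I_N.+1|.
  by rewrite card_ord.
have H := @quot_dim_monomials R alpha beta N alpha_gt0 beta_gt0 N_gt0 beta_N_coprime
  'I_N.+1 predT (fun l => U_(l)%MM) (fun m => m != 0%MM)
  (fun m => (2 <= mdeg (nrm m))%N) (@nonunits Xs) (ideal_exp (@nonunits Xs) 2).
apply: H.
- move=> l l' _ _ /(congr1 nrm); rewrite /= !(nf_mnm1 alpha_gt0) => e.
  by apply/eqP; rewrite -eq_mnm1 e.
- move=> x; rewrite (nonunitsE alpha_gt0 beta_gt0 N_gt0 beta_N_coprime); split.
    by move=> x0 m; apply: contraNneq => ->; rewrite x0.
  by move=> h; apply/eqP; apply: contrapT => /negP /h; rewrite eqxx.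
- by move=> x; rewrite (max_ideal_expE alpha_gt0 beta_gt0 N_gt0 beta_N_coprime).
- move=> l _; rewrite (nf_mnm1 alpha_gt0) mdeg1 phi1 (sat_gen_neq0 alpha_gt0) //.
move=> m hm m0; rewrite -ltnNge ltnS => h.
have : mdeg (nrm m) == 1%N by rewrite eqn_leq h (nf_gt0 alpha_gt0).
move=> /mdeg1P[l /eqP e]; exists l => //.
by rewrite -e (nfK alpha_gt0).
Qed.

Lemma sum_ltn_ord k c : (\sum_(b < k) (b < c))%N = minn c k.
Proof.
elim: k => [|k IH]; first by rewrite big_ord0 minn0.
by rewrite big_ord_recr /= IH; case: ltnP; lia.
Qed.

(** The pairs [(a, b)] with [a + b < k], respectively [a + b + 1 < k], form a
    triangle; there is one triangle of the first kind, for the residue class 0, and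
    [N - 1] of the second kind. *)
Lemma card_normal_words k : (2 * #|[pred t : 'I_k * 'I_k * 'I_N |
    t.1.1 + t.1.2 + (t.2 != 0%N :> nat) < k]| = k * k.+1 + N.-1 * (k * k.-1))%N.
Proof.
have S e : (2 * \sum_(a < k) \sum_(b < k) (a + b + e < k) = (k - e) * (k - e).+1)%N.
  have -> : (\sum_(a < k) \sum_(b < k) (a + b + e < k))%N = (\sum_(a < k) (k - e - a))%N.
    apply: eq_bigr => a _; rewrite (eq_bigr (fun b : 'I_k => (b < k - e - a)%N : nat)).
      by rewrite sum_ltn_ord; apply/minn_idPl; lia.
    by move=> b _; congr nat_of_bool; lia.
  have -> : (\sum_(a < k) (k - e - a) = \sum_(a < k - e) (k - e - a))%N.
    rewrite -!(big_mkord xpredT (fun a => k - e - a)%N).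
    rewrite (big_cat_nat (n := (k - e)%N) (leq0n _) (leq_subr _ _)) /=.
    rewrite [X in (_ + X)%N]big_nat_cond [X in (_ + X)%N]big1 ?addn0 // => a.
    by move=> /andP[/andP[h _] _]; lia.
  move: (k - e)%N => c; elim: c => [|c IH]; first by rewrite big_ord0.
  rewrite big_ord_recl subn0 (eq_bigr (fun a : 'I_c => c - a)%N); last first.
    by move=> a _; rewrite /= subSS.
  by rewrite mulnDr IH; lia.
rewrite -sum1_card big_mkcond /=.
rewrite -(pair_bigA _ (fun (p : 'I_k * 'I_k) (r : 'I_N) =>
  if (p.1 + p.2 + (r != 0%N :> nat) < k)%N then 1 else 0)%N) /= exchange_big /=.
have E (r : 'I_N) : (2 * \sum_(p : 'I_k * 'I_k)
     (if (p.1 + p.2 + (r != 0%N :> nat) < k)%N then 1 else 0) =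
     if r == 0%N :> nat then k * k.+1 else k * k.-1)%N.
  rewrite -(pair_bigA _ (fun (a b : 'I_k) =>
    if (a + b + (r != 0%N :> nat) < k)%N then 1 else 0)%N) /=.
  rewrite (eq_bigr (fun a : 'I_k => \sum_(b < k) (a + b + (r != 0%N :> nat) < k)%N)%N).
    by rewrite S; case: eqP => _; rewrite /= ?subn0 //; case: (k) => // k'; lia.
  by move=> a _; apply: eq_bigr => b _; case: ifP.
rewrite big_distrr /= (eq_bigr _ (fun r _ => E r)).
case: (N) N_gt0 => // n _; rewrite big_ord_recl /=; congr (_ + _)%N.
by rewrite sum_nat_const card_ord.
Qed.

Lemma hilbert_samuel_quot_dim k :
  quot_dim [set: Xs] (ideal_exp (@nonunits Xs) k)
    #|[pred t : 'I_k * 'I_k * 'I_N | t.1.1 + t.1.2 + (t.2 != 0%N :> nat) < k]%N|.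
Proof.
have wordE (t : 'I_k * 'I_k * 'I_N) : ph (word N t.1.1 t.1.2 t.2)
  = mnm2 (t.1.1 + amin alpha t.2) (t.1.2 * N + jmin beta_gt0 N_gt0 t.2).
  by rewrite phi_word.
have H := @quot_dim_monomials R alpha beta N alpha_gt0 beta_gt0 N_gt0 beta_N_coprime
  _ [pred t : 'I_k * 'I_k * 'I_N | t.1.1 + t.1.2 + (t.2 != 0%N :> nat) < k]%N
  (fun t => word N t.1.1 t.1.2 t.2) predT (fun m => (k <= mdeg (nrm m))%N)
  [set: Xs] (ideal_exp (@nonunits Xs) k).
apply: H.
- move=> [[a b] r] [[a' b'] r'] _ _ /=.
  rewrite [LHS](wordE ((a, b), r)) [RHS](wordE ((a', b'), r')) /= => e.
  have := congr1 (fun m : 'X_{1..2} => m 1%R) e; rewrite !mnm2_1 => e1.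
  have := congr1 (fun m : 'X_{1..2} => m 0%R) e; rewrite !mnm2_0 => e0.
  have [_ er _] := jminP beta_gt0 N_gt0 r; have [_ er' _] := jminP beta_gt0 N_gt0 r'.
  have rr : r = r'.
    apply: val_inj; have := congr1 (modn^~ N) e1.
    by rewrite /= !modnMDl er er' !modn_small.
  move: e0 e1; rewrite rr => /addIn e0 /addIn/eqP.
  rewrite eqn_pmul2r // => /eqP e1.
  by congr (_, _, _); apply: val_inj.
- by move=> x; split.
- by move=> x; rewrite (max_ideal_expE alpha_gt0 beta_gt0 N_gt0 beta_N_coprime).
- move=> [[a b] r]; rewrite inE /= => h.
  by rewrite nf_word // mdeg_word -ltnNge.
move=> m hm _; rewrite -ltnNge => hk; have hw : nrm m = word N _ _ _ := erefl.
move: hk; rewrite hw mdeg_word; set a := (_ - _)%N; set b := (_ %/ _)%N.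
set r := (_ %% _)%N => hk.
have ak : (a < k)%N by lia.
have bk : (b < k)%N by lia.
have rN : (r < N)%N by rewrite ltn_mod.
exists (Ordinal ak, Ordinal bk, Ordinal rN); first by rewrite inE.
by rewrite /= -hw (nfK alpha_gt0).
Qed.

Lemma hilbert_samuel_saturation : hilbert_samuel_poly Xs
  ((N%:R / 2%:R) *: 'X^2 + ((2%:R - N%:R) / 2%:R) *: 'X).
Proof.
exists 0%N => k _; eexists; first exact: hilbert_samuel_quot_dim.
rewrite hornerD !hornerZ hornerXn hornerX.
have := congr1 (fun n => n%:R : rat) (card_normal_words k); rewrite natrM.
set c : rat := _%:R; move=> /(canRL (mulKf _)) ->; last by rewrite pnatr_eq0.
case: (k) => [|k']; first by rewrite !muln0 mul0n expr0n !mulr0 addr0.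
rewrite -[in RHS](prednK N_gt0) -(prednK N_gt0) /=.
rewrite !natrD !natrM -![k'.+1%:R]natr1 -![k'.+2%:R]natr1 -![_.-1.+1%:R]natr1 -![k'.+1%:R]natr1.
by field.
Qed.

End Invariants.

(** * The toric presentation *)

Section LaurentIdeal.
Variables (R : realType) (d n : nat) (g : 'I_n -> 'X_{1..d}).
Local Notation K := R[i].

Definition lattice_vectors (l : 'I_n) : 'rV[int]_d := \row_j (g l j)%:Z.

Lemma laurent_monomialE l : laurent_monomial R lattice_vectors l
  = tofrac ('X_[g l] : {mpoly K[d]}).
Proof.
rewrite mpolyXE_id rmorph_prod; apply: eq_bigr => j _.
by rewrite mxE -exprnP rmorphXn.
Qed.

(** For exponents without negative components, the Laurent monomials are
    polynomials. *)
Lemma toric_idealE (p : {mpoly K[n]}) :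
  toric_ideal lattice_vectors p <-> mp_subst (fun=> 1) g p = 0.
Proof.
rewrite /toric_ideal /mkset.
have -> : mmap (fun c : K => tofrac (c%:MP : {mpoly K[d]}))
    (laurent_monomial R lattice_vectors) p = tofrac (mp_subst (fun=> 1) g p).
  rewrite /mp_subst /mmap rmorph_sum; apply: eq_bigr => k _.
  rewrite rmorphM; congr (_ * _); rewrite /mmap1 rmorph_prod.
  by apply: eq_bigr => l _; rewrite rmorphXn scale1r laurent_monomialE.
split=> [/eqP|->]; last exact: rmorph0.
by rewrite tofrac_eq0 => /eqP.
Qed.

End LaurentIdeal.

Section Toric.
Variables (R : realType) (alpha beta N : nat).
Hypotheses (alpha_gt0 : (0 < alpha)%N) (beta_gt0 : (0 < beta)%N) (N_gt0 : (0 < N)%N).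
Hypothesis beta_N_coprime : coprime beta N.
Local Notation K := R[i].
Local Notation eta := (hypersurface_normalization R alpha beta N).
Local Notation Xs := (lipschitz_saturation eta).
Local Notation gm := (sat_gen alpha beta_gt0 N_gt0).
Local Notation ph := (phi alpha beta_gt0 N_gt0).
Local Notation nrm := (nf alpha beta_gt0 N_gt0).
Local Notation Xpar := (@Xparam R alpha beta N alpha_gt0 beta_gt0 N_gt0 beta_N_coprime).
Local Notation gmZ := (lattice_vectors gm).

(** The exponent [(alpha, j)] of the generator with residue class 1 is [(0, 1)] up
    to the generators [(1, 0)] and [(0, N)]; if [N = 1], then [(0, N)] is [(0, 1)]
    itself. *)
Lemma sat_gen_generates : generates_lattice gmZ.
Proof.
pose L (w : 'rV[int]_2) := exists c : 'I_N.+1 -> int, w = \sum_l c l *: gmZ l.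
have L1 l : L (gmZ l).
  exists (fun i => (i == l)%:R); rewrite (bigD1 l) //= eqxx scale1r.
  by rewrite big1 ?addr0 // => i /negbTE ->; rewrite scale0r.
have LZ a w : L w -> L (a *: w).
  move=> [c ->]; exists (fun l => a * c l); rewrite scaler_sumr.
  by apply: eq_bigr => l _; rewrite scalerA.
have LD w w' : L w -> L w' -> L (w + w').
  move=> [c ->] [c' ->]; exists (fun l => c l + c' l); rewrite -big_split.
  by apply: eq_bigr => l _; rewrite scalerDl.
pose e a b : 'rV[int]_2 := \row_j (mnm2 a b j)%:Z.
have L10 : L (e 1%N 0%N) by have := L1 0; rewrite /gmZ /sat_gen.
have L01 : L (e 0%N 1%N).
  have [N1|N1] := eqVneq N 1%N.
    have := L1 (inord 1); rewrite /lattice_vectors /sat_gen inordK //= ?N1 //.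
  have N2 : (1 < N)%N by rewrite ltn_neqAle eq_sym N1 N_gt0.
  have [_ er _] := jminP beta_gt0 N_gt0 1; rewrite (modn_small N2) in er.
  have LN : L (e 0%N N).
    have := L1 (inord 1); rewrite /lattice_vectors /sat_gen inordK //=.
  have Lj : L (e alpha (jmin beta_gt0 N_gt0 1)).
    by have := L1 (inord 2); rewrite /lattice_vectors /sat_gen inordK.
  have -> : e 0%N 1%N = e alpha (jmin beta_gt0 N_gt0 1)
      + ((- (alpha%:Z)) *: e 1%N 0%N
      + (- ((jmin beta_gt0 N_gt0 1 %/ N)%N%:Z)) *: e 0%N N).
    rewrite {1}(divn_eq (jmin beta_gt0 N_gt0 1) N) er.
    apply/rowP => j; rewrite !mxE.
    have [->|->] : j = 0 \/ j = 1.
      by case: j => [[|[|?]] ?]; [left|right|]; rewrite //; apply: val_inj.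
    - by rewrite !mnm2_0; ring.
    - by rewrite !mnm2_1 PoszD PoszM; ring.
  by apply: (LD) => //; apply: (LD); apply: (LZ).
move=> w; have -> : w = w 0 0 *: e 1%N 0%N + w 0 1 *: e 0%N 1%N.
  apply/rowP => j; rewrite !mxE.
  have [->|->] : j = 0 \/ j = 1.
    by case: j => [[|[|?]] ?]; [left|right|]; rewrite //; apply: val_inj.
  - by rewrite !mnm2_0; ring.
  - by rewrite !mnm2_1; ring.
by apply: (LD); apply: (LZ).
Qed.

Lemma sat_gen_strongly_convex : strongly_convex_cone R gmZ.
Proof.
have pos (x : 'rV[R]_2) j : in_cone gmZ x -> 0 <= x 0 j.
  move=> [c [c0 ->]]; rewrite summxE; apply: sumr_ge0 => l _.
  by rewrite !mxE mulr_ge0 // ler0z.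
move=> x hx hNx; apply/rowP => j; rewrite mxE; apply/eqP.
rewrite eq_le (pos _ _ hx) andbT -oppr_ge0.
by have := pos _ j hNx; rewrite mxE.
Qed.

Lemma nf_double0 : nrm (ph (U_(0%R) + U_(0%R))%MM) = (U_(0%R) + U_(0%R))%MM.
Proof.
have -> : (U_(0%R) + U_(0%R))%MM = word N 2 0 0.
  by rewrite /word eqxx mulm0n !addm0 mulmS mulm1n.
by rewrite nf_word.
Qed.

(** Every convergent [F] is congruent to a series in normal forms modulo the
    finitely many binomials that rewrite products of two generators. The
    coefficient of the latter series at a normal form is the sum of the
    coefficients of [F] at all the words with the same image, that is, a
    coefficient of the image of [F]. *)
Lemma Xparam_kernel (F : cps R N.+1) :
  Xpar F = 0 <-> toric_germ_ideal gmZ F.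
Proof.
have hp p : mp_subst (fun=> 1) gm p = 0 -> Xpar (cps_of_mpoly p) = 0.
  move=> p0; apply/val_inj/val_inj.
  transitivity (fps_subst (fun=> 1) gm (fps_of_mpoly p)) => //.
  rewrite (fps_subst_mpoly (fun i => one_le1 R i) (sat_gen_neq0 alpha_gt0 beta_gt0 N_gt0)) p0.
  by apply: fpsP => m; rewrite /= mcoeff0.
split; last first.
  apply: (@ideal_gen_sub _ _ [set F | Xpar F = 0]).
    split => /=; first exact: rmorph0.
    - by move=> x y hx hy; rewrite rmorphD /= hx hy addr0.
    - by move=> x y hy; rewrite rmorphM /= hy mulr0.
  by move=> _ [p /toric_idealE p0 <-]; apply: hp.
move=> F0; pose G (rs : 'I_N.+1 * 'I_N.+1) : {mpoly K[N.+1]} :=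
  'X_[U_(rs.1) + U_(rs.2)] - 'X_[nrm (ph (U_(rs.1) + U_(rs.2))%MM)].
pose E k : {mpoly K[N.+1]} := 'X_[k] - 'X_[nrm (ph k)].
have GT rs : toric_ideal gmZ (G rs).
  apply/toric_idealE; rewrite /G rmorphB /= !mp_substX !big1 ?scale1r; last first.
  - by move=> i _; rewrite expr1n.
  - by move=> i _; rewrite expr1n.
  rewrite -/(ph _) -[X in _ - 'X_[X]]/(ph _) (nfK alpha_gt0) ?subrr //.
  exact: saturated_phi.
have [//|l|||Q hQ] := @telescope R N.+1 N.+1 _ G E (fun l => U_(l)%MM) 2 _ _ _ _ F.
- exact: mnm1_neq0.
- rewrite /E phi0; have -> : nrm 0%MM = 0%MM; last by rewrite subrr.
  have := nf_word alpha beta_gt0 N_gt0 0 0 N_gt0.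
  by rewrite /word eqxx !mulm0n !addm0 phi0.
- move=> k l; case: (nf_step alpha_gt0 beta_gt0 N_gt0 k l) => [e|[s [y [e1 e2]]]].
    (* The relation of index [(0, 0)] is zero: the product is in normal form. *)
    exists (0, 0), k; split; first by lia.
    by rewrite /G /E /= nf_double0 subrr mul0r addr0 e !mpolyXD; ring.
  exists (s, l), y; split.
    have := mdeg_nf alpha_gt0 beta_gt0 N_gt0 k; rewrite e1 mdegD mdeg1; lia.
  by rewrite /G /E e2 e1 !mpolyXD; ring.
suff -> : F = \sum_i cps_of_mpoly (G i) * Q i.
  have [J0 JD JM] : is_ideal (toric_germ_ideal gmZ : set (cps R N.+1)).
    exact: ideal_genP.
  apply: (big_ind (toric_germ_ideal gmZ)) => [||rs _]; [exact: J0|exact: JD|].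
  rewrite mulrC; apply/JM/sub_ideal_gen; exists (G rs) => //; exact: GT.
apply/val_inj/fpsP => m.
(* Large enough both for the telescoping formula at [m] and for the coefficient of
   the image of [F] at [ph m]. *)
pose b := (2 * (mdeg m).+1 + (mdeg (ph m)).+2).+1.
transitivity (fps_coef (\sum_i cps_of_mpoly (G i) * Q i : cps R N.+1) m) => //.
rewrite -(hQ b) ?ltnS ?leq_addr //.
transitivity (\sum_(k : 'X_{1..N.+1 < b}) (fps_coef F k * (bmnm k == m)%:R
   - fps_coef F k * (nrm (ph k) == m)%:R)); last first.
  by apply: eq_bigr => k _; rewrite /E mcoeffB !mcoeffX mulrBr.
rewrite sumrB (@bmultinom_sum1 _ _ _ (fun k => fps_coef F k * (k == m)%:R) m).
- rewrite eqxx mulr1; suff -> : \sum_(k : 'X_{1..N.+1 < b})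
    fps_coef F k * (nrm (ph k) == m)%:R = 0 by rewrite subr0.
  have [em|nm] := eqVneq (nrm (ph m)) m; last first.
    apply: big1 => k _; case: eqP => [e|_]; last by rewrite mulr0.
    by case/eqP: nm; rewrite -e (nfK alpha_gt0) //; apply: saturated_phi.
  have : fps_coef (lip_val (Xpar F)) (ph m) = 0 by rewrite F0.
  rewrite [LHS](@cps_subst1_coef _ _ _ _ _ _ _ b) => [e0|]; last by rewrite /b; lia.
  rewrite -[RHS]e0.
  apply: eq_bigr => k _; congr (_ * _%:R); congr nat_of_bool.
  apply/eqP/eqP => [<-|e]; last by rewrite [ph k]e.
  by rewrite (nfK alpha_gt0) //; apply: saturated_phi.
- by rewrite /b; lia.
by move=> k /negbTE ->; rewrite mulr0.
Qed.

Lemma toric_saturation : toric_singularity Xs.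
Proof.
exists 2%N, N.+1, gmZ; split; [exact: sat_gen_generates|exact: sat_gen_strongly_convex|].
exists [the {lrmorphism _ -> _} of Xpar]; split; last exact: Xparam_kernel.
by move=> x; exists (Xlift beta_gt0 N_gt0 x); apply: XliftK.
Qed.

End Toric.

(** * Dimension of the ring of convergent series in two variables *)

Section PrimeChains.

Lemma prime_expr (A : comNzRingType) (P : set A) x n :
  prime_ideal P -> P (x ^+ n) -> P x.
Proof.
move=> [_ P1 PM]; elim: n => [|n IH]; first by rewrite expr0 => /P1.
by rewrite exprS => /PM[|/IH].
Qed.

(** In an integral equation of [x] modulo [P] of least degree, the constant term
    lies in [Q], and not in [P] since otherwise [x] could be cancelled. *)
Lemma incomparability (A B : comNzRingType) (f : {rmorphism A -> B})
    (P Q : set B) (x : B) (p : {poly A}) :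
    prime_ideal P -> is_ideal Q -> P `<=` Q -> Q x -> ~ P x ->
    p \is monic -> P (map_poly f p).[x] ->
  exists a, Q (f a) /\ ~ P (f a).
Proof.
move=> [[P0 PD PM] P1 Pprime] [Q0 QD QM] PQ Qx Px.
elim/poly_ind: p => [|p c IH]; first by rewrite monicE lead_coef0 eq_sym oner_eq0.
rewrite rmorphD rmorphM /= map_polyX map_polyC hornerMXaddC => hm hp.
have [Pc|Pc] := pselect (P (f c)); last first.
  exists c; split => //.
  have -> : f c = ((map_poly f p).[x] * x + f c) + (- (map_poly f p).[x]) * x by ring.
  by apply: QD; [exact: PQ | exact: QM].
(* If the equation is reduced to its constant term, this term is 1. *)
have [p0|p0] := eqVneq p 0.
  move: hm Pc; rewrite p0 mul0r add0r monicE lead_coefC => /eqP ->.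
  by rewrite rmorph1 => /P1.
apply: IH.
  move: hm; rewrite !monicE lead_coefDl ?lead_coefMX // size_mulX // ltnS.
  by apply: leq_trans (size_polyC_leq1 _) _; rewrite size_poly_gt0.
have : P ((map_poly f p).[x] * x).
  have -> : (map_poly f p).[x] * x = ((map_poly f p).[x] * x + f c) + (-1) * f c by ring.
  by apply: PD => //; apply: PM.
by move=> /Pprime[|/Px].
Qed.

Lemma prime_ideal_preim (A B : comNzRingType) (f : {rmorphism A -> B}) (P : set B) :
  prime_ideal P -> prime_ideal [set a | P (f a)].
Proof.
move=> [[P0 PD PM] P1 Pprime]; split; last 2 first.
- by rewrite /= rmorph1.
- by move=> x y /=; rewrite rmorphM => /Pprime.
split => /=; first by rewrite rmorph0.
- by move=> x y hx hy; rewrite rmorphD; apply: PD.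
- by move=> a x hx; rewrite rmorphM; apply: PM.
Qed.

(** Strict inclusions of primes stay strict after contraction to a subring over
    which the ring is integral. *)
Lemma prime_chain_integral (A B : comNzRingType) (f : {rmorphism A -> B}) k :
  (forall b, integralOver f b) -> prime_chain B k -> prime_chain A k.
Proof.
move=> int_f [P [hP hlt]]; exists (fun i => [set a | P i (f a)]); split.
  by move=> i /hP; apply: prime_ideal_preim.
move=> i ik; have [le /nonsubset[x [Qx Px]]] := hlt i ik; split.
  by move=> a; apply: le.
have [p mp /rootP rp] := int_f x.
have hPi := hP i (ltnW ik); have [[P0 _ _] _ _] := hPi.
have [QI _ _] := hP i.+1 ik.
have hr : P i (map_poly f p).[x] by rewrite rp.
have [a [Qa Pa]] := incomparability hPi QI le Qx Px mp hr.
by move=> hsub; apply: Pa; apply: (hsub a Qa).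
Qed.

End PrimeChains.

Section WeierstrassDivision.
Variable R : realType.
Local Notation K := R[i].

(** Division by the monomial of exponent [(a, b)], discarding the terms that it does
    not divide. *)
Definition fps_shift (a b : nat) (f : fps K 2) : fps K 2 :=
  FPS (fun m => fps_coef f (m + mnm2 a b)%MM).

Lemma mdeg_mnm2 a b : mdeg (mnm2 a b) = (a + b)%N.
Proof. by rewrite mdegD !mdegMn !mdeg1 !mul1n. Qed.

Lemma fps_shift_convergent a b f : f \in convergent -> fps_shift a b f \in convergent.
Proof.
move=> /convergentP[c /(growth_leq (leqnSn c)) hc]; apply/convergentP.
exists (c.+1 ^ (a + b).+1)%N => m; apply: le_trans (hc _) _.
by rewrite ler_nat -expnM leq_pexp2l // mdegD mdeg_mnm2 mulSn mulnS; lia.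
Qed.

Definition cps_shift a b (f : cps R 2) : cps R 2 :=
  CPS (fps_shift_convergent a b (valP f)).

Section FixedPoint.
Variables (n : nat) (h s : fps K 2).
Hypothesis s_supp : forall m, fps_coef s m != 0 -> (0 < m 0%R)%N.

Let step (G : fps K 2) := h + s * fps_shift 0 n G.
Let iterate j := iter j step 0.

Let step_local (G G' : fps K 2) j :
    (forall m : 'X_{1..2}, (m 0%R < j)%N -> fps_coef G m = fps_coef G' m) ->
  forall m : 'X_{1..2}, (m 0%R < j.+1)%N -> fps_coef (step G) m = fps_coef (step G') m.
Proof.
move=> GG m mj; rewrite /step !fps_coefD; congr (_ + _).
apply: eq_bigr => -[k1 k2] /= /eqP e; have [->|/s_supp h1] := eqVneq (fps_coef s k1) 0.
  by rewrite !mul0r.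
rewrite GG //; have := congr1 (fun m : 'X_{1..2} => m 0%R) e.
by rewrite (mnmDE _ k1) (mnmDE _ k2) mnm2_0; lia.
Qed.

Let iterate_stable j (m : 'X_{1..2}) : (m 0%R < j)%N ->
  fps_coef (iterate j.+1) m = fps_coef (iterate j) m.
Proof. by elim: j m => // j IH m; apply: step_local. Qed.

Let iterate_stable2 j i (m : 'X_{1..2}) : (m 0%R < j)%N ->
  fps_coef (iterate (j + i)) m = fps_coef (iterate j) m.
Proof.
move=> mj; elim: i => [|i IH]; first by rewrite addn0.
by rewrite addnS iterate_stable ?IH // (leq_trans mj) // leq_addr.
Qed.

(** The solution [G] of [G = h + s T G], where [T] discards the terms of degree less
    than [n] in [v] and divides by [v^n]. As [u] divides [s], each iteration
    determines the coefficients of one more power of [u]. *)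
Definition fps_fix : fps K 2 := FPS (fun m => fps_coef (iterate (m 0%R).+1) m).

Lemma fps_fixP : fps_fix = h + s * fps_shift 0 n fps_fix.
Proof.
apply: fpsP => m; rewrite [LHS]/=.
apply: (@step_local _ _ (m 0%R)) => // k km /=.
by rewrite -(subnKC km) iterate_stable2.
Qed.

(** The shift costs a factor [Y^n], which a growth rate [X] in [u] much larger than
    the growth rate [Y] in [v] absorbs, since every term of [s] has a factor
    [u]. *)
Lemma fps_fix_convergent : h \in convergent -> s \in convergent ->
  fps_fix \in convergent.
Proof.
move=> /convergentP[b1 hb1] /convergentP[b2 hb2].
pose b := (b1 + b2).+1.
have hb : growth h b by apply: growth_leq hb1; rewrite /b; lia.
have sb : growth s b by apply: growth_leq hb2; rewrite /b; lia.
(* The factors 2 in [X] and [Y] provide the weights of [fps_coefM_norm]. The factor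
   [c] of [X] is gained once because [u] divides [s], and it makes the convolution
   at most half of the required bound: here 8 is twice the sum [2 ^ 2] of the
   weights. *)
pose Y := (2 * b)%N; pose c := (8 * b * Y ^ n)%N; pose X := (2 * b * c)%N.
have b0 : (0 < b)%N by [].
have Y0 : (0 < Y)%N by rewrite muln_gt0.
have c0 : (0 < c)%N by rewrite !muln_gt0 expn_gt0 Y0.
have X0 : (0 < X)%N by rewrite muln_gt0 c0 andbT muln_gt0.
suff hG m : `|fps_coef fps_fix m| <= (2 * b * (X ^ m 0%R * Y ^ m 1%R))%:R.
  apply/convergentP; exists (2 * b * (X * Y))%N => m; apply: le_trans (hG m) _.
  rewrite ler_nat; apply: (@leq_trans (2 * b * (X * Y) ^ mdeg m)%N).
    rewrite leq_mul2l expnMn leq_mul ?orbT // leq_pexp2l //.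
      by rewrite (mnm2E m) mnm2_0 mdeg_mnm2 leq_addr.
    by rewrite (mnm2E m) mnm2_1 mdeg_mnm2 leq_addl.
  have XY0 : (0 < X * Y)%N by rewrite muln_gt0 X0.
  rewrite expnS; apply: leq_mul; first exact: leq_pmulr.
  by case: (mdeg m) => // q; rewrite leq_exp2r // leq_pmull.
have [j] := ubnP (m 0%R); elim: j m => // j IH m; rewrite ltnS => mj.
rewrite fps_fixP fps_coefD; apply: (le_trans (ler_normD _ _)).
have -> : (2 * b * (X ^ m 0%R * Y ^ m 1%R) = b * (X ^ m 0%R * Y ^ m 1%R)
  + b * (X ^ m 0%R * Y ^ m 1%R))%N by ring.
rewrite natrD; apply: lerD.
  apply: le_trans (hb m) _; rewrite ler_nat expnS leq_mul2l; apply/orP; right.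
  rewrite {1}(mnm2E m) mdeg_mnm2 expnD leq_mul //.
    case: (m 0%R) => // k; rewrite leq_exp2r // /X; nia.
  by case: (m 1%R) => // k; rewrite leq_exp2r // /Y; lia.
pose B : K := (b * (X ^ m 0%R * Y ^ m 1%R))%:R / 4%:R.
have -> : (b * (X ^ m 0%R * Y ^ m 1%R))%:R = B * 2 ^+ 2 :> K.
  by rewrite /B -natrX divfK // pnatr_eq0.
apply: fps_coefM_norm; first by rewrite divr_ge0.
move=> k l e; have [->|/s_supp k0] := eqVneq (fps_coef s k) 0.
  by rewrite normr0 mul0r !mulr_ge0 ?invr_ge0 ?exprn_ge0 ?invr_ge0.
have e0 : m 0%R = (k 0%R + l 0%R)%N by rewrite e mnmDE.
have e1 : m 1%R = (k 1%R + l 1%R)%N by rewrite e mnmDE.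
apply: le_trans (ler_pM _ _ (sb k) (IH (l + mnm2 0 n)%MM _)) _ => //.
  by rewrite mnmDE mnm2_0; move: mj e0 k0; lia.
rewrite /B exprVn -mulrA -invfM ler_pdivlMr ?mulr_gt0 ?exprn_gt0 ?ltr0n //.
rewrite -natrX -!natrM ler_nat !(mnmDE _ l) mnm2_0 mnm2_1 addn0 e0 e1.
have -> : mdeg k = (k 0%R + k 1%R)%N by rewrite {1}(mnm2E k) mdeg_mnm2.
move: (k 0%R) (k 1%R) (l 0%R) (l 1%R) k0 => i p q r i0.
apply: (@leq_trans (b * (X ^ q * Y ^ r) * ((2 * b) ^ i * Y ^ p) * c)%N).
  apply/eq_leq; rewrite /c; move: (X) => X'; rewrite /Y !expnMn expnS !expnD.
  by ring.
have -> : (b * (X ^ (i + q) * Y ^ (p + r))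
    = b * (X ^ q * Y ^ r) * ((2 * b) ^ i * Y ^ p) * c ^ i)%N.
  by rewrite !expnD {1}/X (expnMn (2 * b)); ring.
rewrite leq_mul2l; apply/orP; right; exact: (@leq_pexp2l c 1).
Qed.

End FixedPoint.

Local Notation u := (cpsX R (mnm2 1 0)).
Local Notation v := (cpsX R (mnm2 0 1)).

Lemma mnm2_le a b (m : 'X_{1..2}) :
  (mnm2 a b <= m)%MM = ((a <= m 0%R) && (b <= m 1%R))%N.
Proof.
apply/mnm_lepP/andP => [h|[h0 h1] i].
  by have := h 0; have := h 1; rewrite mnm2_0 mnm2_1.
have [->|->] : i = 0 \/ i = 1.
  by case: i => [[|[|?]] ?]; [left|right|]; rewrite //; apply: val_inj.
  by rewrite mnm2_0.
by rewrite mnm2_1.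
Qed.

Lemma monomial_mul_coef a b (f : cps R 2) m : fps_coef (cpsX R (mnm2 a b) * f) m
  = if ((a <= m 0%R) && (b <= m 1%R))%N
    then fps_coef f (mnm2 (m 0%R - a) (m 1%R - b)) else 0.
Proof.
rewrite cpsX_mul_coef mnm2_le; case: ifP => // _; congr (fps_coef _ _).
by apply: (@mnm2P 0 1) => //; rewrite mnmBE ?mnm2_0 ?mnm2_1.
Qed.

Lemma cpsX_v n : cpsX R (mnm2 0 n) = v ^+ n.
Proof.
by rewrite -cpsXn; congr cpsX; apply: (@mnm2P 0 1) => //;
  rewrite mulmnE ?mnm2_0 ?mnm2_1 ?mul1n.
Qed.

Lemma cpsX_u n : cpsX R (mnm2 n 0) = u ^+ n.
Proof.
by rewrite -cpsXn; congr cpsX; apply: (@mnm2P 0 1) => //;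
  rewrite mulmnE ?mnm2_0 ?mnm2_1 ?mul1n.
Qed.

(** If [n] is the order in [v] of [f(0, v)], the terms of [f] without [u] are [v^n]
    times a unit. *)
Lemma weierstrass_form (f : cps R 2) : (exists b, fps_coef f (mnm2 0 b) != 0) ->
  exists (n : nat) (e s : cps R 2), e * f = v ^+ n + u * s.
Proof.
move=> exb; have [n fn nmin] := ex_minnP exb.
pose e0 : fps K 2 := FPS (fun m =>
  if m 0 == 0%N then fps_coef (cps_shift 0 n f) m else 0).
have ce : e0 \in convergent.
  have /convergentP[b hb] := valP (cps_shift 0 n f); apply/convergentP; exists b => m.
  by rewrite /=; case: ifP => _; [exact: hb | rewrite normr0].
have fE : f = cpsX R (mnm2 0 n) * CPS ce + u * cps_shift 1 0 f.
  apply/val_inj/fpsP => m; rewrite [RHS]fps_coefD !monomial_mul_coef.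
  rewrite /= !mnm2_0 !mnm2D !subn0 !addn0 andbT.
  case: (posnP (m 0%R)) => [m0|m0] /=.
    rewrite m0 addr0; case: ifP => nm.
      by rewrite subnK // {1}(mnm2E m) m0.
    apply/eqP; apply: contraFT nm => h; apply: nmin.
    by move: h; rewrite {1}(mnm2E m) m0.
  by rewrite if_same add0r subnK // -mnm2E.
have ne0 : fps_coef (CPS ce) 0%MM != 0 by rewrite /= mnm0E eqxx add0m.
have [//|//|//|e [ee _]] := @cps_inverse R 2 (CPS ce) (fun=> True) _ _ _ ne0.
exists n, e, (e * cps_shift 1 0 f).
by rewrite {1}fE cpsX_v mulrDr [e * (_ * CPS _)]mulrCA [e * CPS _]mulrC ee mulr1 mulrCA.
Qed.

Definition to_u (_ : 'I_1) : 'I_2 := 0.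
Lemma to_u_inj : injective to_u.
Proof. by move=> i j _; rewrite !ord1. Qed.
Definition cps_in_u := @cps_rename R 1 2 to_u to_u_inj.
HB.instance Definition _ := GRing.LRMorphism.on cps_in_u.

Lemma cps_in_u_coef (r : cps R 1) m : fps_coef (cps_in_u r) m
  = if m 1 == 0%N then fps_coef r [multinom m 0%R | _ < 1] else 0.
Proof.
rewrite /=; have -> : mnm_supported to_u m = (m 1 == 0%N).
  apply/forallP/eqP => [h|h j].
    apply/eqP; have := h 1; rewrite implyNb => /orP[//|h1].
    by have [i /(congr1 val)] := codomP h1.
  apply/implyP => mj; apply/codomP; exists 0; rewrite /to_u.
  by case: j mj => [[|[|?]] ?] mj; apply: val_inj => //; move: mj;
    rewrite (_ : Ordinal _ = 1) ?h //; apply: val_inj.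
by case: ifP => // _; congr (fps_coef _ _); apply/mnmP => i; rewrite !mnmE.
Qed.

(** Let [G] solve [G = h - u s T G], with [T] the division by [v^n] discarding lower
    terms. Then [h = G + u s T G], and [G] is [v^n T G] plus its terms of degree
    less than [n] in [v]; thus [T G] is the quotient. *)
Lemma weierstrass_division (n : nat) (s h : cps R 2) :
  exists (r : 'I_n -> cps R 1) (q : cps R 2),
    h = \sum_(i < n) v ^+ i * cps_in_u (r i) + (v ^+ n + u * s) * q.
Proof.
have s_supp m : fps_coef (- cps_val (u * s)) m != 0 -> (0 < m 0%R)%N.
  rewrite fps_coefN oppr_eq0 monomial_mul_coef.
  by case: ifP => [/andP[]//|_]; rewrite eqxx.
have cs : - cps_val (u * s) \in convergent by exact: (valP (- (u * s))).
pose G : cps R 2 := CPS (fps_fix_convergent n s_supp (valP h) cs).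
have GE : h = G + u * s * cps_shift 0 n G.
  apply: val_inj; rewrite [LHS]/= [RHS]/= {1}(fps_fixP n (cps_val h) s_supp).
  by rewrite mulNr subrK.
clearbody G; pose r0 (i : nat) : fps K 1 := FPS (fun k => fps_coef G (mnm2 (k 0) i)).
have cr i : r0 i \in convergent.
  have /convergentP[b /(growth_leq (leqnSn b)) hb] := valP G; apply/convergentP.
  exists (b.+1 ^ i.+1)%N => k; apply: le_trans (hb _) _.
  have -> : mdeg k = k 0 by rewrite mdegE big_ord1.
  rewrite ler_nat -expnM leq_pexp2l // mdeg_mnm2.
  by rewrite mulSn mulnS; lia.
exists (fun i => CPS (cr i)), (cps_shift 0 n G).
rewrite {1}GE mulrDl addrA; congr (_ + _).
apply/val_inj/fpsP => m; rewrite [RHS]fps_coefD -cpsX_v monomial_mul_coef.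
rewrite cps_coef_sum; under eq_bigr => i _ do
  rewrite -cpsX_v monomial_mul_coef cps_in_u_coef mnm2_0 mnm2_1 subn0 /= subn_eq0.
rewrite /= !subn0 mnm2D addn0; case: leqP => nm.
  rewrite subnK // -mnm2E big1 ?add0r // => i _.
  by rewrite [(m 1%R <= i)%N]leqNgt (leq_trans (ltn_ord i) nm) /= if_same.
rewrite addr0 (bigD1 (Ordinal nm)) //= leqnn mnmE -mnm2E big1 ?addr0 // => i im.
case: ifP => // im1; case: ifP => // im2; case/eqP: im; apply: val_inj.
by apply/eqP; rewrite eqn_leq im1 im2.
Qed.

Lemma u_adic_factor (f : cps R 2) : f != 0 -> exists a b (g : cps R 2),
  [/\ f = u ^+ a * g, fps_coef f (mnm2 a b) != 0 & fps_coef g (mnm2 0 b) != 0].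
Proof.
move=> f0; have f0' : cps_val f != 0.
  by apply: contraNneq f0 => h; apply/eqP/val_inj.
have [p [pf hp]] := leading_exists 0 1 f0'.
have gf : fps_coef f (mnm2 (p 0) (p 1)) != 0 by rewrite -mnm2E.
exists (p 0), (p 1), (cps_shift (p 0) 0 f); split => //.
  apply/val_inj/fpsP => m; rewrite -cpsX_u monomial_mul_coef /= !subn0 andbT.
  rewrite mnm2D addn0; case: ifP => pm; first by rewrite subnK // -mnm2E.
  apply/eqP; apply: contraFT pm => /hp; rewrite /lex2.
  by case/orP => [/ltnW|/andP[/eqP-> _]].
by rewrite /= mnm2D add0n addn0.
Qed.

Lemma prime_const0 (P : set (cps R 2)) x : prime_ideal P -> P x ->
  fps_coef x 0%MM = 0.
Proof.
move=> [[_ _ PM] P1 _] Px; apply: contrapT => /eqP x0.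
have [//|//|//|y [xy _]] := @cps_inverse R 2 x (fun=> True) _ _ _ x0.
by apply: P1; rewrite -xy mulrC; apply: PM.
Qed.

(** Any proper ideal lies in the ideal of series without constant term, which [u]
    and [v] generate. *)
Lemma maximal_uv (P Q : set (cps R 2)) : prime_ideal P -> prime_ideal Q ->
  P u -> P v -> ~ P `<` Q.
Proof.
move=> [[P0 PD PM] _ _] hQ Pu Pv [_]; apply=> x Qx.
have [q [-> _]] := cps_split (prime_const0 hQ Qx).
have vE l : P (cps_var R l).
  have -> : cps_var R l = cpsX R U_(l)%MM by [].
  have [->|->] : l = 0 \/ l = 1.
    by case: l => [[|[|?]] ?]; [left|right|]; rewrite //; apply: val_inj.
  - have -> : (U_(0%R) = mnm2 1 0)%MM by rewrite /mnm2 mulm1n mulm0n addm0.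
    exact: Pu.
  have -> : (U_(1%R) = mnm2 0 1)%MM by rewrite /mnm2 mulm1n mulm0n add0m.
  exact: Pv.
elim/big_ind: _ => [||l _]; [exact: P0|exact: PD|].
by rewrite mulrC; apply: PM.
Qed.

Lemma prime_v (P : set (cps R 2)) n s : prime_ideal P ->
  P u -> P (v ^+ n + u * s) -> P v.
Proof.
move=> hP Pu Pw; have [[P0 PD PM] _ _] := hP; apply: (prime_expr (n := n) hP).
have -> : v ^+ n = (v ^+ n + u * s) + (- s) * u by ring.
by apply: PD => //; apply: PM.
Qed.

(** Let [P0 < P1 < P2 < P3] be primes. It suffices that [u] and [v] are in [P2], as
    they generate the maximal ideal. If [u] is in [P1], any element of [P2] not in
    [P1] has a Weierstrass form [v^n + u s], so that [v] is in [P2]. If not, [P1]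
    contains a Weierstrass form [w = v^n + u s], obtained from a non-zero element by
    removing powers of [u]. By division, the ring modulo [w] is finite over the
    series in [u], and incomparability gives a series in [u] lying in [P2] and not
    in [P1]; being a power of [u] times a unit, it shows that [u], and hence [v], is
    in [P2]. *)
Lemma krull_dim_cps2_le : ~ prime_chain (cps R 2) 3.
Proof.
move=> [P [hP hlt]].
have [[hP1 hP2] hP3] := (hP 1%N isT, hP 2%N isT, hP 3%N isT).
have [_ /nonsubset[f [P1f P0f]]] := hlt 0%N isT.
have [le12 /nonsubset[g [P2g P1g]]] := hlt 1%N isT.
have [[P10 P1D P1M] P11 P1prime] := hP1; have [[P20 P2D P2M] P21 P2prime] := hP2.
suff [P2u P2v] : P 2%N u /\ P 2%N v by apply: (maximal_uv hP2 hP3 P2u P2v (hlt 2%N isT)).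
have [P1u|P1u] := pselect (P 1%N u).
  have P2u : P 2%N u by apply: le12.
  split => //; have [exb|hb] := pselect (exists b, fps_coef g (mnm2 0 b) != 0).
    have [n [e [s es]]] := weierstrass_form exb.
    by apply: (@prime_v _ n s hP2 P2u); rewrite -es; apply: P2M.
  case: P1g; have -> : g = cps_shift 1 0 g * u; last exact: P1M.
  apply/val_inj/fpsP => m; rewrite mulrC monomial_mul_coef /= subn0 andbT mnm2D addn0.
  case: (posnP (m 0%R)) => [m0|m0]; last by rewrite subnK // -mnm2E.
  apply/eqP; apply: contrapT => /negP h; apply: hb; exists (m 1%R).
  by move: h; rewrite {1}(mnm2E m) m0.
have f0 : f != 0.
  by apply: contra_notN P0f => /eqP ->; have [[]] := hP 0%N isT.
have [a [b [f' [fE _ f'b]]]] := u_adic_factor f0.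
have P1f' : P 1%N f'.
  by move: P1f; rewrite fE => /P1prime[|//] /(prime_expr hP1)/P1u.
have [n [e [s es]]] := weierstrass_form (ex_intro _ b f'b).
have P1w : P 1%N (v ^+ n + u * s) by rewrite -es; apply: P1M.
have n0 : (0 < n)%N.
  rewrite lt0n; apply/eqP => n0; have := prime_const0 hP1 P1w.
  rewrite n0 expr0 fps_coefD monomial_mul_coef mnm0E /= eqxx addr0.
  by move/eqP; rewrite oner_eq0.
have /choice[r hr] (i : 'I_n) : exists r : 'I_n -> cps R 1, exists q : cps R 2,
    g * v ^+ i = \sum_(j < n) v ^+ j * cps_in_u (r j) + (v ^+ n + u * s) * q.
  exact: weierstrass_division.
(* The matrix of multiplication by [g] modulo [v^n + u s]. *)
pose M : 'M[cps R 1]_n := \matrix_(i, j) r i j.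
have [C /(_ (Ordinal n0))] := char_poly_adj (map_mx cps_in_u M) g
  (fun i : 'I_n => v ^+ i).
rewrite -map_char_poly expr0 mulr1 => hC.
have P1chi : P 1%N (map_poly cps_in_u (char_poly M)).[g].
  rewrite hC; elim/big_ind: _ => [||i _]; [exact: P10|exact: P1D|apply: (P1M)].
  have [q ->] := hr i.
  have -> : \sum_(k < n) (map_mx cps_in_u M) i k * v ^+ k
      = \sum_(j < n) v ^+ j * cps_in_u (r i j).
    by apply: eq_bigr => k _; rewrite !mxE mulrC.
  by rewrite addrC addKr mulrC; apply: P1M.
have [c [P2c P1c]] := incomparability hP1 (And3 P20 P2D P2M) le12 P2g P1g (char_poly_monic M) P1chi.
have {}P1c : ~ P 1%N (cps_in_u c) := P1c.
have {}P2c : P 2%N (cps_in_u c) := P2c.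
have c0 : cps_in_u c != 0 by apply: contra_notN P1c => /eqP ->.
have [a' [b' [c' [cE ca cb]]]] := u_adic_factor c0.
have b'0 : b' = 0%N.
  move: ca; rewrite cps_in_u_coef mnm2_1; case: (b' =P 0%N) => // _.
  by rewrite eqxx.
have P2u : P 2%N u.
  move: P2c; rewrite cE => /P2prime[/(prime_expr hP2)//|/(prime_const0 hP2) c'0].
  move: cb; rewrite b'0; have -> : mnm2 0 0 = 0%MM by rewrite /mnm2 !mulm0n addm0.
  by rewrite c'0 eqxx.
split => //; apply: (@prime_v _ n s hP2 P2u); exact: le12.
Qed.

End WeierstrassDivision.

(** * Dimension and multiplicity of the saturation *)

Section KrullDimension.
Variables (R : realType) (alpha beta N : nat).
Hypotheses (alpha_gt0 : (0 < alpha)%N) (beta_gt0 : (0 < beta)%N) (N_gt0 : (0 < N)%N).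
Hypothesis beta_N_coprime : coprime beta N.
Local Notation K := R[i].
Local Notation eta := (hypersurface_normalization R alpha beta N).
Local Notation Xs := (lipschitz_saturation eta).
Local Notation gm := (sat_gen alpha beta_gt0 N_gt0).
Local Notation ph := (phi alpha beta_gt0 N_gt0).
Local Notation sat := (saturated alpha beta N).
Local Notation Xpar := (@Xparam R alpha beta N alpha_gt0 beta_gt0 N_gt0 beta_N_coprime).
Local Notation am := (amin alpha).
Local Notation jm := (jmin beta_gt0 N_gt0).

(** The exponents of [u] and [v^N], the system of parameters over which the
    saturation is integral. *)
Definition base_mnm (l : 'I_2) : 'X_{1..2} := if l == 0 then mnm2 1 0 else mnm2 0 N.

Fact base_mnm_neq0 l : base_mnm l != 0%MM.
Proof. by rewrite /base_mnm -mdeg_eq0; case: ifP => _; rewrite mdeg_mnm2 -lt0n. Qed.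

Lemma base_mnmE k : mnm_subst base_mnm k = mnm2 (k 0) (k 1%R * N).
Proof.
rewrite /mnm_subst big_ord_recl big_ord1 /base_mnm /=.
rewrite !mnm2Mn mnm2D !mul0n mul1n addn0 add0n mulnC.
by congr (mnm2 (k _) (k _ * N)); apply: val_inj.
Qed.

Definition base_subst : cps R 2 -> cps R 2 :=
  cps_subst (fun i => one_le1 R i) base_mnm_neq0.
HB.instance Definition _ := GRing.LRMorphism.on base_subst.

Lemma base_subst_coef f m : fps_coef (base_subst f) m
  = if (N %| m 1%R)%N then fps_coef f (mnm2 (m 0%R) (m 1%R %/ N)) else 0.
Proof.
rewrite [LHS](@cps_subst1_coef _ _ _ _ _ _ _ (mdeg m).+2) //.
case: ifP => Nm; last first.
  rewrite big1 // => k _; case: eqP => [e|_]; last by rewrite mulr0.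
  by have := congr1 (fun l : 'X_{1..2} => N %| l 1%R)%N e; rewrite Nm base_mnmE mnm2_1 dvdn_mull.
pose F k := fps_coef f k * (mnm_subst base_mnm k == m)%:R.
rewrite (@bmultinom_sum1 _ _ _ F (mnm2 (m 0%R) (m 1%R %/ N))) /F.
- by rewrite base_mnmE mnm2_0 mnm2_1 divnK // -mnm2E eqxx mulr1.
- have -> : mdeg m = (m 0%R + m 1%R)%N by rewrite {1}(mnm2E m) mdeg_mnm2.
  rewrite mdeg_mnm2 ltnS leqW // leq_add2l.
  exact: leq_div.
move=> k; case: (mnm_subst base_mnm k =P m) => [<-|_]; last by rewrite mulr0.
by rewrite base_mnmE mnm2_0 mnm2_1 mulnK // -mnm2E eqxx.
Qed.

Lemma base_subst_lip f : base_subst f \in lip_pred eta.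
Proof.
apply/lip_predE => // m; rewrite base_subst_coef /saturated.
by case: ifP => // _; rewrite eqxx.
Qed.

Definition Xbase (f : cps R 2) : Xs := Lip (base_subst_lip f).

Fact Xbase_is_zmod : zmod_morphism Xbase.
Proof.
move=> F G; apply: val_inj; suff : base_subst (F - G) = base_subst F - base_subst G by [].
exact: rmorphB.
Qed.
Fact Xbase_is_monoid : monoid_morphism Xbase.
Proof.
split.
  by apply: val_inj; suff : base_subst 1 = 1 by []; exact: rmorph1.
move=> F G; apply: val_inj; suff : base_subst (F * G) = base_subst F * base_subst G by [].
exact: rmorphM.
Qed.
HB.instance Definition _ := GRing.isZmodMorphism.Build _ _ Xbase Xbase_is_zmod.
HB.instance Definition _ :=
  GRing.isMonoidMorphism.Build _ _ Xbase Xbase_is_monoid.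

(** The [N]-th power of the monomial is a monomial in [u] and [v^N]. *)
Lemma Xbase_integral_monomial r : (r < N)%N ->
  integralOver Xbase (Xpar (cpsX R (word N 0 0 r))).
Proof.
move=> rN; pose c : cps R 2 := cpsX R (mnm2 (am r * N) (jm r)).
exists ('X^N - c%:P); first exact: monicXnsubC.
rewrite /root rmorphB /= map_polyXn map_polyC hornerD hornerN hornerXn hornerC.
rewrite subr_eq0; apply/eqP/val_inj; rewrite -rmorphXn -cpsXn.
rewrite [LHS]XparamX phiMn phi_word // !mul0n !add0n mnm2Mn.
by rewrite /= /base_subst cps_substX big1 ?scale1r ?base_mnmE ?mnm2_0 ?mnm2_1 // => i _;
  rewrite expr1n.
Qed.

(** The exponents are grouped by the residue class modulo [N] of the exponent of
    [v]. *)
Lemma Xbase_decomposition (x : Xs) : exists h : 'I_N -> cps R 2,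
  x = \sum_r Xbase (h r) * Xpar (cpsX R (word N 0 0 r)).
Proof.
pose h0 (r : 'I_N) : fps K 2 := FPS (fun k =>
  Xcoef x (mnm2 (k 0%R + am r) (k 1%R * N + jm r))).
have ch r : h0 r \in convergent.
  have /convergentP[b /(growth_leq (leqnSn b)) hb] := valP (lip_val x).
  apply/convergentP; exists (b.+1 ^ (N + am r + jm r).+1)%N => k.
  apply: le_trans (hb _) _; rewrite ler_nat -expnM leq_pexp2l // mdeg_mnm2.
  rewrite [in X in (_ <= X)%N](mnm2E k) mdeg_mnm2; nia.
exists (fun r => CPS (ch r)); apply: XcoefP => m; rewrite Xcoef_sum.
have E (r : 'I_N) : Xcoef (Xbase (CPS (ch r)) * Xpar (cpsX R (word N 0 0 r))) m
    = if [&& am r <= m 0%R, jm r <= m 1%R & r == (m 1%R %% N)%N :> nat]%N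
      then Xcoef x m else 0.
  rewrite /Xcoef mulrC.
  have -> : lip_val (Xpar (cpsX R (word N 0 0 r)) * Xbase (CPS (ch r)))
    = cpsX R (mnm2 (am r) (jm r)) * base_subst (CPS (ch r)).
    by congr (_ * _); rewrite [LHS]XparamX phi_word.
  rewrite monomial_mul_coef base_subst_coef !mnm2_0 !mnm2_1.
  case: (leqP (am r) _) => //= h1; case: (leqP (jm r) _) => //= h2.
  have [_ er _] := jminP beta_gt0 N_gt0 r.
  rewrite -eqn_mod_dvd // er (modn_small (ltn_ord r)) eq_sym; case: ifP => // rm.
  rewrite /= !mnm2_0 !mnm2_1 subnK // divnK ?subnK -?mnm2E //.
  by rewrite -eqn_mod_dvd // er (modn_small (ltn_ord r)) eq_sym.
rewrite (eq_bigr _ (fun r _ => E r)).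
have rN : (m 1%R %% N < N)%N by rewrite ltn_mod.
rewrite (bigD1 (Ordinal rN)) //= eqxx andbT -saturatedE // big1 ?addr0.
  case: ifPn => // ms; apply/eqP; apply: contraNT ms; exact: Xcoef_sat.
by move=> r rm; rewrite -val_eqE /= in rm; rewrite (negbTE rm) !andbF.
Qed.

Lemma Xbase_integral (x : Xs) : integralOver Xbase x.
Proof.
have [h ->] := Xbase_decomposition x.
elim/big_ind: _ => [|y z hy hz|r _].
- exact: (integral0 [the {rmorphism _ -> _} of Xbase]).
- exact: (integral_add (RtoK := [the {rmorphism _ -> _} of Xbase])).
apply: (integral_mul (RtoK := [the {rmorphism _ -> _} of Xbase])).
  exact: (integral_id [the {rmorphism _ -> _} of Xbase]).
exact: Xbase_integral_monomial.
Qed.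

Lemma Xcoef_leading0 (x : Xs) (m : 'X_{1..2}) : m 0%R = 0%N -> Xcoef x m != 0 ->
  exists2 p, leading 0 1 (cps_val (lip_val x)) p & p 0%R = 0%N.
Proof.
move=> m0 hm; have x0 : cps_val (lip_val x) != 0 by apply: contraNneq hm; rewrite /Xcoef => ->.
have [p hp] := leading_exists 0 1 x0; exists p => //.
by have := hp.2 m hm; rewrite /lex2 m0; lia.
Qed.

(** The zero ideal, the series vanishing on the line [u = 0], and the maximal
    ideal. *)
Lemma saturation_chain : prime_chain Xs 2.
Proof.
have nuE (x : Xs) := nonunitsE alpha_gt0 beta_gt0 N_gt0 beta_N_coprime x.
pose Pu : set Xs := [set x | forall m : 'X_{1..2}, m 0%R = 0%N -> Xcoef x m = 0].
exists (fun i => if i is i'.+1 then if i' is 0%N then Pu else @nonunits Xs else [set 0]).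
have gmX l (m : 'X_{1..2}) : Xcoef (Xpar (cpsX R U_(l)%MM)) m = (gm l == m)%:R.
  by rewrite XparamX_coef phi1.
split.
  case=> [|[|[|//]]] _.
  - split; first split.
    + by [].
    + by move=> x y /= -> ->; rewrite addr0.
    + by move=> a x /= ->; rewrite mulr0.
    + by move=> /eqP; rewrite oner_eq0.
    move=> x y /= xy.
    have xy0 : cps_val (lip_val x) * cps_val (lip_val y) = 0.
      exact: (congr1 (fun z : Xs => cps_val (lip_val z)) xy).
    have [h|h] := fps2_mul_eq0 xy0; [left|right]; apply: XcoefP => m.
      by rewrite /Xcoef h.
    by rewrite /Xcoef h.
  - split; first split.
    + by move=> m _; exact: Xcoef0.
    + by move=> x y hx hy m m0; rewrite XcoefD hx ?hy ?addr0.
    + move=> a x hx m m0; apply/eqP; apply: contrapT => /negP /XcoefM_supp[k [l [e _]]].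
      by rewrite hx ?eqxx //; move: m0; rewrite e mnmDE; lia.
    + move=> /(_ 0%MM); rewrite mnm0E Xcoef1 eqxx => /(_ erefl) /eqP.
      by rewrite oner_eq0.
    move=> x y xy; apply: contrapT => /not_orP[].
    move=> /existsNP[m /not_implyP[m0 /eqP hm]] /existsNP[k /not_implyP[k0 /eqP hk]].
    have [p hp p0] := Xcoef_leading0 m0 hm; have [q hq q0] := Xcoef_leading0 k0 hk.
    have [] := leadingM (isT : (0 : 'I_2) != 1) hp hq.
    have := xy (p + q)%MM; rewrite mnmDE p0 q0 => /(_ erefl); rewrite /Xcoef => h.
    by rewrite [fps_coef _ _]h eqxx.
  - split; first split.
    + by apply/nuE.
    + by move=> x y /nuE hx /nuE hy; apply/nuE; rewrite XcoefD hx hy addr0.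
    + move=> a x /nuE hx; apply/nuE; apply/eqP; apply: contrapT => /negP.
      move=> /XcoefM_supp[k [l [e _]]]; have /andP[_ /eqP->] : (k == 0%MM) && (l == 0%MM).
        by rewrite -mnmD_eq0 -e.
      by rewrite hx eqxx.
    + by move=> /nuE /eqP; rewrite Xcoef1 eqxx oner_eq0.
    move=> x y /nuE xy; have : Xcoef x 0%MM * Xcoef y 0%MM = 0.
      have := @fps_coefM1 _ _ (cps_val (lip_val x)) (cps_val (lip_val y)) 0%MM 0%MM.
      rewrite addm0 => <- //= k l /eqP; rewrite mnmD_eq0.
      by move=> /andP[/eqP-> /eqP->].
    by move/eqP; rewrite mulf_eq0 => /orP[] /eqP h; [left|right]; apply/nuE.
case=> [|[|//]] _; split.
- by move=> x -> m _.
- move=> /(_ (Xpar (cpsX R U_(0%R)%MM))) h.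
  have /h /(congr1 (fun z => Xcoef z (mnm2 1 0))) : Pu (Xpar (cpsX R U_(0%R)%MM)).
    by move=> m m0; rewrite gmX /sat_gen /=; case: eqP => // e; rewrite -e mnm2_0 in m0.
  by rewrite gmX /sat_gen /= eqxx => /eqP; rewrite oner_eq0.
- by move=> x hx; apply/nuE/hx; rewrite mnm0E.
move=> /(_ (Xpar (cpsX R U_(inord 1)%MM))) h.
have /h /(_ (mnm2 0 N)) : nonunits (Xpar (cpsX R U_(inord 1)%MM)).
  by apply/nuE; rewrite gmX (negbTE (sat_gen_neq0 alpha_gt0 beta_gt0 N_gt0 _)).
rewrite mnm2_0 gmX /sat_gen inordK //= eqxx => /(_ erefl) /eqP.
by rewrite oner_eq0.
Qed.

Lemma krull_dim_saturation : krull_dim Xs 2.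
Proof.
split; first exact: saturation_chain.
move=> h; apply: (@krull_dim_cps2_le R).
apply: (prime_chain_integral (f := [the {rmorphism _ -> _} of Xbase]) _ h).
exact: Xbase_integral.
Qed.

(** The Hilbert-Samuel polynomial has leading coefficient [N / 2]. *)
Lemma multiplicity_saturation : hilbert_samuel_multiplicity Xs N.
Proof.
pose p : {poly rat} := (N%:R / 2%:R) *: 'X^2 + ((2%:R - N%:R) / 2%:R) *: 'X.
exists 2%N, p; split.
- exact: krull_dim_saturation.
- exact: hilbert_samuel_saturation.
- apply: (leq_trans (size_polyD _ _)); rewrite geq_max.
  by rewrite !(leq_trans (size_scale_leq _ _)) ?size_polyXn ?size_polyX.
- rewrite /p coefD !coefZ coefXn coefX /= mulr1 mulr0 addr0.
  by rewrite -mulrA mulVf ?mulr1.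
Qed.

End KrullDimension.

Theorem corollary4p6 (R : realType) (alpha beta N : nat)
    (alpha_gt0 : (0 < alpha)%N) (beta_gt0 : (0 < beta)%N) (N_gt0 : (0 < N)%N)
    (beta_N_coprime : coprime beta N) :
  let Xs := lipschitz_saturation (hypersurface_normalization R alpha beta N) in
  [/\ toric_surface_singularity Xs,
      hilbert_samuel_multiplicity Xs N &
      embedding_dim Xs N.+1].
Proof.
split; first split.
- exact: toric_saturation.
- exact: krull_dim_saturation.
- exact: multiplicity_saturation.
- exact: embedding_dim_saturation.
Qed.
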